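(* There is a polynomial-time $3$-approximation algorithm for the colorful $k$-center problem. That is, there is a polynomial-time algorithm which, given an instance $(P, d, R, B, k, r, b)$ of colorful $k$-center that has a feasible solution, outputs a set $C \subseteq P$ with $|C| \le k$ such that $\bigcup_{c \in C} \mathcal{B}(c, 3\rho^* )$ contains at least $r$ red points and at least $b$ blue points, where $\rho^*$ is the optimal radius of the instance.
   Context: An instance of colorful $k$-center consists of a finite set $P$ of $n$ points with a metric $d$ on $P$, a partition $P = R \cup B$ into red points $R$ and blue points $B$, and integers $k, r, b \ge 0$. For $j \in P$ and $\rho \ge 0$, $\mathcal{B}(j,\rho) = \{p \in P : d(j,p) \le \rho\}$. A solution of radius $\rho$ is a set $C \subseteq P$ with $|C| \le k$ such that $\bigcup_{c\in C}\mathcal{B}(c,\rho)$ contains at least $r$ points of $R$ and at least $b$ points of $B$. The optimal radius $\rho^*$ is the minimum $\rho$ for which a solution of radius $\rho$ exists. *)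

(* Defs.v *)
From HB Require Import structures.
From mathcomp Require Import all_boot all_order all_algebra.
Set Implicit Arguments.
Unset Strict Implicit.
Unset Printing Implicit Defensive.
Import Order.TTheory GRing.Theory Num.Theory.
Local Open Scope ring_scope.

(* Colorful k-center.  Points are P = 'I_n, the metric d takes rational     *)
(* values, red p marks p \in R, and B = P \ R (the non-red points).         *)

Definition is_metric (n : nat) (d : 'I_n -> 'I_n -> rat) : Prop :=
  [/\ forall i j, 0 <= d i j,
      forall i j, d i j = 0 <-> i = j,
      forall i j, d i j = d j i
    & forall i j l, d i l <= d i j + d j l].

Definition ball (n : nat) (d : 'I_n -> 'I_n -> rat) (j : 'I_n) (rho : rat)
  : {set 'I_n} := [set p | d j p <= rho].

Definition covered (n : nat) (d : 'I_n -> 'I_n -> rat) (C : {set 'I_n})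
  (rho : rat) : {set 'I_n} := \bigcup_(c in C) ball d c rho.

Definition is_solution (n : nat) (d : 'I_n -> 'I_n -> rat) (red : 'I_n -> bool)
  (k r b : nat) (C : {set 'I_n}) (rho : rat) : Prop :=
  [/\ (#|C| <= k)%N,
      (r <= #|[set p in covered d C rho | red p]|)%N
    & (b <= #|[set p in covered d C rho | ~~ red p]|)%N].

Definition solvable (n : nat) (d : 'I_n -> 'I_n -> rat) (red : 'I_n -> bool)
  (k r b : nat) (rho : rat) : Prop :=
  0 <= rho /\ exists C, is_solution d red k r b C rho.

Definition is_opt_radius (n : nat) (d : 'I_n -> 'I_n -> rat) (red : 'I_n -> bool)
  (k r b : nat) (rho : rat) : Prop :=
  solvable d red k r b rho /\ forall rho', solvable d red k r b rho' -> rho <= rho'.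

(* Model of computation: a unit-cost RAM over unbounded integers with       *)
(* addition, subtraction, indirect addressing and conditional jumps (no     *)
(* multiplication), which is polynomially equivalent to Turing machines.    *)

Inductive instr : Type :=
  | IConst of nat & int          (* R[i] := c                    *)
  | IAdd of nat & nat & nat      (* R[i] := R[j] + R[l]          *)
  | ISub of nat & nat & nat      (* R[i] := R[j] - R[l]          *)
  | ILoad of nat & nat           (* R[i] := R[ |R[j]| ]          *)
  | IStore of nat & nat          (* R[ |R[i]| ] := R[j]          *)
  | IJgtz of nat & nat           (* if R[i] > 0 then goto l      *)
  | IHalt.

Record ram_state := RamState { pc : nat; regs : nat -> int }.

Definition upd (f : nat -> int) (i : nat) (v : int) : nat -> int :=
  fun x => if x == i then v else f x.

(* None = the machine has halted (Halt instruction or pc out of program) *)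
Definition ram_step (prog : seq instr) (s : ram_state) : option ram_state :=
  let R := regs s in
  let nx := (pc s).+1 in
  match nth IHalt prog (pc s) with
  | IConst i c => Some (RamState nx (upd R i c))
  | IAdd i j l => Some (RamState nx (upd R i (R j + R l)))
  | ISub i j l => Some (RamState nx (upd R i (R j - R l)))
  | ILoad i j => Some (RamState nx (upd R i (R `|R j|%N)))
  | IStore i j => Some (RamState nx (upd R `|R i|%N (R j)))
  | IJgtz i l => Some (RamState (if 0 < R i then l else nx) R)
  | IHalt => None
  end.

Fixpoint ram_run (prog : seq instr) (t : nat) (s : ram_state) : option ram_state :=
  match ram_step prog s with
  | None => Some s
  | Some s1 => if t is t'.+1 then ram_run prog t' s1 else None
  end.

Definition encode (n : nat) (d : 'I_n -> 'I_n -> rat) (red : 'I_n -> bool)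
  (k r b : nat) : seq int :=
  [:: n%:Z; k%:Z; r%:Z; b%:Z]
  ++ [seq (red i)%:Z | i <- enum 'I_n]
  ++ flatten [seq [:: numq (d i j); denq (d i j)] | i <- enum 'I_n, j <- enum 'I_n].

Definition bitlen (z : int) : nat := (trunc_log 2 `|z|%N).+1.

Definition input_size (s : seq int) : nat := \sum_(z <- s) bitlen z.

Definition init_state (s : seq int) : ram_state :=
  RamState 0 (fun i => nth 0 s i).

(* Output convention: R[0] = m and the centers are R[1], ..., R[m]. *)
Definition decode_output (n : nat) (s : ram_state) : {set 'I_n} :=
  [set i : 'I_n | has (fun j => regs s j == (i : nat)%:Z) (iota 1 `|regs s 0|%N)].

(* Main.v *)
Require Import Defs.
From HB Require Import structures.
From mathcomp Require Import all_boot all_order all_algebra zify ring lra.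
Set Implicit Arguments.
Unset Strict Implicit.
Unset Printing Implicit Defensive.
Import Order.TTheory GRing.Theory Num.Theory.
Local Open Scope ring_scope.

(** The optimal radius is one of the distances, so guess it; two points are
    adjacent when their distance is at most that radius, and covering within
    three hops suffices.  Let O be an optimal set of centres.

    If some ball meets the balls of two centres of O, three hops around its
    centre cover both, which frees one centre.  Otherwise the balls of O are far
    apart; guess the three centres of O that gain most red points when expanded
    from one hop to three, and let tau be the smallest of these gains.  Then the
    expansion yields 3 tau red points more than O needs, and no other ball of O
    has more than tau red points in its vicinity beyond its own.  Remove and
    label as a cluster whatever is close to a ball with more than 2 tau red
    points; in each such cluster at most one ball of O is involved, so the right
    clusters can be chosen exactly.  In what remains, every 2-hop cluster has at
    most 3 tau red points.

    The covering LP of the remaining points is solved by an integer perceptron,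
    which needs only polynomially many updates because a 0/1 solution exists.
    Clustering greedily by fractional coverage turns its solution into a
    fractional choice of disjoint clusters, and an extreme point of the choice
    polytope has at most two fractional coordinates: rounding loses one cluster
    (at most 3 tau red points), which the slack pays for, or is rounded up with
    the freed centre.  The integral choice itself is found by a subset-sum
    dynamic programme over the triples (centres, red points, blue points), so
    every guess is checked exactly and the best feasible radius is kept.

    On the machine side, this algorithm is a program of a small loop language
    whose running time is a syntactic polynomial, compiled to the RAM.  A
    hand-written prologue moves the input into the memory layout of the compiler
    and bounds the bit lengths, since products have to be computed by doubling. *)

(** Integrality is what makes an approximate LP solution good enough. A perceptron needs a positive
    margin, so the LP is solved only up to a slack 1/N with N = |T| + 1: multiplying each constraint
    by N and adding the homogenizing coordinate t gives a 0/1 solution margin 1 and keeps the rows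
    integral and polynomially small. Bringing the total mass from k + 1/N back to k costs at most
    |T|/N more. Each requirement is thus missed by strictly less than 1/N + |T|/N = 1, a deficit
    that an integral choice of clusters cannot have. Red points or a centre are lost only at the two
    fractional clusters.

    One right guess suffices, but it must lead to a solution for whatever LP solution and clustering
    the program happens to find; this is why [good_guess] quantifies over both.

    The machine model adds two constraints: the input fills the low addresses from the start, and
    the output convention scans every cell from 1 to R[0], so memory has to be rearranged before the
    computation and cleaned after it. *)

Definition memory := nat -> int.

(** * Execution of RAM code with step bounds *)

Inductive steps (prog : seq instr) : nat -> ram_state -> ram_state -> Prop :=
| steps0 s : steps prog 0 s s
| stepsS t s s1 s2 :
    ram_step prog s = Some s1 -> steps prog t s1 s2 -> steps prog t.+1 s s2.

(** An upper bound instead of an exact count lets a conditional be charged for both branches, so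
    that costs depend on the syntax only. *)
Definition reach prog T s s' := exists2 t, (t <= T)%N & steps prog t s s'.

Section Reach.
Variable prog : seq instr.
Implicit Types (s : ram_state) (m : memory).

Lemma steps_trans t1 t2 s1 s2 s3 :
  steps prog t1 s1 s2 -> steps prog t2 s2 s3 -> steps prog (t1 + t2) s1 s3.
Proof. by elim=> // t s s1' s2' E _ IH /IH; apply: stepsS E. Qed.

Lemma reach_refl T s : reach prog T s s.
Proof. by exists 0%N => //; apply: steps0. Qed.

Lemma reach_trans T1 T2 s1 s2 s3 :
  reach prog T1 s1 s2 -> reach prog T2 s2 s3 -> reach prog (T1 + T2) s1 s3.
Proof.
move=> [t1 h1 S1] [t2 h2 S2]; exists (t1 + t2)%N; first exact: leq_add.
exact: steps_trans S2.
Qed.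

Lemma reach_le T1 T2 s1 s2 :
  (T1 <= T2)%N -> reach prog T1 s1 s2 -> reach prog T2 s1 s2.
Proof. by move=> le [t h S]; exists t => //; apply: leq_trans le. Qed.

Lemma reach_step T s1 s2 s3 :
  ram_step prog s1 = Some s2 -> reach prog T s2 s3 -> reach prog T.+1 s1 s3.
Proof. by move=> E [t h S]; exists t.+1 => //; apply: stepsS S. Qed.

Lemma reach_run T s s' :
  reach prog T s s' -> ram_step prog s' = None -> ram_run prog T s = Some s'.
Proof.
move=> [t le S] N; elim: S T le N => [s0|t0 s0 s1 s2 E _ IH] T.
  by move=> _ N; case: T => [|T] /=; rewrite N.
by case: T => // T le N /=; rewrite E; apply: IH.
Qed.

Lemma reach_trans_pc T1 T2 s1 p q m s3 :
  reach prog T1 s1 (RamState p m) -> reach prog T2 (RamState q m) s3 -> p = q ->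
  reach prog (T1 + T2) s1 s3.
Proof. by move=> R1 R2 E; rewrite E in R1; apply: reach_trans R2. Qed.

Lemma reach_cast T T' s1 p q m :
  reach prog T s1 (RamState p m) -> p = q -> (T <= T')%N ->
  reach prog T' s1 (RamState q m).
Proof. by move=> R <- le; apply: reach_le R. Qed.

Definition code_at base (code : seq instr) :=
  forall i, (i < size code)%N -> nth IHalt prog (base + i) = nth IHalt code i.

Lemma code_at_cat base c1 c2 : code_at base (c1 ++ c2) <->
  code_at base c1 /\ code_at (base + size c1) c2.
Proof.
split=> [H|[H1 H2] i].
  split=> i lt; [rewrite H|rewrite -addnA H]; rewrite ?nth_cat ?size_cat.
  - by rewrite lt.
  - by rewrite (leq_trans lt) ?leq_addr.
  - by rewrite ltnNge leq_addr /= addKn.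
  - by rewrite ltn_add2l.
rewrite size_cat nth_cat => lt; case: ltnP => le; first exact: H1.
by rewrite -(H2 (i - size c1)%N) ?ltn_subLR // -addnA subnKC.
Qed.

Lemma code_at_cons base i c : code_at base (i :: c) <->
  nth IHalt prog base = i /\ code_at base.+1 c.
Proof.
rewrite -cat1s code_at_cat /= addn1; split=> -[H1 H2]; split=> //.
  by have := H1 0%N isT; rewrite addn0.
by case=> // _; rewrite addn0.
Qed.

Lemma code_at_take k base c : code_at base c -> code_at base (take k c).
Proof. by rewrite -{1}(cat_take_drop k c) code_at_cat => -[]. Qed.

Lemma code_at_drop k base c : code_at base c -> code_at (base + k) (drop k c).
Proof.
move=> C i; rewrite size_drop nth_drop -addnA => lt; apply: C; lia.
Qed.

Definition exec1 (m : memory) (i : instr) : memory :=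
  match i with
  | IConst i c => upd m i c
  | IAdd i j l => upd m i (m j + m l)
  | ISub i j l => upd m i (m j - m l)
  | ILoad i j => upd m i (m `|m j|%N)
  | IStore i j => upd m `|m i|%N (m j)
  | _ => m
  end.

Definition nojump i := match i with IJgtz _ _ | IHalt => false | _ => true end.

Lemma reach_straight code base m : code_at base code -> all nojump code ->
  reach prog (size code) (RamState base m)
    (RamState (base + size code) (foldl exec1 m code)).
Proof.
elim: code base m => [|i c IH] base m /=.
  by rewrite addn0 => _ _; apply: reach_refl.
rewrite code_at_cons => -[E C] /andP[nj A].
apply: (@reach_step _ _ (RamState base.+1 (exec1 m i))); last first.
  by rewrite addnS -addSn; apply: IH.
by rewrite /ram_step /= E; case: i nj {E}.
Qed.

Lemma reach_one base i m : nth IHalt prog base = i -> nojump i ->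
  reach prog 1 (RamState base m) (RamState base.+1 (exec1 m i)).
Proof.
move=> E nj; apply: reach_step (reach_refl _ _).
by rewrite /ram_step /= E; case: i nj {E}.
Qed.

Lemma reach_jgtz base i l m : nth IHalt prog base = IJgtz i l ->
  reach prog 1 (RamState base m) (RamState (if 0 < m i then l else base.+1) m).
Proof.
move=> E; apply: reach_step (reach_refl _ _).
by rewrite /ram_step /= E.
Qed.

End Reach.

(** * A loop language whose running time is a syntactic polynomial *)

Inductive expr :=
| Cst of int
| Var of nat
| Arr of nat & expr
| Add of expr & expr
| Sub of expr & expr
| Ifp of expr & expr & expr
| Sum of nat & nat & expr.

(** Loops and sums are bounded by the value of a scalar, and [wfc] places that scalar among those
    the code cannot assign. Nesting depth thus becomes the degree of the time bound. There is no
    product, as on the RAM. *)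
Inductive cmd :=
| Skip
| Asg of nat & expr
| Sto of nat & expr & expr
| Seq of cmd & cmd
| If of expr & cmd & cmd
| For of nat & nat & cmd.

Record store := Store { sc : nat -> int; ar : nat -> nat -> int }.

Definition sset x v (s : store) := Store (upd (sc s) x v) (ar s).
Definition aset a i v (s : store) :=
  Store (sc s) (fun a' => if a' == a then upd (ar s a) i v else ar s a').

(** A negative bound means no iteration, in agreement with the test for a positive counter in the
    compiled loop. *)
Definition cnt (z : int) : nat := if z is Posz m then m else 0%N.

Lemma cnt_gt0 z : (0 < z) = (0 < cnt z)%N.
Proof. by case: z. Qed.

Fixpoint eval (s : store) (e : expr) : int :=
  match e with
  | Cst z => z
  | Var x => sc s x
  | Arr a e1 => ar s a `|eval s e1|%N
  | Add e1 e2 => eval s e1 + eval s e2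
  | Sub e1 e2 => eval s e1 - eval s e2
  | Ifp e1 e2 e3 => if 0 < eval s e1 then eval s e2 else eval s e3
  | Sum b x e1 => \sum_(0 <= i < cnt (sc s b)) eval (sset x i%:Z s) e1
  end.

Fixpoint run (c : cmd) (s : store) : store :=
  match c with
  | Skip => s
  | Asg x e => sset x (eval s e) s
  | Sto a e1 e2 => aset a `|eval s e1|%N (eval s e2) s
  | Seq c1 c2 => run c2 (run c1 s)
  | If e c1 c2 => if 0 < eval s e then run c1 s else run c2 s
  | For b x c1 => foldl (fun s i => run c1 (sset x i%:Z s)) s
                        (iota 0 (cnt (sc s b)))
  end.

(* Memory layout: cells 0 and 1 hold the constants 0 and 1, then come NV
   scalars, then ND temporaries; cell i of array a is OFF + NA * i + a, so that
   the arrays are interleaved and unbounded. *)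
Definition NV := 60%N.
Definition ND := 138%N.
Definition OFF := 200%N.
Definition NA := 18%N.
Lemma NAE : NA = 18%N. Proof. by []. Qed.
Opaque NA.
Definition tmp d := (2 + NV + d)%N.
Definition cell a i := (OFF + NA * i + a)%N.

(** Scalars below [q] are read-only and the only ones allowed as bounds; [d] is the first free
    temporary. A sum takes four temporaries for itself: accumulator, saved index, remaining count,
    current index. *)
Fixpoint wfe (q d : nat) (e : expr) : bool :=
  match e with
  | Cst _ => (d < ND)%N
  | Var x => (x < NV)%N && (d < ND)%N
  | Arr a e1 => [&& (a < NA)%N, (d.+1 < ND)%N & wfe q d e1]
  | Add e1 e2 | Sub e1 e2 => wfe q d e1 && wfe q d.+1 e2
  | Ifp e1 e2 e3 => [&& wfe q d e1, wfe q d e2 & wfe q d e3]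
  | Sum b x e1 => [&& (b < q)%N, (q <= x < NV)%N & wfe q d.+4 e1]
  end.

Fixpoint wfc (q d : nat) (c : cmd) : bool :=
  match c with
  | Skip => true
  | Asg x e => (q <= x < NV)%N && wfe q d e
  | Sto a e1 e2 => [&& (a < NA)%N, (d.+2 < ND)%N, wfe q d e1 & wfe q d.+1 e2]
  | Seq c1 c2 => wfc q d c1 && wfc q d c2
  | If e c1 c2 => [&& wfe q d e, wfc q d c1 & wfc q d c2]
  | For b x c1 => [&& (b < q)%N, (q <= x < NV)%N, (d.+1 < ND)%N & wfc q d.+2 c1]
  end.

(** The index enters in absolute value, as in indirect addressing on the RAM: the leading
    subtraction negates it and is jumped over when it is positive. The factor [NA] is unrolled into
    additions. *)
Definition absaddr d d' a : seq instr :=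
  [:: ISub (tmp d) 0 (tmp d); IConst (tmp d') (OFF + a)%N%:Z]
  ++ nseq NA (IAdd (tmp d') (tmp d') (tmp d)).

(** The value is left in [tmp d], and temporaries below [d] are kept for pending operands. Jump
    targets are absolute, hence [base]; [IJgtz 1 l] is an unconditional jump because cell 1 holds 1.
    A sum saves and restores its index, so that evaluation changes no scalar. *)
Fixpoint cexp (d base : nat) (e : expr) : seq instr :=
  match e with
  | Cst z => [:: IConst (tmp d) z]
  | Var x => [:: IAdd (tmp d) x.+2 0]
  | Arr a e1 => let c1 := cexp d base e1 in let b := (base + size c1)%N in
      c1 ++ IJgtz (tmp d) b.+2 :: absaddr d d.+1 a ++ [:: ILoad (tmp d) (tmp d.+1)]
  | Add e1 e2 => let c1 := cexp d base e1 in
      c1 ++ cexp d.+1 (base + size c1) e2 ++ [:: IAdd (tmp d) (tmp d) (tmp d.+1)]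
  | Sub e1 e2 => let c1 := cexp d base e1 in
      c1 ++ cexp d.+1 (base + size c1) e2 ++ [:: ISub (tmp d) (tmp d) (tmp d.+1)]
  | Ifp e1 e2 e3 =>
      let c1 := cexp d base e1 in let b := (base + size c1)%N in
      let c3 := cexp d b.+1 e3 in let b' := (b.+2 + size c3)%N in
      let c2 := cexp d b' e2 in
      c1 ++ IJgtz (tmp d) b' :: c3 ++ IJgtz 1 (b' + size c2) :: c2
  | Sum b x e1 =>
      let h := base.+4 in
      let c1 := cexp d.+4 h.+4.+1 e1 in
      [:: IConst (tmp d) 0; IAdd (tmp d.+1) x.+2 0; IAdd (tmp d.+2) b.+2 0;
          IConst (tmp d.+3) 0;
          IJgtz (tmp d.+2) h.+2; IJgtz 1 (h + size c1 + 7);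
          IAdd x.+2 (tmp d.+3) 0; IAdd (tmp d.+3) (tmp d.+3) 1;
          ISub (tmp d.+2) (tmp d.+2) 1]
      ++ c1 ++ [:: IAdd (tmp d) (tmp d) (tmp d.+4); IJgtz 1 h; IAdd x.+2 (tmp d.+1) 0]
  end.

Fixpoint ccmd (d base : nat) (c : cmd) : seq instr :=
  match c with
  | Skip => [::]
  | Asg x e => cexp d base e ++ [:: IAdd x.+2 (tmp d) 0]
  | Sto a e1 e2 =>
      let c1 := cexp d base e1 in
      let c2 := cexp d.+1 (base + size c1) e2 in
      let b := (base + size c1 + size c2)%N in
      c1 ++ c2 ++ IJgtz (tmp d) b.+2 :: absaddr d d.+2 a
        ++ [:: IStore (tmp d.+2) (tmp d.+1)]
  | Seq c1 c2 => let k1 := ccmd d base c1 in k1 ++ ccmd d (base + size k1) c2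
  | If e c1 c2 =>
      let k := cexp d base e in let b := (base + size k)%N in
      let k2 := ccmd d b.+1 c2 in let b' := (b.+2 + size k2)%N in
      let k1 := ccmd d b' c1 in
      k ++ IJgtz (tmp d) b' :: k2 ++ IJgtz 1 (b' + size k1) :: k1
  | For b x c1 =>
      let h := base.+2 in
      let k := ccmd d.+2 h.+4.+1 c1 in
      [:: IAdd (tmp d) b.+2 0; IConst (tmp d.+1) 0;
          IJgtz (tmp d) h.+2; IJgtz 1 (h + size k + 6);
          IAdd x.+2 (tmp d.+1) 0; IAdd (tmp d.+1) (tmp d.+1) 1;
          ISub (tmp d) (tmp d) 1]
      ++ k ++ [:: IJgtz 1 h]
  end.

Fixpoint ecost (B : nat) (e : expr) : nat :=
  match e with
  | Cst _ | Var _ => 1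
  | Arr _ e1 => ecost B e1 + (NA + 4)
  | Add e1 e2 | Sub e1 e2 => ecost B e1 + ecost B e2 + 1
  | Ifp e1 e2 e3 => ecost B e1 + ecost B e2 + ecost B e3 + 2
  | Sum _ _ e1 => B * (ecost B e1 + 6) + 7
  end.

Fixpoint ccost (B : nat) (c : cmd) : nat :=
  match c with
  | Skip => 0
  | Asg _ e => ecost B e + 1
  | Sto _ e1 e2 => ecost B e1 + ecost B e2 + (NA + 4)
  | Seq c1 c2 => ccost B c1 + ccost B c2
  | If e c1 c2 => ecost B e + ccost B c1 + ccost B c2 + 2
  | For _ _ c1 => B * (ccost B c1 + 5) + 4
  end.

(** * Correctness of the compiler *)

Record agree (s : store) (m : memory) : Prop := Agree {
  ag0 : m 0%N = 0;
  ag1 : m 1%N = 1;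
  agv : forall x, (x < NV)%N -> m x.+2 = sc s x;
  aga : forall a i, (a < NA)%N -> m (cell a i) = ar s a i }.

Lemma updE m i v j : upd m i v j = if j == i then v else m j.
Proof. by []. Qed.

Lemma upd_neq m i v j : j != i -> upd m i v j = m j.
Proof. by rewrite updE => /negbTE->. Qed.

Lemma upd_eq m i v : upd m i v i = v.
Proof. by rewrite updE eqxx. Qed.

Lemma agree_tmp s m d v : (d < ND)%N -> agree s m -> agree s (upd m (tmp d) v).
Proof.
rewrite /ND => ltd [A0 A1 Av Aa]; split.
- by rewrite upd_neq // /tmp; lia.
- by rewrite upd_neq // /tmp; lia.
- by move=> x lx; rewrite upd_neq ?Av // /tmp; lia.
- by move=> a i la; rewrite upd_neq ?Aa // /cell /tmp /NV /OFF; lia.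
Qed.

Lemma agree_set s m x v : (x < NV)%N -> agree s m ->
  agree (sset x v s) (upd m x.+2 v).
Proof.
move=> lx [A0 A1 Av Aa]; split=> //=.
  by move=> y ly; rewrite !updE !eqSS; case: ifP => // _; apply: Av.
move=> a i la; rewrite upd_neq ?Aa //.
by move: lx; rewrite /cell /NV /OFF; lia.
Qed.

Lemma agree_aset s m a i v : (a < NA)%N -> agree s m ->
  agree (aset a i v s) (upd m (cell a i) v).
Proof.
move=> la [A0 A1 Av Aa]; split=> //=.
  move=> x lx; rewrite upd_neq ?Av //.
  by move: lx; rewrite /cell /NV /OFF; lia.
move=> a' i' la'; rewrite updE.
have ->: (cell a' i' == cell a i) = (a' == a) && (i' == i).
  by move: la la'; rewrite /cell NAE; lia.
by case: eqP => [->|_] /=; rewrite ?updE ?Aa.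
Qed.

Lemma tmp_inj d d' : (tmp d == tmp d') = (d == d').
Proof. by rewrite /tmp eqn_add2l. Qed.

Lemma tmpSS x d : (x < NV)%N -> (x.+2 == tmp d) = false.
Proof. by rewrite /tmp; lia. Qed.

Lemma wfe_d q d e : wfe q d e -> (d < ND)%N.
Proof.
elim: e d => //=.
- by move=> x d /andP[].
- by move=> a e _ d /and3P[_ /ltnW].
- by move=> e1 IH e2 _ d /andP[/IH].
- by move=> e1 IH e2 _ d /andP[/IH].
- by move=> e1 IH e2 _ e3 _ d /andP[/IH].
- by move=> b x e IH d /and3P[_ _ /IH]; lia.
Qed.

Lemma addr_code d d' a (m : memory) : d != d' ->
  let m' := foldl exec1 m (IConst (tmp d') (OFF + a)%N%:Z ::
                           nseq NA (IAdd (tmp d') (tmp d') (tmp d))) in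
  m' (tmp d') = (OFF + a)%N%:Z + m (tmp d) *+ NA
  /\ forall j, j != tmp d' -> m' j = m j.
Proof.
move=> dd' /=; set m1 := upd _ _ _.
have E1 : m1 (tmp d') = (OFF + a)%N%:Z by rewrite /m1 updE eqxx.
have E2 : m1 (tmp d) = m (tmp d) by rewrite /m1 upd_neq ?tmp_inj.
have E3 j : j != tmp d' -> m1 j = m j by move=> nj; rewrite /m1 upd_neq.
rewrite -[X in X + _]E1 -E2.
have: forall j, j != tmp d' ->
    foldl exec1 m1 (nseq NA (IAdd (tmp d') (tmp d') (tmp d))) j = m1 j.
  move=> j nj; elim: NA (m1) => [|k IH] m2 //=.
  by rewrite IH upd_neq.
move=> H; split=> [|j nj]; last by rewrite H ?E3.
elim: NA (m1) => [|k IH] m2 /=; first by rewrite addr0.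
by rewrite IH updE eqxx upd_neq ?tmp_inj // mulrSr -addrA [X in _ + X]addrC.
Qed.

Lemma reach_addr prog b d d' a (m : memory) : d != d' -> m 0%N = 0 ->
  code_at prog b (IJgtz (tmp d) b.+2 :: absaddr d d' a) ->
  exists m', [/\ reach prog (NA + 3) (RamState b m) (RamState (b + NA + 3) m'),
    m' (tmp d') = (cell a `|m (tmp d)|%N)%:Z
    & forall j, j != tmp d -> j != tmp d' -> m' j = m j].
Proof.
move=> dd' m0; rewrite code_at_cons /absaddr /= code_at_cons => -[E1 [E2 C]].
have cellE z : 0 <= z ->
    ((OFF + a)%N%:Z + z *+ NA : int) = (cell a `|z|%N)%:Z.
  by rewrite /cell; case: z => // k _; rewrite -mulr_natl NAE; lia.
pose m1 := if 0 < m (tmp d) then m else upd m (tmp d) (0 - m (tmp d)).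
have m1d : m1 (tmp d) = `|m (tmp d)|%:Z.
  rewrite /m1; case: ifP => h; first by lia.
  by rewrite updE eqxx; lia.
have m1j j : j != tmp d -> m1 j = m j.
  by rewrite /m1; case: ifP => // _ nj; rewrite upd_neq.
have R1 : reach prog 2 (RamState b m) (RamState b.+2 m1).
  rewrite /m1; case: ifP => h.
    have := reach_jgtz m E1; rewrite h; exact: reach_le.
  have := reach_jgtz m E1; rewrite h => R; apply: (reach_trans R (T2 := 1)).
  by apply: reach_step (reach_refl _ _ _); rewrite /ram_step /= E2 /= m0.
have [A1 A2] := @addr_code d d' a m1 dd'.
set m2 := foldl _ _ _ in A1 A2; exists m2; split.
- have -> : (NA + 3 = 2 + (1 + NA))%N by lia.
  apply: reach_trans R1 _.
  have := reach_straight m1 C; rewrite /= size_nseq /=.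
  have -> : (b.+2 + NA.+1 = b + NA + 3)%N by lia.
  by apply; rewrite all_nseq orbT.
- by rewrite A1 m1d cellE // absz_nat.
- by move=> j jd jd'; rewrite A2 // m1j.
Qed.

Lemma size_absaddr d d' a : size (absaddr d d' a) = NA.+2.
Proof. by rewrite size_cat size_nseq. Qed.

Opaque absaddr.

Ltac pcs := rewrite /= ?size_cat /= ?size_cat /= ?(size_nseq, size_absaddr) /=; lia.

Ltac neqs := solve [ done | rewrite tmp_inj; lia | rewrite tmpSS //
  | rewrite eq_sym tmpSS // | rewrite /tmp; lia ].
Ltac mems := repeat first [ rewrite upd_eq | rewrite upd_neq; [|by neqs] ].

Section ExprCorrect.
Variable prog : seq instr.

Lemma cexp_ok q B e d base s m : wfe q d e -> code_at prog base (cexp d base e) ->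
  agree s m -> (forall b, (b < q)%N -> (cnt (sc s b) <= B)%N) ->
  exists m', [/\ reach prog (ecost B e) (RamState base m)
                       (RamState (base + size (cexp d base e)) m'),
    agree s m', m' (tmp d) = eval s e
    & forall j, (j < d)%N -> m' (tmp j) = m (tmp j)].
Proof.
elim: e d base s m => [z|x|a e1 IH1|e1 IH1 e2 IH2|e1 IH1 e2 IH2|e1 IH1 e2 IH2 e3 IH3|b x e1 IH1]
  d base s m W C A ro; have ltd := wfe_d W; rewrite /= in W C *.
- exists (upd m (tmp d) z); split.
  + exact: (reach_straight m C).
  + exact: agree_tmp.
  + by rewrite updE eqxx.
  + by move=> j lj; rewrite upd_neq // tmp_inj ltn_eqF.
- move: W => /andP[lx _].
  exists (upd m (tmp d) (m x.+2 + m 0%N)); split.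
  + exact: (reach_straight m C).
  + exact: agree_tmp.
  + by rewrite updE eqxx (ag0 A) addr0 (agv A).
  + by move=> j lj; rewrite upd_neq // tmp_inj ltn_eqF.
- move: W => /and3P[la ld W1].
  move: C; set c1 := cexp d base e1.
  rewrite code_at_cat => -[C1]; rewrite -cat_cons code_at_cat => -[C2 C3].
  have [m1 [R1 A1 V1 P1]] := IH1 d base s m W1 C1 A ro.
  have [|m2 [R2 V2 P2]] := @reach_addr prog _ _ _ _ m1 _ (ag0 A1) C2.
    by rewrite ltn_eqF.
  have A2 : agree s m2.
    split.
    + by rewrite P2 ?(ag0 A1) // /tmp; lia.
    + by rewrite P2 ?(ag1 A1) // /tmp; lia.
    + by move=> y ly; rewrite P2 ?(agv A1) ?tmpSS.
    + move=> a' i la'; rewrite P2 ?(aga A1) //; rewrite /cell /tmp /OFF /NV;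
      move: ld; rewrite /ND; lia.
  exists (upd m2 (tmp d) (m2 `|m2 (tmp d.+1)|%N)); split.
  + have R3 := reach_straight m2 C3 isT.
    apply: reach_cast (reach_trans R1 (reach_trans_pc R2 R3 _)) _ _.
    * by pcs.
    * by pcs.
    * by pcs.
  + exact: agree_tmp.
  + by rewrite updE eqxx V2 absz_nat (aga A2) // V1.
  + by move=> j lj; rewrite upd_neq ?tmp_inj ?P2 ?tmp_inj ?P1 //; lia.
- move: W => /andP[W1 W2]; have ltd1 := wfe_d W2.
  move: C; set c1 := cexp d base e1; set c2 := cexp d.+1 _ e2.
  rewrite !code_at_cat => -[C1 [C2 C3]].
  have [m1 [R1 A1 V1 P1]] := IH1 d base s m W1 C1 A ro.
  have [m2 [R2 A2 V2 P2]] := IH2 d.+1 _ s m1 W2 C2 A1 ro.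
  exists (upd m2 (tmp d) (m2 (tmp d) + m2 (tmp d.+1))); split.
  + have := reach_straight m2 C3 isT => R3.
    have := reach_trans (reach_trans R1 R2) R3.
    by rewrite !size_cat /= -!addnA.
  + exact: agree_tmp.
  + by rewrite updE eqxx V2 P2 ?V1.
  + by move=> j lj; rewrite upd_neq ?tmp_inj ?P2 ?P1 //; lia.
- move: W => /andP[W1 W2]; have ltd1 := wfe_d W2.
  move: C; set c1 := cexp d base e1; set c2 := cexp d.+1 _ e2.
  rewrite !code_at_cat => -[C1 [C2 C3]].
  have [m1 [R1 A1 V1 P1]] := IH1 d base s m W1 C1 A ro.
  have [m2 [R2 A2 V2 P2]] := IH2 d.+1 _ s m1 W2 C2 A1 ro.
  exists (upd m2 (tmp d) (m2 (tmp d) - m2 (tmp d.+1))); split.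
  + have := reach_straight m2 C3 isT => R3.
    have := reach_trans (reach_trans R1 R2) R3.
    by rewrite !size_cat /= -!addnA.
  + exact: agree_tmp.
  + by rewrite updE eqxx V2 P2 ?V1.
  + by move=> j lj; rewrite upd_neq ?tmp_inj ?P2 ?P1 //; lia.
- move: W => /and3P[W1 W2 W3].
  move: C; set c1 := cexp d base e1; set b1 := (base + size c1)%N.
  set c3 := cexp d b1.+1 e3; set b2 := (b1.+2 + size c3)%N.
  set c2 := cexp d b2 e2.
  rewrite code_at_cat code_at_cons code_at_cat code_at_cons.
  have -> : ((base + size c1).+1 + size c3).+1 = b2 by rewrite /b2 /b1; lia.
  move=> -[C1 [J1 [C3 [J2 C2]]]].
  have [m1 [R1 A1 V1 P1]] := IH1 d base s m W1 C1 A ro.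
  have R1' := reach_trans R1 (reach_jgtz m1 J1).
  rewrite V1 in R1'; rewrite size_cat /= size_cat /=.
  have -> : (base + (size c1 + (size c3 + (size c2).+1).+1) = b2 + size c2)%N.
    by rewrite /b2 /b1; lia.
  case: ifP R1' => pos R1'.
    have [m2 [R2 A2 V2 P2]] := IH2 d _ s m1 W2 C2 A1 ro.
    exists m2; split => //; last by move=> j lj; rewrite P2 ?P1.
    by have := reach_trans R1' R2; apply: reach_le; lia.
  have [m2 [R2 A2 V2 P2]] := IH3 d _ s m1 W3 C3 A1 ro.
  exists m2; split => //; last by move=> j lj; rewrite P2 ?P1.
  have R3 := reach_jgtz m2 J2; rewrite (ag1 A2) ltr01 in R3.
  by have := reach_trans (reach_trans R1' R2) R3; apply: reach_le; lia.
move: W => /and3P[lb /andP[lqx lx] W1]; have ltd4 := wfe_d W1.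
move: C; set c1 := cexp d.+4 _ e1; set h := base.+4.
move=> C; have Ci : code_at prog base [:: _; _; _; _] := @code_at_take _ 4 _ _ C.
have {C} := @code_at_drop _ 4 _ _ C; rewrite addn4 -/h /=.
rewrite code_at_cons code_at_cons => -[J1 [J2 C]].
have := @code_at_take _ 3 _ _ C; rewrite /= take0 => Cs.
have {C} := @code_at_drop _ 3 _ _ C; rewrite addn3 /= ?drop0 code_at_cat => -[C1].
rewrite code_at_cons code_at_cons code_at_cons => -[Ca [J3 [Cx _]]].
set n := cnt (sc s b).
have leB : (n <= B)%N by apply: ro.
(* [k] iterations remain and [i] are done. The scalar [x] holds a stale index here, hence some [v];
   its old value waits in [tmp d.+1] and returns after the loop. *)
have inv : forall k i m1, (k + i = n)%N ->
  (exists v, agree (sset x v s) m1) -> m1 (tmp d) = \sum_(0 <= j < i) eval (sset x j%:Z s) e1 ->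
  m1 (tmp d.+1) = sc s x -> cnt (m1 (tmp d.+2)) = k -> m1 (tmp d.+3) = i%:Z ->
  (forall j, (j < d)%N -> m1 (tmp j) = m (tmp j)) ->
  exists m2, [/\ reach prog (k * (ecost B e1 + 6) + 2) (RamState h m1)
      (RamState (h + size c1 + 7) m2), exists v, agree (sset x v s) m2,
     m2 (tmp d) = \sum_(0 <= j < n) eval (sset x j%:Z s) e1,
     m2 (tmp d.+1) = sc s x & forall j, (j < d)%N -> m2 (tmp j) = m (tmp j)].
  elim=> [|k IHk] i m1 ki [v Av] Vs Vx Vk Vi Vj.
    rewrite add0n in ki; exists m1; split; rewrite -?ki //; last by exists v.
    have R1 := reach_jgtz m1 J1; rewrite cnt_gt0 Vk /= in R1.
    have R2 := reach_jgtz m1 J2; rewrite (ag1 Av) ltr01 in R2.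
    exact: reach_cast (reach_trans R1 R2) _ _.
  have R1 := reach_jgtz m1 J1; rewrite cnt_gt0 Vk /= in R1.
  have R2 := reach_straight m1 Cs isT.
  set m2 := foldl _ _ _ in R2.
  have A2 : agree (sset x i%:Z s) m2.
    rewrite /m2 /= (ag0 Av) addr0 Vi; apply: agree_tmp; first by lia.
    apply: agree_tmp; first by lia.
    have := agree_set i%:Z lx Av.
    have E1 y : (if y == x then i%:Z else (if y == x then v else sc s y)) = (if y == x then i%:Z else sc s y) by case: eqP.
    case=> B0 B1 Bv Ba; split=> // y ly; rewrite Bv //=; exact: E1.
  have V2 j : (j <= d.+1)%N || (j == d.+4)%N -> m2 (tmp j) = m1 (tmp j).
    move=> lj; rewrite /m2 /= !upd_neq // ?tmp_inj //; try by lia.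
    by rewrite eq_sym tmpSS.
  have ro2 b0 : (b0 < q)%N -> (cnt (sc (sset x i%:Z s) b0) <= B)%N.
    by move=> lb0; rewrite /= upd_neq ?ro //; lia.
  have [m3 [R3 A3 V3 P3]] := IH1 d.+4 _ _ _ W1 C1 A2 ro2.
  have R4 := reach_one m3 Ca isT; set m4 := exec1 _ _ in R4.
  have A4 : agree (sset x i%:Z s) m4 by apply: agree_tmp.
  have R5 := reach_jgtz m4 J3; rewrite (ag1 A4) ltr01 in R5.
  have [||||||m5 [R6 A5 V5 X5 P5]] := IHk i.+1 m4 _ (ex_intro _ _ A4).
  - by lia.
  - rewrite /m4 /= updE eqxx V3 P3 ?V2 ?Vs // ?leqnSn //; last by lia.
    by rewrite big_nat_recr.
  - by rewrite /m4 /= upd_neq ?tmp_inj ?P3 ?V2 //; lia.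
  - rewrite /m4 /= upd_neq ?tmp_inj; last by lia.
    rewrite P3; last by lia.
    rewrite /m2 /=; mems; rewrite (ag1 Av).
    by move: Vk; case: (m1 _) => -[|?] //= [<-]; rewrite ?subzSS ?subr0; lia.
  - rewrite /m4 /= upd_neq ?tmp_inj; last by lia.
    rewrite P3; last by lia.
    by rewrite /m2 /=; mems; rewrite (ag1 Av) Vi; lia.
  - by move=> j lj; rewrite /m4 /= upd_neq ?tmp_inj ?P3 ?V2 ?Vj //; lia.
  exists m5; split=> //.
  have RR := reach_trans_pc R1 R2 erefl.
  have {}RR := reach_trans (reach_trans_pc (reach_trans_pc RR R3 _) R4 _) R5.
  apply: reach_cast (reach_trans_pc (RR _ _) R6 _) _ _ => //; rewrite ?addn3 //.
  by rewrite -/c1; pcs.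
have R0 := reach_straight m Ci isT; set m0 := foldl _ _ _ in R0.
have Ax : agree (sset x (sc s x) s) m.
  case: A => B0 B1 Bv Ba; split=> //= y ly; rewrite updE Bv //.
  by case: eqP => [->|].
have A0 : agree (sset x (sc s x) s) m0.
  by rewrite /m0 /=; do 4?[apply: agree_tmp; first by lia].
have lbV : (b < NV)%N by lia.
have [|||||m1 [R1 [v A1] V1 X1 P1]] := inv n 0%N m0 (addn0 n) (ex_intro _ _ A0).
- by rewrite /m0 /= big_nil; mems.
- by rewrite /m0 /=; mems; rewrite (ag0 A) addr0 (agv A).
- by rewrite /m0 /=; mems; rewrite (ag0 A) addr0 (agv A).
- by rewrite /m0 /=; mems.
- by move=> j lj; rewrite /m0 /=; mems.
have R2 := reach_one m1 Cx isT; set m2 := exec1 _ _ in R2.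
exists m2; split.
- apply: reach_cast (reach_trans_pc (reach_trans_pc R0 R1 _) R2 _) _ _.
  + by rewrite /h /= addn4.
  + by rewrite -/c1; lia.
  + by pcs.
  + by have := leq_mul leB (leqnn (ecost B e1 + 6)); rewrite /=; lia.
- rewrite /m2 /= (ag0 A1) addr0 X1.
  have [B0 B1 Bv Ba] := agree_set (sc s x) lx A1; split=> // y ly.
  by rewrite Bv //= !updE; case: eqP => [->|].
- by rewrite /m2 /= upd_neq ?V1 // eq_sym tmpSS.
- by move=> j lj; rewrite /m2 /= upd_neq ?P1 // eq_sym tmpSS.
Qed.

Lemma wfc_ro q d c s x : wfc q d c -> (x < q)%N -> sc (run c s) x = sc s x.
Proof.
elim: c d s => [|y e|a e1 e2|c1 IH1 c2 IH2|e c1 IH1 c2 IH2|b y c IH] d s //=.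
- by move=> /andP[/andP[ly _] _] lx; rewrite upd_neq //; lia.
- by move=> /andP[W1 W2] lx; rewrite (IH2 d) // (IH1 d).
- by move=> /and3P[_ W1 W2] lx; case: ifP => _; [exact: (IH1 d)|exact: (IH2 d)].
- move=> /and4P[_ /andP[ly _] _ W] lx.
  move: (iota _ _) => l; elim: l s => //= i l IHl s.
  by rewrite IHl (IH d.+2) //= upd_neq //; lia.
Qed.

Lemma ccmd_ok q B c d base s m : wfc q d c -> code_at prog base (ccmd d base c) ->
  agree s m -> (forall b, (b < q)%N -> (cnt (sc s b) <= B)%N) ->
  exists m', [/\ reach prog (ccost B c) (RamState base m)
                       (RamState (base + size (ccmd d base c)) m'),
    agree (run c s) m'
    & forall j, (j < d)%N -> m' (tmp j) = m (tmp j)].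
Proof.
elim: c d base s m => [|x e|a e1 e2|c1 IH1 c2 IH2|e c1 IH1 c2 IH2|b x c1 IH1]
  d base s m W C A ro; rewrite /= in W C *.
- by exists m; rewrite addn0; split=> //; apply: reach_refl.
- move: W => /andP[/andP[_ lx] W]; move: C; rewrite code_at_cat => -[C1 C2].
  have [m1 [R1 A1 V1 P1]] := cexp_ok W C1 A ro.
  have R2 := reach_straight m1 C2 isT; set m2 := foldl _ _ _ in R2.
  exists m2; split.
  + by apply: reach_cast (reach_trans R1 R2) _ _ => //; pcs.
  + by rewrite /m2 /= (ag0 A1) addr0 V1; apply: agree_set.
  + by move=> j lj; rewrite /m2 /=; mems; rewrite P1.
- move: W => /and4P[la ld W1 W2].
  move: C; set c1 := cexp d base e1; set c2 := cexp d.+1 _ e2.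
  rewrite code_at_cat => -[C1]; rewrite code_at_cat => -[C2].
  rewrite -cat_cons code_at_cat => -[C3 C4].
  have [m1 [R1 A1 V1 P1]] := cexp_ok W1 C1 A ro.
  have [m2 [R2 A2 V2 P2]] := cexp_ok W2 C2 A1 ro.
  have [|m3 [R3 V3 P3]] := @reach_addr prog _ _ _ _ m2 _ (ag0 A2) C3; first by lia.
  have A3 : agree s m3.
    split.
    + by rewrite P3 ?(ag0 A2) // /tmp; lia.
    + by rewrite P3 ?(ag1 A2) // /tmp; lia.
    + by move=> y ly; rewrite P3 ?(agv A2) ?tmpSS.
    + move=> a' i la'; rewrite P3 ?(aga A2) //; rewrite /cell /tmp /OFF /NV;
      move: ld; rewrite /ND; lia.
  have R4 := reach_straight m3 C4 isT; set m4 := foldl _ _ _ in R4.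
  exists m4; split.
  + apply: reach_cast (reach_trans (reach_trans R1 R2) (reach_trans_pc R3 R4 _)) _ _.
    * by pcs.
    * by pcs.
    * by pcs.
  + rewrite /m4 /= V3 absz_nat P3 ?tmp_inj; try lia.
    by rewrite V2 P2 // V1; apply: agree_aset.
  + move=> j lj; rewrite /m4 /= V3 absz_nat upd_neq; last first.
      by rewrite /cell /tmp /OFF /NV; move: ld lj; rewrite /ND; lia.
    by rewrite P3 ?tmp_inj; try lia; rewrite P2 ?P1 //; lia.
- move: W => /andP[W1 W2]; move: C; rewrite code_at_cat => -[C1 C2].
  have [m1 [R1 A1 P1]] := IH1 d base s m W1 C1 A ro.
  have ro1 b : (b < q)%N -> (cnt (sc (run c1 s) b) <= B)%N.
    by move=> lb; rewrite (wfc_ro _ W1) ?ro.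
  have [m2 [R2 A2 P2]] := IH2 d _ _ m1 W2 C2 A1 ro1.
  exists m2; split=> //; last by move=> j lj; rewrite P2 ?P1.
  by apply: reach_cast (reach_trans R1 R2) _ _ => //; pcs.
- move: W => /and3P[W0 W1 W2].
  move: C; set k0 := cexp d base e; set b1 := (base + size k0)%N.
  set k2 := ccmd d b1.+1 c2; set b2 := (b1.+2 + size k2)%N.
  set k1 := ccmd d b2 c1.
  rewrite code_at_cat code_at_cons code_at_cat code_at_cons.
  have -> : ((base + size k0).+1 + size k2).+1 = b2 by rewrite /b2 /b1; lia.
  move=> -[C0 [J1 [C2 [J2 C1]]]].
  have [m0 [R0 A0 V0 P0]] := cexp_ok W0 C0 A ro.
  have R0' := reach_trans R0 (reach_jgtz m0 J1).
  rewrite V0 in R0'; rewrite size_cat /= size_cat /=.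
  have -> : (base + (size k0 + (size k2 + (size k1).+1).+1) = b2 + size k1)%N.
    by rewrite /b2 /b1; lia.
  case: ifP R0' => pos R0'.
    have [m1 [R1 A1 P1]] := IH1 d _ s m0 W1 C1 A0 ro.
    exists m1; split=> //; last by move=> j lj; rewrite P1 ?P0.
    by have := reach_trans R0' R1; apply: reach_le; lia.
  have [m1 [R1 A1 P1]] := IH2 d _ s m0 W2 C2 A0 ro.
  exists m1; split => //; last by move=> j lj; rewrite P1 ?P0.
  have R3 := reach_jgtz m1 J2; rewrite (ag1 A1) ltr01 in R3.
  by have := reach_trans (reach_trans R0' R1) R3; apply: reach_le; lia.
move: W => /and4P[lb /andP[lqx lx] ld W1].
have lbV : (b < NV)%N by lia.
move: C; set h := base.+2; set k1 := ccmd d.+2 _ c1.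
move=> C; have Ci : code_at prog base [:: _; _] := @code_at_take _ 2 _ _ C.
have {C} := @code_at_drop _ 2 _ _ C; rewrite addn2 -/h /=.
rewrite code_at_cons code_at_cons => -[J1 [J2 C]].
have := @code_at_take _ 3 _ _ C; rewrite /= take0 => Cs.
have {C} := @code_at_drop _ 3 _ _ C; rewrite addn3 /= drop0 code_at_cat => -[C1].
rewrite code_at_cons => -[J3 _].
set n := cnt (sc s b).
have leB : (n <= B)%N by apply: ro.
have inv : forall k i s1 m1, (k + i = n)%N -> agree s1 m1 ->
  (forall b, (b < q)%N -> (cnt (sc s1 b) <= B)%N) ->
  cnt (m1 (tmp d)) = k -> m1 (tmp d.+1) = i%:Z ->
  (forall j, (j < d)%N -> m1 (tmp j) = m (tmp j)) ->
  exists m2, [/\ reach prog (k * (ccost B c1 + 5) + 2) (RamState h m1)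
      (RamState (h + size k1 + 6) m2),
     agree (foldl (fun s i => run c1 (sset x i%:Z s)) s1 (iota i k)) m2
     & forall j, (j < d)%N -> m2 (tmp j) = m (tmp j)].
  elim=> [|k IHk] i s1 m1 ki A1 ro1 Vk Vi Vj.
    exists m1; split=> //.
    have R1 := reach_jgtz m1 J1; rewrite cnt_gt0 Vk /= in R1.
    have R2 := reach_jgtz m1 J2; rewrite (ag1 A1) ltr01 in R2.
    exact: reach_cast (reach_trans R1 R2) _ _.
  have R1 := reach_jgtz m1 J1; rewrite cnt_gt0 Vk /= in R1.
  have R2 := reach_straight m1 Cs isT; set m2 := foldl _ _ _ in R2.
  have A2 : agree (sset x i%:Z s1) m2.
    rewrite /m2 /= (ag0 A1) addr0 Vi; apply: agree_tmp; first by lia.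
    by apply: agree_tmp; [lia|exact: agree_set].
  have ro2 b0 : (b0 < q)%N -> (cnt (sc (sset x i%:Z s1) b0) <= B)%N.
    by move=> lb0; rewrite /= upd_neq ?ro1 //; lia.
  have [m3 [R3 A3 P3]] := IH1 d.+2 _ _ _ W1 C1 A2 ro2.
  have R4 := reach_jgtz m3 J3; rewrite (ag1 A3) ltr01 in R4.
  have ro3 b0 : (b0 < q)%N -> (cnt (sc (run c1 (sset x i%:Z s1)) b0) <= B)%N.
    by move=> lb0; rewrite (wfc_ro _ W1) ?ro2.
  have [||||m5 [R5 A5 P5]] := IHk i.+1 _ m3 _ A3 ro3.
  - by lia.
  - rewrite P3; last by lia.
    rewrite /m2 /=; mems; rewrite (ag1 A1).
    by move: Vk; case: (m1 _) => -[|?] //= [<-]; rewrite ?subzSS ?subr0; lia.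
  - rewrite P3; last by lia.
    by rewrite /m2 /=; mems; rewrite (ag1 A1) Vi; lia.
  - by move=> j lj; rewrite P3; [rewrite /m2 /=; mems; rewrite Vj|lia].
  exists m5; split=> //.
  have RR := reach_trans_pc (reach_trans_pc R1 R2 erefl) R3 _.
  apply: reach_cast (reach_trans (reach_trans (RR _) R4) R5) _ _ => //.
    by rewrite /= addn3.
  by rewrite /=; lia.
have R0 := reach_straight m Ci isT; set m0 := foldl _ _ _ in R0.
have A0 : agree s m0 by rewrite /m0 /=; do 2?[apply: agree_tmp; first by lia].
have [|||m1 [R1 A1 P1]] := inv n 0%N s m0 (addn0 n) A0 ro.
- by rewrite /m0 /=; mems; rewrite (ag0 A) addr0 (agv A).
- by rewrite /m0 /=; mems.
- by move=> j lj; rewrite /m0 /=; mems.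
exists m1; split=> //.
apply: reach_cast (reach_trans_pc R0 R1 _) _ _.
- by rewrite /= addn2.
- by pcs.
- by have := leq_mul leB (leqnn (ccost B c1 + 5)); rewrite /=; lia.
Qed.

End ExprCorrect.

(** * Polynomially bounded functions *)

Definition polyb (f : nat -> nat) := exists c, forall n, (f n <= c * n.+1 ^ c)%N.

Lemma polyb_le f g : polyb g -> (forall n, f n <= g n)%N -> polyb f.
Proof. by move=> [c H] le; exists c => n; apply: leq_trans (le n) (H n). Qed.

Lemma polyb_cst k : polyb (fun _ => k).
Proof. by exists k => n; rewrite leq_pmulr // expn_gt0. Qed.

Lemma polyb_id : polyb id.
Proof. by exists 1%N => n; rewrite mul1n expn1. Qed.

Lemma polyb_add f g : polyb f -> polyb g -> polyb (fun n => f n + g n)%N.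
Proof.
move=> [c F] [c' G]; exists (c + c')%N => n; rewrite mulnDl leq_add //.
  by apply: leq_trans (F n) _; rewrite leq_mul // leq_pexp2l // leq_addr.
by apply: leq_trans (G n) _; rewrite leq_mul // leq_pexp2l // leq_addl.
Qed.

(** One number serves as coefficient and exponent, as in the time bound of the theorem;
    [c * c' + c + c'] dominates both the product of the coefficients and the sum of the
    exponents. *)
Lemma polyb_mul f g : polyb f -> polyb g -> polyb (fun n => f n * g n)%N.
Proof.
move=> [c F] [c' G]; exists (c * c' + c + c')%N => n.
apply: leq_trans (leq_mul (F n) (G n)) _.
rewrite mulnACA -expnD leq_mul ?leq_pexp2l //; first by rewrite -addnA leq_addr.
by rewrite -addnA leq_addl.
Qed.

Lemma polyb_exp f k : polyb f -> polyb (fun n => f n ^ k)%N.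
Proof.
move=> P; elim: k => [|k IH]; first exact: polyb_cst.
by apply: polyb_le (polyb_mul P IH) _ => n; rewrite expnS.
Qed.

Lemma polyb_comp f g : polyb f -> polyb g -> polyb (fun n => f (g n)).
Proof.
move=> [c F] G.
have P : polyb (fun n => c * (g n + 1) ^ c)%N.
  by do ?[apply: polyb_mul|apply: polyb_exp|apply: polyb_add|apply: polyb_cst].
by apply: polyb_le P _ => n; apply: leq_trans (F _) _; rewrite addn1.
Qed.

Ltac polyb_tac := do ?[exact: polyb_cst | exact: polyb_id | assumption
  | apply: polyb_add | apply: polyb_mul].

Lemma polyb_ecost e : polyb (ecost ^~ e).
Proof. by elim: e => [z|x|a e1 H1|e1 H1 e2 H2|e1 H1 e2 H2|e1 H1 e2 H2 e3 H3|b x e1 H1] /=; polyb_tac. Qed.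

Lemma polyb_ccost c : polyb (ccost ^~ c).
Proof.
by elim: c => [|x e|a e1 e2|c1 H1 c2 H2|e c1 H1 c2 H2|b x c1 H1] /=;
   do ?[exact: polyb_ecost]; polyb_tac; exact: polyb_ecost.
Qed.

(** * Rounding a fractional selection *)

Section Rounding.
Variable J : finType.
Implicit Types (y d w : J -> rat) (A : {set J}).

Definition unit_box y := forall j, 0 <= y j <= 1.
Definition frac y := [set j | 0 < y j < 1].

Lemma sum_delta w f : \sum_j w j * (j == f)%:R = w f.
Proof.
rewrite (bigD1 f) //= eqxx mulr1 big1 ?addr0 // => j /negbTE->.
by rewrite mulr0.
Qed.

(** Move from [y] along [d] until a first coordinate reaches 0 or 1. Only fractional coordinates
    move, so the step is positive, and its minimality keeps the others in the box. *)
Lemma hit_boundary y d : unit_box y -> (exists j, d j != 0) ->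
  (forall j, d j != 0 -> j \in frac y) ->
  exists2 e, 0 < e & unit_box (fun j => y j + e * d j)
    /\ exists2 j, j \in frac y & j \notin frac (fun j => y j + e * d j).
Proof.
move=> box [j0 dj0] sup.
(* Step length after which coordinate [j] reaches the side of the box towards which it moves. *)
pose F j := if 0 < d j then (1 - y j) / d j else - y j / d j.
have Fpos j : d j != 0 -> 0 < F j.
  move=> nz; have := sup j nz; rewrite inE => /andP[y0 y1]; rewrite /F.
  case: (ltrP 0 (d j)) => dj; first by rewrite divr_gt0 ?subr_gt0.
  have lt0 : d j < 0 by rewrite lt_neqAle nz.
  have -> : - y j / d j = y j / (- d j) by rewrite invrN mulrN mulNr.
  by rewrite divr_gt0 ?oppr_gt0.
case: (Order.TotalTheory.arg_minP F (P := fun j => d j != 0) dj0) => i di mini.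
exists (F i); first exact: Fpos.
have up j : 0 < d j -> d j * F j = 1 - y j.
  by move=> p; rewrite /F p mulrC divfK // gt_eqF.
have dn j : d j < 0 -> d j * F j = - y j.
  by move=> p; rewrite /F ltNge (ltW p) /= mulrC divfK // lt_eqF.
split.
  move=> j; have [->|nz] := eqVneq (d j) 0; first by rewrite mulr0 addr0.
  have le := mini j nz; have pi := Fpos i di.
  have := sup j nz; rewrite inE => /andP[y0 y1].
  have [pd|nd|/eqP] := ltrgt0P (d j); last by rewrite (negbTE nz).
    have: d j * F i <= d j * F j by rewrite ler_pM2l.
    have: 0 < d j * F i by rewrite mulr_gt0.
    by rewrite up // [F i * _]mulrC; lra.
  have: d j * F j <= d j * F i by rewrite ler_nM2l.
  have: d j * F i < 0 by rewrite nmulr_rlt0.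
  by rewrite dn // [F i * _]mulrC; lra.
exists i; first exact: sup.
rewrite inE [F i * _]mulrC; have [pd|nd|/eqP] := ltrgt0P (d i).
- by rewrite up //; apply/negP; lra.
- by rewrite dn //; apply/negP; lra.
- by rewrite (negbTE di).
Qed.

(** Two equations, the total and the [b]-sum, leave a free direction among any three fractional
    coordinates. Its sign is chosen so that the [r]-sum does not drop, and following it to the
    boundary makes a coordinate integral. Zero coordinates stay zero, so the support does not
    grow. *)
Lemma reduce_frac (b r : J -> rat) y : unit_box y ->
  exists y', [/\ unit_box y', forall j, y j = 0 -> y' j = 0,
    \sum_j y' j = \sum_j y j, \sum_j b j * y' j = \sum_j b j * y j
    & (\sum_j r j * y j <= \sum_j r j * y' j) /\ (#|frac y'| <= 2)%N].
Proof.
move: {2}#|frac y| (leqnn #|frac y|) => m.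
elim: m y => [|m IH] y le box; first by exists y; split=> //; split=> //; lia.
have [small|big] := leqP #|frac y| 2; first by exists y.
have [f [g [h [[ff fg fh] [nfg ngh nhf]]]]] := card_gt2P big.
have [a1 [a2 [a3 [nz s0 sb sr]]]] : exists a1 a2 a3 : rat,
   [/\ [|| a1 != 0, a2 != 0 | a3 != 0], a1 + a2 + a3 = 0,
     b f * a1 + b g * a2 + b h * a3 = 0
     & 0 <= r f * a1 + r g * a2 + r h * a3].
  have [a1 [a2 [a3 [nz s0 sb]]]] : exists a1 a2 a3 : rat,
     [/\ [|| a1 != 0, a2 != 0 | a3 != 0], a1 + a2 + a3 = 0
       & b f * a1 + b g * a2 + b h * a3 = 0].
    (* Up to sign the general solution is the cross product of (1, 1, 1) and (b f, b g, b h); it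
       vanishes when the three weights agree, hence the separate case. *)
    have [E|nE] := eqVneq (b f) (b g).
      by exists 1, (-1), 0; split=> //; rewrite E; ring.
    exists (b g - b h), (b h - b f), (b f - b g); split; try ring.
    by rewrite !subr_eq0 nE !orbT.
  have [p|q] := lerP 0 (r f * a1 + r g * a2 + r h * a3).
    by exists a1, a2, a3.
  exists (- a1), (- a2), (- a3); rewrite !oppr_eq0; split=> //; lra.
pose d j : rat := a1 * (j == f)%:R + a2 * (j == g)%:R + a3 * (j == h)%:R.
have sumd w : \sum_j w j * d j = w f * a1 + w g * a2 + w h * a3.
  rewrite -(sum_delta w f) -(sum_delta w g) -(sum_delta w h) !mulr_suml.
  by rewrite -!big_split /=; apply: eq_bigr => j _; rewrite /d; ring.
have [ngf nhg nfh] : [/\ g != f, h != g & f != h] by split; rewrite eq_sym.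
have df : d f = a1 by rewrite /d eqxx (negbTE nfg) (negbTE nfh) /=; ring.
have dg : d g = a2 by rewrite /d eqxx (negbTE ngf) (negbTE ngh) /=; ring.
have dh : d h = a3 by rewrite /d eqxx (negbTE nhf) (negbTE nhg) /=; ring.
have [||e e0 [box' [j jf jn]]] := hit_boundary (d := d) box.
- by case/or3P: nz => nz; [exists f|exists g|exists h]; rewrite ?df ?dg ?dh.
- move=> j; rewrite /d; have [->//|_] := eqVneq j f.
  have [->//|_] := eqVneq j g; have [->//|_] := eqVneq j h.
  by rewrite !mulr0 !addr0 eqxx.
set y1 := (fun j => _) in box' jn.
have d0 j0 : j0 \notin frac y -> d j0 = 0.
  move=> nj; rewrite /d; case: eqP => [E|_]; first by rewrite E ff in nj.
  case: eqP => [E|_]; first by rewrite E fg in nj.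
  by case: eqP => [E|_]; [rewrite E fh in nj|rewrite !mulr0 !addr0].
have sub : frac y1 \subset frac y :\ j.
  apply/subsetP => i iy1; rewrite in_setD1; apply/andP; split.
    by apply: contraNneq jn => <-.
  by apply: contraLR iy1 => ni; move: (ni); rewrite !inE /y1 d0 // mulr0 addr0.
have [|y' [B' Z' S' Sb' [Sr' C']]] := IH y1 _ box'.
  by apply: leq_trans (subset_leq_card sub) _; rewrite -ltnS; move: le; rewrite (cardsD1 j) jf add1n.
exists y'; split=> //.
- move=> i yi; apply: Z'; rewrite /y1 yi d0 ?mulr0 ?addr0 //.
  by rewrite inE yi ltxx.
- rewrite S' big_split /= -mulr_sumr.
  have -> : \sum_i d i = 0.
    transitivity (\sum_i 1 * d i); first by apply: eq_bigr => i _; rewrite mul1r.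
    by rewrite (sumd (fun=> 1)) !mul1r.
  by rewrite mulr0 addr0.
- rewrite Sb'; transitivity (\sum_i b i * y i + e * \sum_i b i * d i).
    by rewrite mulr_sumr -big_split; apply: eq_bigr => i _; rewrite /y1 /=; ring.
  by rewrite sumd sb mulr0 addr0.
- split=> //; apply: le_trans Sr'.
  have -> : \sum_i r i * y1 i = \sum_i r i * y i + e * \sum_i r i * d i.
    by rewrite mulr_sumr -big_split; apply: eq_bigr => i _; rewrite /y1 /=; ring.
  by rewrite sumd lerDl mulr_ge0 // ltW.
Qed.

(** After [reduce_frac] at most two coordinates are fractional. Either both can be rounded up within
    [k], or their mass is at most 1: then keeping the one with more blue points preserves the blue
    count and loses at most [rho] red points, while keeping both takes at most one centre beyond
    [k]. *)
Lemma round_select (b r : J -> nat) y (k rho b0 r0 : nat) : unit_box y ->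
  (forall j, y j != 0 -> (r j <= rho)%N) ->
  \sum_j y j <= k%:R ->
  b0%:R - 1 < \sum_j (b j)%:R * y j -> r0%:R - 1 < \sum_j (r j)%:R * y j ->
  (exists A, [/\ #|A| <= k, b0 <= \sum_(j in A) b j
              & r0 <= \sum_(j in A) r j + rho])%N
  /\ (exists A, [/\ #|A| <= k.+1, b0 <= \sum_(j in A) b j
              & r0 <= \sum_(j in A) r j])%N.
Proof.
move=> box rrho Sk Sb Sr.
have [y' [B' Z' S' Sb' [Sr' C']]] :=
  reduce_frac (fun j => (b j)%:R) (fun j => (r j)%:R) box.
rewrite -S' in Sk; rewrite -Sb' in Sb; have {}Sr := lt_le_trans Sr Sr'.
have {}rrho j : y' j != 0 -> (r j <= rho)%N.
  by move=> nz; apply: rrho; apply: contraNneq nz => /Z' ->.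
move: y' B' Sk Sb Sr rrho C' {Z' S' Sb' Sr' y box} => y box Sk Sb Sr rrho C.
pose I := [set j | y j == 1].
have split_sum (w : J -> nat) : \sum_j (w j)%:R * y j =
    (\sum_(j in I) w j)%:R + \sum_(j in frac y) (w j)%:R * y j.
  rewrite (bigID (mem I)) /= natr_sum; congr (_ + _).
    by apply: eq_bigr => j; rewrite inE => /eqP->; rewrite mulr1.
  rewrite [RHS]big_mkcond /= big_mkcond /=; apply: eq_bigr => j _.
  rewrite !inE; have [->|n1] := eqVneq (y j) 1; first by rewrite ltxx andbF.
  rewrite /= [y j < 1]lt_neqAle n1; have /andP[p q] := box j; rewrite q andbT.
  rewrite lt_neqAle p andbT eq_sym; have [->|//] := eqVneq (y j) 0.
  by rewrite mulr0.
have Sk' : #|I|%:R + \sum_(j in frac y) y j <= k%:R.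
  apply: le_trans Sk; have := split_sum (fun=> 1%N).
  rewrite sum1_card (eq_bigr y) => [|j _]; last by rewrite mul1r.
  by rewrite [X in _ = _ + X](eq_bigr y) => [->//|j _]; rewrite mul1r.
rewrite !split_sum in Sb Sr.
(* Integrality: a deficit smaller than 1 between natural numbers is no deficit. *)
have natlt (u v : nat) (z : rat) : u%:R - 1 < v%:R + z -> z <= 0 -> (u <= v)%N.
  move=> h h0; rewrite leqNgt; apply/negP => lt.
  have: (v.+1%:R <= u%:R :> rat) by rewrite ler_nat.
  by rewrite -natr1; lra.
have fr j : j \in frac y -> 0 < y j < 1 by rewrite inE.
have fI j : j \in frac y -> j \notin I.
  by rewrite !inE => /andP[_ lt]; rewrite lt_eqF.
have ub (w : J -> nat) j : j \in frac y -> (w j)%:R * y j <= (w j)%:R.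
  by move=> /fr /andP[_ lt]; rewrite ler_piMr ?ler0n // ltW.
have [/eqP c0|cpos] := boolP (#|frac y| == 0)%N.
  move: c0 => /eqP; rewrite cards_eq0 => /eqP E.
  rewrite E !big_set0 in Sk' Sb Sr.
  have Sk2 : (#|I| <= k)%N by move: Sk'; rewrite addr0 ler_nat.
  have hb := natlt _ _ _ Sb (lexx _); have hr := natlt _ _ _ Sr (lexx _).
  split; exists I; split=> //; first by apply: leq_trans hr (leq_addr _ _).
  exact: leqW.
have [/cards1P[f E]|c2] := boolP (#|frac y| == 1)%N.
  rewrite E !big_set1 in Sk' Sb Sr.
  have ff : f \in frac y by rewrite E set11.
  have fnI := fI _ ff; have /andP[yf0 yf1] := fr _ ff.
  have Ik : (#|I| < k)%N by rewrite -(ltr_nat rat); lra.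
  have hb : (b0 <= \sum_(j in f |: I) b j)%N.
    rewrite big_setU1 //=; apply: (natlt _ _ ((b f)%:R * y f - (b f)%:R)).
      by rewrite natrD; lra.
    by have := ub b f ff; lra.
  have hr : (r0 <= \sum_(j in f |: I) r j)%N.
    rewrite big_setU1 //=; apply: (natlt _ _ ((r f)%:R * y f - (r f)%:R)).
      by rewrite natrD; lra.
    by have := ub r f ff; lra.
  have cU : (#|f |: I| <= k)%N by rewrite cardsU1 fnI.
  split; exists (f |: I); split=> //; first exact: leq_trans hr (leq_addr _ _).
  exact: leqW.
have /cards2P[f [g [nfg E]]] : #|frac y| == 2 by move: C cpos c2; lia.
have ff : f \in frac y by rewrite E !inE eqxx.
have gg : g \in frac y by rewrite E !inE eqxx orbT.
have sumfg (w : J -> rat) : \sum_(j in frac y) w j = w f + w g.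
  by rewrite E big_setU1 ?big_set1 //= inE.
rewrite !sumfg in Sk' Sb Sr.
have fnI := fI _ ff; have gnI := fI _ gg.
have /andP[yf0 yf1] := fr _ ff; have /andP[yg0 yg1] := fr _ gg.
have fgI : f \notin g |: I by rewrite in_setU1 negb_or nfg.
have sumU (w : J -> nat) : (\sum_(j in f |: (g |: I)) w j = w f + (w g + \sum_(j in I) w j))%N.
  by rewrite big_setU1 //= big_setU1.
have cU : (#|f |: (g |: I)| = #|I|.+2)%N by rewrite !cardsU1 fgI gnI.
have Ik : (#|I| < k)%N by rewrite -(ltr_nat rat); lra.
have hb : (b0 <= \sum_(j in f |: (g |: I)) b j)%N.
  rewrite sumU; have := ub b f ff; have := ub b g gg => h1 h2.
  apply: (natlt _ _ ((b f)%:R * y f - (b f)%:R + ((b g)%:R * y g - (b g)%:R))); last by lra.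
  by rewrite !natrD; lra.
have hr : (r0 <= \sum_(j in f |: (g |: I)) r j)%N.
  rewrite sumU; have := ub r f ff; have := ub r g gg => h1 h2.
  apply: (natlt _ _ ((r f)%:R * y f - (r f)%:R + ((r g)%:R * y g - (r g)%:R))); last by lra.
  by rewrite !natrD; lra.
split; last by exists (f |: (g |: I)); split=> //; rewrite cU.
(* If the two fractions exceed 1 together, rounding both up stays within [k]. *)
have [le1|gt1] := lerP (y f + y g) 1; last first.
  exists (f |: (g |: I)); split=> //; last exact: leq_trans hr (leq_addr _ _).
  have: (#|I|.+1 < k)%N by rewrite -(ltr_nat rat) -natr1; lra.
  by rewrite cU.
(* By symmetry [f] has at least as many blue points as [g]; it is the one that is kept. *)
wlog bfg : f g nfg E ff gg sumfg fnI gnI yf0 yf1 yg0 yg1 fgI sumU cU hb hr le1 Sk' Sb Sr / (b g <= b f)%N.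
  move=> H; have [le|/ltnW le] := leqP (b g) (b f); first exact: (H f g).
  apply: (H g f) => //; try by rewrite eq_sym.
  - by rewrite setUC.
  - by move=> w; rewrite sumfg addrC.
  - by rewrite in_setU1 negb_or eq_sym nfg.
  - by move=> w; rewrite setUCA sumU addnCA.
  - by rewrite setUCA.
  - by rewrite setUCA.
  - by rewrite setUCA.
  - by rewrite addrC.
  - by rewrite [y g + _]addrC.
  - by rewrite [X in _ < _ + X]addrC.
  - by rewrite [X in _ < _ + X]addrC.
have rf := rrho f (lt0r_neq0 yf0); have rg := rrho g (lt0r_neq0 yg0).
exists (f |: I); split; first by rewrite cardsU1 fnI.
- rewrite big_setU1 //=.
  have h : (b g)%:R * y g <= (b f)%:R * y g by rewrite ler_pM2r // ler_nat.
  have h2 : (b f)%:R * (y f + y g) <= (b f)%:R by rewrite ler_piMr ?ler0n.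
  apply: (natlt _ _ ((b f)%:R * y f + (b g)%:R * y g - (b f)%:R)); last by lra.
  by rewrite natrD; lra.
- rewrite big_setU1 //=.
  have h1 : (r f)%:R * y f <= rho%:R * y f by rewrite ler_pM2r // ler_nat.
  have h2 : (r g)%:R * y g <= rho%:R * y g by rewrite ler_pM2r // ler_nat.
  have h3 : rho%:R * (y f + y g) <= rho%:R by rewrite ler_piMr ?ler0n.
  have h4 : 0 <= (r f)%:R :> rat by rewrite ler0n.
  apply: (natlt _ _ ((r f)%:R * y f + (r g)%:R * y g - (r f)%:R - rho%:R)); last by lra.
  by rewrite !natrD; lra.
Qed.

End Rounding.

(** * The perceptron as a solver for the covering LP *)

Section Perceptron.
Variable I : finType.
Implicit Types a v w : I -> int.

Definition dot v w := \sum_i v i * w i.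
(** A perceptron step followed by projection onto the nonnegative orthant. *)
Definition clamp v a : I -> int := fun i => Num.max 0 (v i + a i).

Lemma cauchy_schwarz v w : dot v w ^+ 2 <= dot v v * dot w w.
Proof.
have sq0 u : 0 <= dot u u by apply: sumr_ge0 => i _; rewrite -expr2 sqr_ge0.
have [z|nz] := eqVneq (dot v v) 0.
  have v0 i : v i = 0.
    move/eqP: z; rewrite psumr_eq0; last by move=> j _; rewrite -expr2 sqr_ge0.
    move=> /allP/(_ i); rewrite mem_index_enum => /(_ isT).
    by rewrite /= mulf_eq0 orbb => /eqP.
  rewrite z mul0r /dot big1 ?expr0n // => i _; by rewrite v0 mul0r.
have pos : 0 < dot v v by rewrite lt_neqAle eq_sym nz sq0.
have E (l m : int) : dot (fun i => l * v i - m * w i) (fun i => l * v i - m * w i)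
   = l ^+ 2 * dot v v - 2 * l * m * dot v w + m ^+ 2 * dot w w.
  rewrite /dot !mulr_sumr -sumrB -big_split /=; apply: eq_bigr => i _; ring.
(* With these factors the squared norm of [l v - m w] equals [m] times the difference that has to be
   nonnegative. *)
pose l := dot v w; pose m := dot v v.
have := sq0 (fun i => l * v i - m * w i); rewrite E.
rewrite -/l -/m => h.
have: 0 <= m * (m * dot w w - l ^+ 2) by apply: le_trans h _; rewrite le_eqVlt; apply/orP; left; apply/eqP; ring.
by rewrite pmulr_rge0 // subr_ge0.
Qed.

Variables (w : I -> int) (A W : nat).
Hypotheses (w0 : forall i, 0 <= w i) (wW : dot w w <= W%:Z).

(** The two perceptron potentials after [u] updates: correlation with the hidden solution [w] grows
    by at least 1 per update, the squared norm by at most [A]. *)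
Definition pinv (u : nat) v :=
  [/\ u%:Z <= dot w v, dot v v <= (u * A)%N%:Z & forall i, 0 <= v i].

Lemma pinv0 : pinv 0 (fun=> 0).
Proof.
split=> //; first by rewrite /dot big1 // => i _; rewrite mulr0.
by rewrite /dot big1 // => i _; rewrite mulr0.
Qed.

(** Cauchy-Schwarz bounds the square of [u] by [W * u * A]. *)
Lemma pinv_le u v : pinv u v -> (u <= W * A)%N.
Proof.
move=> [h1 h2 h3]; have := cauchy_schwarz w v.
case: u h1 h2 => // u h1 h2 cs.
have e1 : u.+1%:Z ^+ 2 <= dot w v ^+ 2 by rewrite lerXn2r ?nnegrE //; lia.
have e2 : dot w w * dot v v <= W%:Z * (u.+1 * A)%N%:Z.
  rewrite ler_pM //; apply: sumr_ge0 => i _; rewrite -expr2 sqr_ge0 //.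
have := le_trans e1 (le_trans cs e2).
rewrite -PoszM expr2 -PoszM lez_nat mulnCA leq_pmul2l //.
Qed.

(** As [w] is nonnegative, raising negative coordinates to 0 can only increase the correlation, and
    it can only decrease the norm. *)
Lemma pinv_clamp u v a : pinv u v -> dot a v <= 0 -> 1 <= dot a w ->
  dot a a <= A%:Z -> pinv u.+1 (clamp v a).
Proof.
clear wW.
move=> [h1 h2 h3] av aw aA; split.
- have : dot w v + dot a w <= dot w (clamp v a).
    rewrite /dot -big_split /=; apply: ler_sum => i _.
    rewrite [a i * _]mulrC -mulrDr ler_wpM2l // /clamp le_max lexx orbT //.
  lia.
- have : dot (clamp v a) (clamp v a) <= dot v v + 2 * dot a v + dot a a.
    rewrite /dot mulr_sumr -!big_split /=; apply: ler_sum => i _.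
    have -> : v i * v i + 2 * (a i * v i) + a i * a i = (v i + a i) ^+ 2 by ring.
    rewrite /clamp; case: (lerP 0 (v i + a i)) => h; first by rewrite -expr2.
    by rewrite mulr0 sqr_ge0.
  by rewrite mulSn PoszD; lia.
- by move=> i; rewrite /clamp le_max lexx.
Qed.

End Perceptron.

(** * The covering LP in homogeneous integer form *)

Section Covering.
Variables (T : finType) (adj : rel T) (al : {set T}) (N : nat).
Implicit Types (x : T -> int) (t : int) (C : {set T}) (k q : nat).

Definition Zsum x p : int := \sum_(i in al | adj p i) x i.

(** The coordinate [t] homogenizes the LP: the fractional solution is [x / t], and for positive [t]
    the negation of [cviol] says that its total is below k + 1/N. The last summand [t] gives a 0/1
    solution with t = 1 its margin 1. *)
Definition cviol k x t := N%:Z * (k%:Z * t - \sum_(i in al) x i) + t <= 0.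
(** Truncation at [t] counts a point at most once; without violation and for positive [t] the
    requirement [q] is missed by less than 1/N. *)
Definition qviol C q x t :=
  N%:Z * (\sum_(p in C) Num.min (Zsum x p) t - q%:Z * t) + t <= 0.

Definition cupd k (st : (T -> int) * int) := let: (x, t) := st in
  if cviol k x t then (fun i => Num.max 0 (x i - N%:Z), t + (N%:Z * k%:Z + 1))
  else st.
(** The constraint is concave in (x, t), not linear. The update adds the linear piece active at the
    current point: points with coverage below [t] contribute their neighbours, saturated points
    contribute [t]. *)
Definition qupd C q (st : (T -> int) * int) := let: (x, t) := st in
  if qviol C q x t then
    (fun i => x i + N%:Z * #|[set p in C | adj p i && (Zsum x p < t)]|%:Z,
     Num.max 0 (t + (N%:Z * (#|[set p in C | t <= Zsum x p]|%:Z - q%:Z) + 1)))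
  else st.

Definition lp_round k C1 q1 C2 q2 st := qupd C2 q2 (qupd C1 q1 (cupd k st)).

Definition lp_ok k C1 q1 C2 q2 x t :=
  [/\ ~~ cviol k x t, ~~ qviol C1 q1 x t, ~~ qviol C2 q2 x t & forall i, 0 <= x i].

Definition covset (O : {set T}) := [set p | [exists c in O, adj p c]].

(** Unless all constraints already hold, a round performs at least one update. The number of updates
    is at most W * A = N * N ^ 5, so more than N ^ 6 rounds must reach a feasible state, which no
    further round changes. *)
Lemma lp_solve (O : {set T}) k C1 q1 C2 q2 K : N = #|T|.+1 ->
  O \subset al -> (#|O| <= k)%N -> (k < N)%N -> (q1 < N)%N -> (q2 < N)%N ->
  (q1 <= #|covset O :&: C1|)%N -> (q2 <= #|covset O :&: C2|)%N ->
  (N ^ 6 < K)%N ->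
  let: (x, t) := iter K (lp_round k C1 q1 C2 q2) (fun=> 0, 0) in
  lp_ok k C1 q1 C2 q2 x t.
Proof.
move=> EN Oal Ok kN q1N q2N cO1 cO2 KN.
(* [None] is the coordinate [t]. Coordinates outside [al] are masked: the updates change them too,
   but no constraint reads them. *)
pose emb (st : (T -> int) * int) : option T -> int := fun o =>
  if o is Some i then (if i \in al then st.1 i else 0) else st.2.
(* The hidden solution: the indicator of [O], with t = 1. *)
pose w : option T -> int := fun o => if o is Some i then (i \in O)%:Z else 1.
have sumo (f : option T -> int) : \sum_o f o = f None + \sum_i f (Some i).
  rewrite (bigD1 None) //=; congr (_ + _).
  rewrite (reindex_omap Some id) /=; last by case.
  by apply: eq_bigl => i; rewrite eqxx.
have w0 o : 0 <= w o by case: o => //= i; case: (i \in O).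
have sumO (f : T -> int) : \sum_i f i * (i \in O)%:Z = \sum_(i in O) f i.
  rewrite [RHS]big_mkcond /=; apply: eq_bigr => i _.
  by case: ifP => _; rewrite ?mulr1 ?mulr0.
have wW : dot w w <= N%:Z.
  rewrite /dot sumo /= mulr1 sumO (eq_bigr (fun=> 1)); last by move=> i ->.
  rewrite sumr_const -[1 *+ _]/(#|O|%:R) natz; have := max_card (mem O); lia.
have dotw (a : option T -> int) : dot a w = a None + \sum_(i in O) a (Some i).
  by rewrite /dot sumo /= mulr1 sumO.
(* There are N coordinates and every row has entries of size at most N ^ 2, which gives the constant
   A = N ^ 5. *)
have bound (a : option T -> int) :
    (forall o, `|a o| <= (N ^ 2)%N%:Z) -> dot a a <= (N ^ 5)%N%:Z.
  move=> ha; apply: (@le_trans _ _ (\sum_(o : option T) (N ^ 4)%N%:Z)).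
    apply: ler_sum => o _; rewrite -expr2 -real_normK ?num_real // (_ : (N ^ 4)%N%:Z = (N ^ 2)%N%:Z ^+ 2).
      by rewrite lerXn2r ?nnegrE.
    by rewrite -!natz -natrX -expnM.
  rewrite sumr_const card_option -EN -mulr_natl natz -PoszM lez_nat.
  by rewrite -expnS.
have N2 : (N * #|T| + 1 <= N ^ 2)%N by rewrite expnS expn1; nia.
have step1 u st : pinv w (N ^ 5) u (emb st) -> (forall i, 0 <= st.1 i) ->
    (forall i, 0 <= (cupd k st).1 i) /\
    (~~ cviol k st.1 st.2 /\ cupd k st = st
     \/ pinv w (N ^ 5) u.+1 (emb (cupd k st))).
  case: st => x t P x0; rewrite /cupd /=; case: ifP => V /=; last by split=> //; left.
  split; first by move=> i; rewrite le_max lexx.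
  right; pose a : option T -> int := fun o => if o is Some i then
     (if i \in al then - N%:Z else 0) else N%:Z * k%:Z + 1.
  have da : dot a (emb (x, t)) = N%:Z * (k%:Z * t - \sum_(i in al) x i) + t.
    rewrite /dot sumo /=.
    have -> : \sum_i (if i \in al then - N%:Z else 0) * (if i \in al then x i else 0)
        = - (N%:Z * \sum_(i in al) x i).
      rewrite mulr_sumr -sumrN [RHS]big_mkcond /=; apply: eq_bigr => i _.
      by case: ifP; rewrite ?mul0r ?mulNr.
    by ring.
  have aw : 1 <= dot a w.
    rewrite dotw /= (eq_bigr (fun=> - N%:Z)); last by move=> i /(subsetP Oal) ->.
    rewrite sumr_const -mulr_natr natz; nia.
  have := pinv_clamp w0 P (a := a); rewrite da => /(_ V aw) H.
  have {}H : pinv w (N ^ 5) u.+1 (clamp (emb (x, t)) a).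
    apply: H; apply: bound => -[i|] /=; last by rewrite ger0_norm; nia.
    by case: ifP => _; rewrite ?normrN ?normr0 //=; nia.
  have E : clamp (emb (x, t)) a =1
      emb (fun i : T => Num.max 0 (x i - N%:Z), t + (N%:Z * k%:Z + 1)).
    case=> [i|] /=; rewrite /clamp /=; first by case: ifP.
    case: P => _ _ /(_ None) /= t0; apply/max_idPr; nia.
  case: H => h1 h2 h3; split; rewrite /dot.
  - by rewrite -(eq_bigr _ (fun i _ => congr1 (fun z => w i * z) (E i))).
  - by rewrite -(eq_bigr _ (fun i _ => congr2 (fun z z' => z * z') (E i) (E i))).
  - by move=> o; rewrite -E.
have step2 C q u st : (q < N)%N -> (q <= #|covset O :&: C|)%N ->
    pinv w (N ^ 5) u (emb st) -> (forall i, 0 <= st.1 i) ->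
    (forall i, 0 <= (qupd C q st).1 i) /\
    (~~ qviol C q st.1 st.2 /\ qupd C q st = st
     \/ pinv w (N ^ 5) u.+1 (emb (qupd C q st))).
  move=> qN qO; case: st => x t P x0; rewrite /qupd /=.
  case: ifP => V /=; last by split=> //; left.
  split; first by move=> i; rewrite addr_ge0 ?x0 // mulr_ge0.
  right; pose S := [set p in C | Zsum x p < t].
  pose S' := [set p in C | t <= Zsum x p].
  pose a : option T -> int := fun o => if o is Some i then
     (if i \in al then N%:Z * #|[set p in C | adj p i && (Zsum x p < t)]|%:Z else 0)
     else N%:Z * (#|S'|%:Z - q%:Z) + 1.
  have cardE (D : {set T}) (f : pred T) :
      \sum_(p in D) (f p)%:Z = #|[set p in D | f p]|%:Z.
    rewrite -sum1_card (eq_bigl (fun p => (p \in D) && f p)); last by move=> p; rewrite inE.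
    by rewrite -natz natr_sum big_mkcondr /=; apply: eq_bigr => p _; case: (f p).
  have aE i : #|[set p in C | adj p i && (Zsum x p < t)]|%:Z = \sum_(p in S) (adj p i)%:Z.
    by rewrite cardE; congr (Posz #|pred_of_set _|); apply/setP => p; rewrite !inE andbA andbAC.
  have sumZ : \sum_(i in al) x i * \sum_(p in S) (adj p i)%:Z = \sum_(p in S) Zsum x p.
    under eq_bigr => i _ do rewrite mulr_sumr.
    rewrite exchange_big /=; apply: eq_bigr => p _.
    rewrite /Zsum [RHS]big_mkcondr /=; apply: eq_bigr => i _.
    by case: ifP; rewrite ?mulr1 ?mulr0.
  have da : dot a (emb (x, t)) =
      N%:Z * (\sum_(p in C) Num.min (Zsum x p) t - q%:Z * t) + t.
    have -> : \sum_(p in C) Num.min (Zsum x p) t = \sum_(p in S) Zsum x p + #|S'|%:Z * t.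
      rewrite (bigID (fun p => Zsum x p < t)) /=; congr (_ + _).
        rewrite (eq_bigl (fun p => p \in S)); last by move=> p; rewrite inE.
        by apply: eq_bigr => p; rewrite inE => /andP[_ /ltW h]; apply/min_idPl.
      rewrite (eq_bigl (fun p => p \in S')); last by move=> p; rewrite inE -leNgt.
      rewrite (eq_bigr (fun=> t)); last by move=> p; rewrite inE => /andP[_ h]; apply/min_idPr.
      by rewrite sumr_const -mulr_natl natz.
    rewrite /dot sumo /= -sumZ.
    have -> : \sum_i (if i \in al then N%:Z * #|[set p in C | adj p i && (Zsum x p < t)]|%:Z else 0) *
        (if i \in al then x i else 0) = N%:Z * \sum_(i in al) x i * \sum_(p in S) (adj p i)%:Z.
      rewrite [X in _ = _ * X]big_mkcond mulr_sumr /=; apply: eq_bigr => i _.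
      by case: ifP => _; rewrite ?mulr0 ?mul0r // aE; ring.
    by ring.
  have aw : 1 <= dot a w.
    rewrite dotw /=.
    (* A point of [C] covered by [O] is either saturated or lies in [S] with a neighbour in [O];
       hence the active linear piece is valid for the indicator of [O]. *)
    have le1 : (#|covset O :&: C|%:Z <= \sum_(i in O) \sum_(p in S) (adj p i)%:Z + #|S'|%:Z).
      rewrite exchange_big /=.
      apply: (@le_trans _ _ (#|[set p in S | p \in covset O]|%:Z + #|S'|%:Z)).
        rewrite -PoszD lez_nat; apply: leq_trans (leq_card_setU _ _).
        apply: subset_leq_card; apply/subsetP => p; rewrite inE => /andP[pc pC].
        by move: pc; rewrite !inE pC => ->; rewrite andbT /=; case: ltP.
      rewrite lerD2r -cardE; apply: ler_sum => p _.
      case: (boolP (p \in covset O)) => [|_]; last by apply: sumr_ge0.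
      rewrite inE => /existsP[c /andP[cO pc]].
      by rewrite (bigD1 c) //= pc lerDl; apply: sumr_ge0.
    have -> : \sum_(i in O) (if i \in al then N%:Z * #|[set p in C | adj p i && (Zsum x p < t)]|%:Z else 0)
        = N%:Z * \sum_(i in O) \sum_(p in S) (adj p i)%:Z.
      by rewrite mulr_sumr; apply: eq_bigr => i /(subsetP Oal) ->; rewrite aE.
    nia.
  have := pinv_clamp w0 P (a := a); rewrite da => /(_ V aw) H.
  have cT (D : {set T}) : (#|D| <= #|T|)%N by apply: max_card.
  have {}H : pinv w (N ^ 5) u.+1 (clamp (emb (x, t)) a).
    apply: H; apply: bound => -[i|] /=.
      case: ifP => _; last by rewrite normr0.
      rewrite ger0_norm; have := cT [set p in C | adj p i && (Zsum x p < t)]; nia.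
    have := cT S'; case: lerP; nia.
  have E : clamp (emb (x, t)) a =1
      emb (fun i => x i + N%:Z * #|[set p in C | adj p i && (Zsum x p < t)]|%:Z,
           Num.max 0 (t + (N%:Z * (#|S'|%:Z - q%:Z) + 1))).
    case=> [i|] /=; rewrite /clamp //=; case: ifP => // _.
      by apply/max_idPr; rewrite addr_ge0 // mulr_ge0.
  case: H => h1 h2 h3; split; rewrite /dot.
  - by rewrite -(eq_bigr _ (fun i _ => congr1 (fun z => w i * z) (E i))).
  - by rewrite -(eq_bigr _ (fun i _ => congr2 (fun z z' => z * z') (E i) (E i))).
  - by move=> o; rewrite -E.
set rd := lp_round k C1 q1 C2 q2; set st0 := (fun=> 0, 0).
pose ok st := lp_ok k C1 q1 C2 q2 st.1 st.2.
have fixok st : ok st -> rd st = st.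
  case: st => x t [/negbTE c1 /negbTE c2 /negbTE c3 _].
  by rewrite /rd /lp_round /cupd c1 /qupd c2 c3.
(* Either the state has become feasible and is frozen, or the [m] rounds so far account for at least
   [m] updates. *)
have main : forall m, ok (iter m rd st0) \/
    (exists2 u, (m <= u)%N & pinv w (N ^ 5) u (emb (iter m rd st0)))
     /\ (forall i, 0 <= (iter m rd st0).1 i).
  elim=> [|m [H|[[u mu P] x0]]] /=.
  - right; split=> //; exists 0%N => //.
    have [h1 h2 h3] := pinv0 w (N ^ 5).
    have E : (fun=> 0) =1 emb st0 by case=> [i|] //=; case: ifP.
    split; rewrite /dot.
    + by rewrite -(eq_bigr _ (fun i _ => congr1 (fun z => w i * z) (E i))).
    + by rewrite -(eq_bigr _ (fun i _ => congr2 (fun z z' => z * z') (E i) (E i))).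
    + by move=> o; rewrite -E.
  - by left; rewrite fixok.
  set st := iter m rd st0 in P x0 *.
  rewrite /rd /lp_round.
  have [x1 H1] := step1 u st P x0.
  set s1 := cupd k st in x1 H1 *.
  have [u1 uu1 P1] : exists2 u1, (u <= u1)%N & pinv w (N ^ 5) u1 (emb s1).
    by case: H1 => [[_ ->]|?]; [exists u|exists u.+1].
  have [x2 H2] := step2 C1 q1 u1 s1 q1N cO1 P1 x1.
  set s2 := qupd C1 q1 s1 in x2 H2 *.
  have [u2 uu2 P2] : exists2 u2, (u1 <= u2)%N & pinv w (N ^ 5) u2 (emb s2).
    by case: H2 => [[_ ->]|?]; [exists u1|exists u1.+1].
  have [x3 H3] := step2 C2 q2 u2 s2 q2N cO2 P2 x2.
  case: H1 => [[v1 E1]|P1']; last first.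
    right; split=> //.
    have [x2' H2'] := step2 C1 q1 u.+1 s1 q1N cO1 P1' x1; rewrite -/s2 in H2'.
    have [v2 uv2 P2'] : exists2 u2, (u.+1 <= u2)%N & pinv w (N ^ 5) u2 (emb s2).
      by case: H2' => [[_ ->]|?]; [exists u.+1|exists u.+2].
    have [_ [[_ ->]|?]] := step2 C2 q2 v2 s2 q2N cO2 P2' x2.
      by exists v2 => //; apply: leq_ltn_trans uv2.
    by exists v2.+1 => //; lia.
  case: H2 => [[v2 E2]|P2']; last first.
    right; split=> //.
    have [_ [[_ ->]|?]] := step2 C2 q2 u1.+1 s2 q2N cO2 P2' x2.
      by exists u1.+1 => //; lia.
    by exists u1.+2 => //; lia.
  case: H3 => [[v3 E3]|P3]; last by right; split=> //; exists u2.+1 => //; lia.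
  left; rewrite E3; rewrite E1 in v2; rewrite E2 E1 in v3.
  by rewrite E2 E1; split.
case: (main K) => [|[[u Ku P] _]]; first by rewrite /ok; case: (iter _ _ _).
have := pinv_le wW P; rewrite -expnS; lia.
Qed.

End Covering.

(** * Clustering *)

Section Graph.
Variables (T : finType) (adj : rel T) (red : {set T}).
Hypotheses (adjxx : reflexive adj) (adjC : symmetric adj).
Implicit Types (L O S A : {set T}) (cl : T -> option T).

Definition nb1 i := [set p | adj i p].
Definition nb2 i := [set p | [exists u, adj i u && adj u p]].
Definition nb3 i := [set p | [exists u, (u \in nb2 i) && adj u p]].
Definition nb3s S := [set p | [exists s in S, p \in nb3 s]].

(** Labels form a partial function, so clusters are disjoint by construction. *)
Definition labin cl A q := if cl q is Some j then j \in A else false.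

(** Designed for a dichotomy, for an optimal ball with at most tau red points in its vicinity
    outside itself: if it meets a ball [nb1 p] with more than 2 tau live red points, it shares more
    than tau of them and its live part is swallowed; if it misses [nb1 p], it misses the whole
    set. *)
Definition dset tau L p :=
  [set q in L | [exists c, adj c q
                           && (tau < #|nb1 c :&: nb1 p :&: L :&: red|)%N]].

Definition dstep tau (st : {set T} * (T -> option T)) p :=
  if (2 * tau < #|nb1 p :&: st.1 :&: red|)%N then
    (st.1 :\: dset tau st.1 p,
     fun q => if q \in dset tau st.1 p then Some p else st.2 q)
  else st.

(** The LP puts mass on these centres only. A cluster centre of positive coverage is then adjacent
    to one of them, so its cluster has at most 3 tau red points. *)
Definition allowed tau L :=
  [set i | [forall q, (adj i q && (q \in L)) ==>
                      (#|nb2 q :&: L :&: red| <= 3 * tau)%N]].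

(** The outcome of greedy clustering by [Z]. A cluster centre dominates its members, so moving their
    coverage to it loses nothing; the balls of distinct centres are disjoint, so no mass is used
    twice. *)
Definition sparse_lab L (Z : T -> int) cl :=
  (forall q, q \in L -> exists j,
     [/\ cl q = Some j, j \in L, q \in nb2 j, Z q <= Z j & cl j = Some j])
  /\ (forall j j', j \in L -> j' \in L -> cl j = Some j -> cl j' = Some j' ->
        j != j' -> [disjoint nb1 j & nb1 j']).

Lemma mem_nb1 i : i \in nb1 i. Proof. by rewrite inE adjxx. Qed.

Lemma nb1_sym i j : (i \in nb1 j) = (j \in nb1 i).
Proof. by rewrite !inE adjC. Qed.

Lemma nb2P i p : reflect (exists2 u, u \in nb1 i & p \in nb1 u) (p \in nb2 i).
Proof.
rewrite inE; apply: (iffP existsP) => [[u /andP[h1 h2]]|[u h1 h2]]; exists u.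
- by rewrite inE.
- by rewrite inE.
- by rewrite !inE in h1 h2 *; rewrite h1.
Qed.

Lemma nb3P i p : reflect (exists2 u, u \in nb2 i & p \in nb1 u) (p \in nb3 i).
Proof.
rewrite inE; apply: (iffP existsP) => [[u /andP[h1 h2]]|[u h1 h2]]; exists u => //.
  by rewrite inE.
by move: h2; rewrite inE => ->; rewrite h1.
Qed.

Lemma nb2_sym i j : (i \in nb2 j) = (j \in nb2 i).
Proof.
by apply/nb2P/nb2P => -[u h1 h2]; exists u; rewrite nb1_sym.
Qed.

Lemma nb12 i : nb1 i \subset nb2 i.
Proof. by apply/subsetP => p h; apply/nb2P; exists i => //; apply: mem_nb1. Qed.

Lemma nb23 i : nb2 i \subset nb3 i.
Proof. by apply/subsetP => p h; apply/nb3P; exists p => //; apply: mem_nb1. Qed.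

Lemma covsetP O p : reflect (exists2 c, c \in O & p \in nb1 c) (p \in covset adj O).
Proof.
rewrite inE; apply: (iffP existsP) => [[u /andP[h1 h2]]|[u h1 h2]]; exists u => //.
  by rewrite inE adjC.
by rewrite h1 adjC; move: h2; rewrite inE.
Qed.

Lemma nb3sP S p : reflect (exists2 c, c \in S & p \in nb3 c) (p \in nb3s S).
Proof. by rewrite inE; apply: exists_inP. Qed.

(** Double counting: a point has at most one label, so it is counted in at most one class. *)
Lemma sum_labin cl A (C : {set T}) :
  (\sum_(j in A) #|[set q in C | cl q == Some j]|)%N = #|[set q in C | labin cl A q]|.
Proof.
transitivity (\sum_(j in A) \sum_(q in C) (cl q == Some j))%N.
  apply: eq_bigr => j _; rewrite -sum1_card big_mkcond [RHS]big_mkcond /=.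
  by apply: eq_bigr => q _; rewrite !inE; case: (q \in C); case: eqP.
rewrite exchange_big /= -sum1_card big_mkcond [RHS]big_mkcond /=.
apply: eq_bigr => q _; rewrite !inE /labin; case: (q \in C) => //=.
case: (cl q) => [j|]; last by rewrite big1.
have [jA|jA] := boolP (j \in A).
  rewrite (bigD1 j) //= eqxx big1 // => i /andP[_ ni].
  by case: eqP => // -[E]; rewrite E eqxx in ni.
rewrite big1 // => i iA; case: eqP => // -[E]; by rewrite E iA in jA.
Qed.

(** Each cluster centre [j] gets the weight min(Z j, t) / t, scaled down by [s]. Disjoint balls
    bound the total, dominance bounds the coverage from below, and [round_select] turns the weights
    into a choice of clusters. *)
Lemma lp_select L (al : {set T}) k r b rho x t cl N : N = #|T|.+1 ->
  lp_ok adj al N k (L :&: red) r (L :\: red) b x t ->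
  sparse_lab L (Zsum adj al x) cl ->
  (forall j i, j \in L -> i \in al -> adj j i -> (#|nb2 j :&: L :&: red| <= rho)%N) ->
  (exists A, [/\ #|A| <= k, b <= #|[set q in L :\: red | labin cl A q]|
              & r <= #|[set q in L :&: red | labin cl A q]| + rho])%N
  /\ (exists A, [/\ #|A| <= k.+1, b <= #|[set q in L :\: red | labin cl A q]|
              & r <= #|[set q in L :&: red | labin cl A q]|])%N.
Proof.
move=> EN [cv v1 v2 x0] [lab sep] hrho.
set Z := Zsum adj al x in lab *.
have N0 : 0 < N%:R :> rat by rewrite EN ltr0n.
have t0 : 0 < t.
  have: 0 <= \sum_(i in al) x i by apply: sumr_ge0.
  move: cv; rewrite /cviol -ltNge; set X := \sum_(i in al) _ => h1 h2.
  by rewrite ltNge; apply/negP => h3; nia.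
pose tt : rat := t%:~R.
have tt0 : 0 < tt by rewrite ltr0z.
have Z0 p : 0 <= Z p by apply: sumr_ge0.
pose J := [set j in L | cl j == Some j].
pose m j : rat := (Num.min (Z j) t)%:~R / tt.
(* This factor scales k + 1/N = (N k + 1) / N down to exactly k. *)
pose s : rat := (N * k)%:R / (N * k).+1%:R.
pose y j := if j \in J then s * m j else 0.
have m01 j : 0 <= m j <= 1.
  apply/andP; split.
    by rewrite divr_ge0 ?(ltW tt0) // ler0z le_min Z0 ltW.
  by rewrite ler_pdivrMr // mul1r ler_int ge_min lexx orbT.
have s0 : 0 <= s by rewrite divr_ge0.
have s1 : s <= 1 by rewrite ler_pdivrMr ?ltr0n // mul1r ler_nat.
have box : unit_box y.
  move=> j; rewrite /y; case: ifP => // _; have /andP[p q] := m01 j.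
  by rewrite mulr_ge0 //= mulr_ile1.
have sumJ : \sum_(j in J) m j < k%:R + N%:R^-1.
  have le1 : \sum_(j in J) (Num.min (Z j) t) <= \sum_(i in al) x i.
    apply: (@le_trans _ _ (\sum_(j in J) Z j)).
      by apply: ler_sum => j _; rewrite ge_min lexx.
    rewrite /Z /Zsum; under eq_bigr => j _ do rewrite big_mkcondr /=.
    rewrite exchange_big /=; apply: ler_sum => i _.
    rewrite -big_mkcondr /=.
    (* The mass [x i] counts for at most one cluster centre: two of them adjacent to [i] would have
       meeting balls. *)
    have [/existsP[j /andP[jJ ji]]|/existsPn none] := boolP [exists j, (j \in J) && adj j i].
      rewrite (bigD1 j) /=; last by rewrite jJ.
      rewrite big1 ?addr0 // => j' /andP[/andP[jJ' ji'] nj].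
      move: jJ jJ'; rewrite !inE => /andP[jL /eqP cj] /andP[jL' /eqP cj'].
      have /disjointFr/(_ _) := sep j' j jL' jL cj' cj nj.
      by move=> /(_ i); rewrite !inE ji' ji => /(_ isT).
    by rewrite big1 // => j h; have := none j; rewrite h.
  rewrite /m -mulr_suml ltr_pdivrMr // -(rmorph_sum (intmul 1)) /=.
  apply: (@le_lt_trans _ _ (\sum_(i in al) x i)%:~R); first by rewrite ler_int.
  rewrite -(ltr_pM2l N0) mulrA mulrDr divff ?gt_eqF //.
  move: cv; rewrite /cviol -ltNge; set X := \sum_(i in al) _ => h.
  have: N%:Z * X < (N * k)%N%:Z * t + t by rewrite PoszM; lia.
  by rewrite -(ltr_int rat) !rmorphD !rmorphM /= -!pmulrn -/tt ?natrM; lra.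
have sumy : \sum_j y j <= k%:R.
  rewrite /y -big_mkcond /= -mulr_sumr.
  apply: (@le_trans _ _ (s * (k%:R + N%:R^-1))); first by rewrite ler_wpM2l // ltW.
  rewrite /s le_eqVlt; apply/orP; left; apply/eqP.
  rewrite -natr1 natrM; field.
  by rewrite gt_eqF //= -natrM natr1 pnatr_eq0.
have key (C : {set T}) q : C \subset L -> ~~ qviol adj al N C q x t ->
    q%:R - 1 < \sum_j #|[set p in C | cl p == Some j]|%:R * y j.
  move=> CL qv; pose w j := #|[set p in C | cl p == Some j]|.
  have h1 : \sum_(p in C) Num.min (Z p) t <= \sum_(j in J) (w j)%:Z * Num.min (Z j) t.
    have -> : \sum_(j in J) (w j)%:Z * Num.min (Z j) t =
       \sum_(j in J) \sum_(p in C) (if cl p == Some j then Num.min (Z j) t else 0).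
      apply: eq_bigr => j _; rewrite -big_mkcondr /= sumr_const -mulr_natl natz.
      by congr (Posz _ * _); apply: eq_card => p; rewrite !inE.
    rewrite exchange_big /=; apply: ler_sum => p pC.
    have [j [cp jL _ Zpj cj]] := lab p (subsetP CL p pC).
    rewrite (bigD1 j) /=; last by rewrite inE jL cj eqxx.
    rewrite cp eqxx -[X in X <= _]addr0 lerD //; first by rewrite le_min2 // lexx.
    by apply: sumr_ge0 => i _; case: ifP => // _; rewrite le_min Z0 ltW.
  pose X := \sum_(j in J) (w j)%:R * m j.
  have h2 : q%:R - N%:R^-1 < X.
    have -> : X = (\sum_(j in J) (w j)%:Z * Num.min (Z j) t)%:~R / tt.
      rewrite rmorph_sum /= mulr_suml; apply: eq_bigr => j _.
      by rewrite rmorphM /= -pmulrn mulrA.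
    rewrite ltr_pdivlMr // -(ltr_pM2l N0).
    apply: (@lt_le_trans _ _ (N%:R * (\sum_(p in C) Num.min (Z p) t)%:~R)); last first.
      by rewrite ler_pM2l // ler_int.
    move: qv; rewrite /qviol -ltNge -/Z; set Y := \sum_(p in C) _ => h.
    have: (N * q)%N%:Z * t - t < N%:Z * Y by rewrite PoszM; lia.
    rewrite -(ltr_int rat) !rmorphB !rmorphM /= -!pmulrn -/tt ?natrM.
    suff -> : N%:R * ((q%:R - N%:R^-1) * tt) = N%:R * q%:R * tt - tt by [].
    by field; rewrite gt_eqF.
  have h3 : X <= #|T|%:R * (k%:R + N%:R^-1).
    apply: (@le_trans _ _ (\sum_(j in J) #|T|%:R * m j)).
      apply: ler_sum => j _; rewrite ler_wpM2r //; first by have /andP[] := m01 j.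
      by rewrite ler_nat max_card.
    by rewrite -mulr_sumr ler_wpM2l // ltW.
  have -> : \sum_j #|[set p in C | cl p == Some j]|%:R * y j = s * X.
    rewrite /X mulr_sumr [RHS]big_mkcond /=; apply: eq_bigr => j _.
    by rewrite /y; case: ifP => _; rewrite ?mulr0 // mulrCA.
  have sE : s = 1 - (N * k).+1%:R^-1.
    have nz : (N * k).+1%:R != 0 :> rat by rewrite pnatr_eq0.
    by apply: (mulIf nz); rewrite /s mulrBl mul1r mulVf // divfK // -natr1 addrK.
  (* The unscaled sum is at most |T| (k + 1/N), so scaling costs at most |T| / N; together with the
     LP slack 1/N this is exactly 1, because N = |T| + 1. *)
  have h4 : X * (N * k).+1%:R^-1 <= #|T|%:R / N%:R.
    rewrite ler_pdivrMr ?ltr0n //; apply: le_trans h3 _.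
    rewrite le_eqVlt; apply/orP; left; apply/eqP.
    by rewrite -natr1 natrM; field; rewrite gt_eqF.
  have h5 : #|T|%:R / N%:R + N%:R^-1 = 1 :> rat.
    by rewrite -[X in _ + X]mul1r -mulrDl natr1 -EN divff // gt_eqF.
  rewrite sE mulrBl mul1r [Y in _ < _ - Y]mulrC; move: h2 h4 h5.
  by move: (N%:R^-1) (#|T|%:R / _) (X * _) => u v z; lra.
have yrho j : y j != 0 -> (#|[set q in L :&: red | cl q == Some j]| <= rho)%N.
  rewrite /y; case: ifP => [jJ|]; last by rewrite eqxx.
  move: jJ; rewrite inE => /andP[jL _] nz.
  have [i ial ji] : exists2 i, i \in al & adj j i.
    apply/exists_inP; apply: contraR nz; rewrite negb_exists_in => /forall_inP H.
    have -> : m j = 0; last by rewrite mulr0.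
    rewrite /m /Z /Zsum big_pred0; first by rewrite (min_idPl (ltW t0)) mul0r.
    by move=> i; apply/negP => /andP[ia ji]; have := H i ia; rewrite ji.
  apply: leq_trans (hrho j i jL ial ji); apply: subset_leq_card.
  apply/subsetP => q; rewrite !inE => /andP[/andP[qL qr] /eqP cq].
  have [j' [cq' _ qj' _ _]] := lab q qL.
  by move: cq'; rewrite cq => -[E]; move: qj'; rewrite -E inE => ->; rewrite qL.
have [[A [A1 A2 A3]] [A' [B1 B2 B3]]] := round_select
  (b := fun j => #|[set q in L :\: red | cl q == Some j]|)
  box yrho sumy (key _ _ (subsetDl _ _) v2) (key _ _ (subsetIl _ _) v1).
by rewrite !sum_labin in A2 A3 B2 B3; split; [exists A|exists A'].
Qed.

End Graph.

(** * Guessing three centres and removing dense balls *)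

Section Guess.
Variables (T : finType) (adj : rel T) (red : {set T}).
Hypotheses (adjxx : reflexive adj) (adjC : symmetric adj).
Implicit Types (L O S A : {set T}) (cl : T -> option T).

Local Notation B := (nb1 adj).
Local Notation N2 := (nb2 adj).
Local Notation N3 := (nb3 adj).
Local Notation N3s := (nb3s adj).
Local Notation cov := (covset adj).

Section Dense.
Variables (tau : nat) (L0 O : {set T}).
Hypothesis OL : forall c, c \in O -> B c \subset L0.
Hypothesis Ogain : forall c q, c \in O -> q \in B c ->
  (#|(N2 q :&: red :&: L0) :\: B c| <= tau)%N.
Hypothesis Osep : forall p c c', c \in O -> c' \in O ->
  ~~ [disjoint B c & B p] -> ~~ [disjoint B c' & B p] -> c = c'.

(** [Od] collects the optimal centres whose balls have been swallowed by removed clusters, [Ad] the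
    labels that pay for them, at most one each. All other centres keep their whole ball live. *)
Record dinv (L : {set T}) cl (Od Ad : {set T}) : Prop := DInv {
  di_L : L \subset L0;
  di_O : Od \subset O;
  di_card : (#|Ad| <= #|Od|)%N;
  di_done : forall c, c \in Od -> forall q, q \in B c -> labin cl Ad q;
  di_todo : forall c, c \in O -> c \notin Od -> B c \subset L;
  di_live : forall q, q \in L -> cl q = None;
  di_lab : forall q p, cl q = Some p -> (q \in N3 p) && (q \in L0 :\: L) }.

Lemma dset_sub L p : dset adj red tau L p \subset L.
Proof. by apply/subsetP => q; rewrite inE => /andP[]. Qed.

Lemma dset_self L p : (2 * tau < #|B p :&: L :&: red|)%N ->
  B p :&: L \subset dset adj red tau L p.
Proof.
move=> big; apply/subsetP => q; rewrite inE => /andP[qp qL].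
rewrite inE qL; apply/existsP; exists p; move: qp; rewrite inE => -> /=.
by rewrite setIid; apply: leq_trans big; lia.
Qed.

(** By separation at most one centre of [O] touches the ball of [p]. If one does, it has not been
    treated yet, its ball lies in the removed set and the cluster [p] pays for it; otherwise the
    removed set avoids all optimal balls. *)
Lemma dstep_inv L cl Od Ad p : dinv L cl Od Ad ->
  exists Od' Ad', dinv (dstep adj red tau (L, cl) p).1 (dstep adj red tau (L, cl) p).2 Od' Ad'
   /\ (#|B p :&: (dstep adj red tau (L, cl) p).1 :&: red| <= 2 * tau)%N.
Proof.
move=> I; have [iL iO iC iD iT iV iB] := I.
rewrite /dstep /=; case: ltnP => big /=; last by exists Od, Ad.
set D := dset _ _ _ _ _.
have DL : D \subset L := dset_sub L p.
have dense' : (#|B p :&: (L :\: D) :&: red| <= 2 * tau)%N.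
  rewrite (_ : _ :&: red = set0) ?cards0 //; apply/setP => q.
  rewrite !(in_setI, in_setD, in_set0).
  apply/negP => /andP[/andP[qp /andP[nD qL]] _].
  by move/negP: nD; apply; apply: (subsetP (dset_self big)); rewrite in_setI qp.
(* A remaining centre that misses the ball of p misses all of D: a point of D
   covered by it would give it too many uncovered red points two hops away. *)
have miss c : c \in O -> [disjoint B c & B p] -> [disjoint B c & D].
  move=> cO dis; rewrite -setI_eq0; apply/eqP/setP => u; rewrite in_set0.
  apply/negP; rewrite in_setI => /andP[uc]; rewrite inE => /andP[uL /existsP[c1 /andP[c1u many]]].
  have := Ogain cO uc; rewrite leqNgt => /negP; apply.
  apply: leq_trans many _; apply: subset_leq_card; apply/subsetP => v.
  rewrite inE => /andP[]; rewrite inE => /andP[]; rewrite inE => /andP[vc1 vp vL vr].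
  rewrite inE; apply/andP; split.
    apply/negP => vc; have := disjointFr dis vc; by rewrite vp.
  rewrite !inE vr (subsetP iL) // andbT andbT; apply/existsP; exists c1.
  by rewrite adjC c1u; move: vc1; rewrite inE.
have lab' q p' : (if q \in D then Some p else cl q) = Some p' ->
    (q \in N3 p') && (q \in L0 :\: (L :\: D)).
  case: ifP => qD; last first.
    by move=> /iB /andP[-> ]; rewrite !inE => /andP[/negbTE-> ->]; rewrite andbF.
  move=> [<-]; rewrite !in_setD qD (subsetP iL) ?(subsetP DL) //= andbT.
  move/setIdP: qD => [_ /existsP[c1 /andP[c1q many]]].
  have /card_gt0P[u /setIP[/setIP[/setIP[c1u pu] _] _]] :
    (0 < #|B c1 :&: B p :&: L :&: red|)%N by apply: leq_ltn_trans many.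
  apply/nb3P; exists c1; last by rewrite inE.
  by apply/nb2P; exists u; rewrite // nb1_sym.
have live' q : q \in L :\: D -> (if q \in D then Some p else cl q) = None.
  by rewrite inE => /andP[/negbTE-> /iV].
have done' c q : c \in Od -> q \in B c -> labin (fun q => if q \in D then Some p else cl q) Ad q.
  move=> cO qc; have := iD c cO q qc; rewrite /labin.
  case: ifP => // qD; rewrite iV //; exact: (subsetP DL).
have Lsub : L :\: D \subset L0 by apply: subset_trans (subsetDl _ _) iL.
have [/existsP[c /andP[cO tch]]|none] := boolP [exists c in O, ~~ [disjoint B c & B p]]; last first.
  exists Od, Ad; split=> //; split=> //.
    by move=> c cO q qc; apply: done' qc.
  move=> c cO cn; apply/subsetP => q qc; rewrite inE (subsetP (iT c cO cn)) // andbT.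
  have dis : [disjoint B c & B p].
    by move/existsPn: none => /(_ c); rewrite cO negbK.
  by apply/negP => qD; have := disjointFr (miss c cO dis) qc; rewrite qD.
have [q0 /andP[q0c q0p]] : exists q, (q \in B c) && (q \in B p).
  by move: tch; rewrite -setI_eq0 => /set0Pn[q]; rewrite inE => h; exists q.
have few : (#|(B p :&: red :&: L0) :\: B c| <= tau)%N.
  apply: leq_trans (Ogain cO q0c); apply: subset_leq_card; apply/subsetP => v.
  rewrite !inE => /andP[-> /andP[/andP[pv ->] ->]]; rewrite !andbT /=.
  by apply/existsP; exists p; rewrite pv adjC; move: q0p; rewrite inE => ->.
(* A treated centre has no live point in its ball, so the ball of [p] would have at most tau live
   red points. *)
have cnd : c \notin Od.
  apply/negP => cOd; move: big; apply/negP; rewrite -leqNgt.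
  apply: (@leq_trans tau); last by lia.
  apply: leq_trans few; apply: subset_leq_card; apply/subsetP => v.
  rewrite inE => /andP[]; rewrite inE => /andP[vp vL vr].
  rewrite inE; apply/andP; split; last by rewrite !inE vr (subsetP iL) // !andbT; move: vp; rewrite inE.
  apply/negP => vc; have := iD c cOd v vc; by rewrite /labin iV.
have cL := iT c cO cnd.
(* Of the more than 2 tau live red points in the ball of [p] at most tau avoid the ball of [c]; so
   [c] itself is the witness for each point of its ball. *)
have cD : B c \subset D.
  apply/subsetP => q qc; rewrite inE (subsetP cL) //; apply/existsP; exists c.
  move: (qc); rewrite inE => -> /=.
  have : (#|B p :&: L :&: red| <= #|B c :&: B p :&: L :&: red| + #|(B p :&: red :&: L0) :\: B c|)%N.
    apply: leq_trans (leq_card_setU _ _); apply: subset_leq_card; apply/subsetP => v.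
    rewrite inE => /andP[]; rewrite inE => /andP[vp vL vr].
    rewrite in_setU !(in_setI, in_setD) vp vL vr (subsetP iL) //.
    by case: (v \in B c).
  by move: big few; clear; lia.
exists (c |: Od), (p |: Ad); split=> //; split=> //.
- by apply/subsetP => d /setU1P[->|/(subsetP iO)].
- by rewrite !cardsU1 cnd; case: (p \notin Ad) => /=; rewrite ?add1n ?add0n ?ltnS // leqW.
- move=> d /setU1P[->|dO] q qd.
    by rewrite /labin (subsetP cD) // !inE eqxx.
  have := done' d q dO qd; rewrite /labin; case: (if _ then _ else _) => // j.
  by rewrite in_setU1 => ->; rewrite orbT.
- move=> d dO; rewrite in_setU1 negb_or => /andP[dc dn].
  apply/subsetP => q qd; rewrite inE (subsetP (iT d dO dn)) // andbT.
  have dis : [disjoint B d & B p].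
    by apply: contraNT dc => t; apply/eqP; apply: (Osep (p := p)).
  by apply/negP => qD; have := disjointFr (miss d dO dis) qd; rewrite qD.
Qed.

(** The bound for [p] established at its own step survives, since later steps only remove live
    points. *)
Lemma dfold_inv s L cl Od Ad : dinv L cl Od Ad ->
  let st := foldl (dstep adj red tau) (L, cl) s in
  exists Od' Ad', [/\ dinv st.1 st.2 Od' Ad', st.1 \subset L
   & forall p, p \in s -> (#|B p :&: st.1 :&: red| <= 2 * tau)%N].
Proof.
elim: s L cl Od Ad => [|p s IH] L cl Od Ad I /=; first by exists Od, Ad.
have [Od1 [Ad1 [I1 D1]]] := dstep_inv p I.
move: I1 D1; case E: (dstep _ _ _ _ _) => [L1 cl1] /= I1 D1.
have L1L : L1 \subset L.
  by move: E; rewrite /dstep /=; case: ifP => _ [<- _]; rewrite ?subsetDl.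
have [Od2 [Ad2 [I2 S2 D2]]] := IH _ _ _ _ I1.
exists Od2, Ad2; split=> //; first exact: subset_trans S2 L1L.
move=> q; rewrite in_cons => /orP[/eqP->|/D2//].
apply: leq_trans D1; apply: subset_leq_card; apply: setSI; exact: setIS.
Qed.

End Dense.

(** The guess tau = |T| switches the removal off, which lets the degenerate cases use the same
    program. *)
Lemma dfold_trivial s L cl : foldl (dstep adj red #|T|) (L, cl) s = (L, cl).
Proof.
elim: s => //= p s IH; rewrite /dstep /= ifF //; apply/negbTE; rewrite -leqNgt.
by apply: leq_trans (max_card _) _; rewrite leq_pmull.
Qed.

Definition touch2 O := [exists i, [exists c in O, exists c' in O,
  [&& c != c', c \in N2 i & c' \in N2 i]]].

Lemma untouchP O : ~~ touch2 O -> forall i c c', c \in O -> c' \in O ->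
  c \in N2 i -> c' \in N2 i -> c = c'.
Proof.
move=> nt i c c' cO c'O ci c'i; apply/eqP; apply: contraNT nt => ne.
apply/existsP; exists i; apply/exists_inP; exists c => //.
by apply/exists_inP; exists c' => //; rewrite ne ci.
Qed.

(** Centres are added by largest marginal gain of red points outside their own ball. Gains shrink as
    [S] grows, so the last one, [tau], is at most each of the [m] gains and at least the gain of
    every centre left out. *)
Lemma greedy_gain O m : ~~ touch2 O -> (m <= #|O|)%N ->
  exists S tau, [/\ S \subset O, #|S| = m, (tau <= #|T|)%N,
    (m * tau <= #|(N3s S :&: red) :\: cov O|)%N
    & forall c, c \in O -> c \notin S ->
        (#|((N3 c :\: B c) :&: red) :\: N3s S| <= tau)%N].
Proof.
move=> nt; elim: m => [|m IH] mO.
  exists set0, #|T|; split=> //; rewrite ?sub0set ?cards0 // => c _ _; exact: max_card.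
have [S [tau [SO Sm tT slack gain]]] := IH (ltnW mO).
pose g c := #|((N3 c :\: B c) :&: red) :\: N3s S|.
have /existsP[c0 c0P] : [exists c, c \in O :\: S].
  apply/existsP/card_gt0P; rewrite cardsD (setIidPr SO) Sm; lia.
case: (@arg_maxnP _ c0 (fun c => c \in O :\: S) g c0P) => c /setDP[cO cS] cmax.
have gle : (g c <= tau)%N := gain c cO cS.
exists (c |: S), (g c); split.
- by apply/subsetP => d /setU1P[->|/(subsetP SO)].
- by rewrite cardsU1 cS Sm.
- exact: leq_trans gle tT.
- have sub : (((N3s S :&: red) :\: cov O) :|: (((N3 c :\: B c) :&: red) :\: N3s S))
     \subset (N3s (c |: S) :&: red) :\: cov O.
    apply/subsetP => q /setUP[].
      rewrite inE => /andP[qn]; rewrite inE => /andP[/nb3sP[s sS qs] qr].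
      by rewrite inE qn inE qr andbT; apply/nb3sP; exists s => //; rewrite in_setU1 sS orbT.
    rewrite inE => /andP[qn]; rewrite inE => /andP[]; rewrite inE => /andP[qB qc qr].
    rewrite inE in_setI qr andbT; apply/andP; split; last first.
      by apply/nb3sP; exists c => //; rewrite setU11.
    (* Gained points are not covered by [O]: if [d] covered one, the point [u] before it would be
       within two hops of [c] and of [d], so [c = d] and the point would lie in the ball of [c]. *)
    apply/negP => /(covsetP adjC)[d dO qd]; move/negP: qB; apply.
    have [u uc uq] := nb3P _ _ _ qc.
    suff -> : c = d by [].
    apply: (untouchP nt (i := u)) => //; first by rewrite nb2_sym.
    by rewrite nb2_sym //; apply/nb2P; exists q => //; rewrite nb1_sym.
  have dis : ((N3s S :&: red) :\: cov O) :&: (((N3 c :\: B c) :&: red) :\: N3s S) = set0.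
    apply/setP => q; rewrite in_set0; apply/negP.
    by move=> /setIP[/setDP[/setIP[h _] _] /setDP[_]]; rewrite h.
  have := subset_leq_card sub; rewrite cardsU dis cards0.
  rewrite -/(g c) => h; apply: leq_trans h; rewrite mulSn addnC subn0 leq_add2r.
  by apply: leq_trans slack; rewrite leq_mul2l gle orbT.
- move=> d dO; rewrite in_setU1 negb_or => /andP[dc dS].
  have := cmax d; rewrite inE dO dS => /(_ isT); apply: leq_trans.
  apply: subset_leq_card; apply: setDS; apply/subsetP => q /nb3sP[s sS qs].
  by apply/nb3sP; exists s => //; rewrite in_setU1 sS orbT.
Qed.

Lemma set3E S : (0 < #|S| <= 3)%N -> exists s1 s2 s3, S = [set s1; s2; s3].
Proof.
move=> /andP[S0 S3].
have [x xS] := card_gt0P S0.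
have [E|[y yS]] := set_0Vmem (S :\ x).
  exists x, x, x; apply/setP => z; rewrite !inE !orbb.
  by have := in_set0 z; rewrite -E !inE; case: eqP => [->|] //=.
have [E|[z zS]] := set_0Vmem ((S :\ x) :\ y).
  exists x, y, y; apply/setP => z; rewrite !inE.
  move: yS; rewrite !inE => /andP[_ yS].
  have := in_set0 z; rewrite -E !inE.
  by case: (eqVneq z y) => [->|_] /=; rewrite ?orbT //; case: eqP => [->|] //=; rewrite orbF.
exists x, y, z; apply/setP => w; rewrite !inE.
move: (yS) (zS); rewrite !inE => /andP[_ yS'] /and3P[_ _ zS'].
have E : ((S :\ x) :\ y) :\ z = set0.
  apply/eqP; rewrite -cards_eq0; move: S3.
  by rewrite (cardsD1 x) xS (cardsD1 y) yS (cardsD1 z) zS; lia.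
have := in_set0 w; rewrite -E !inE.
case: (eqVneq w z) => [->|_] /=; rewrite ?orbT //.
case: (eqVneq w y) => [->|_] /=; rewrite ?orbT //.
by case: eqP => [->|] //=; rewrite orbF.
Qed.

(** Dense and sparse labels are chosen together at the end, so no guess about the dense clusters is
    needed. That labels avoid the three-hop region of [S] makes the two summands of each count
    concern disjoint sets. *)
Definition good_guess k r b s1 s2 s3 tau ks rs bs :=
  let S := [set s1; s2; s3] in
  let st := foldl (dstep adj red tau) (~: N3s S, fun=> None) (enum T) in
  let al := allowed adj red tau st.1 in
  [/\ [/\ (tau <= #|T|)%N, (ks <= #|T|)%N, (rs <= #|T|)%N & (bs <= #|T|)%N],
      exists2 O : {set T}, O \subset al & [/\ (#|O| <= ks)%N,
        (rs <= #|cov O :&: (st.1 :&: red)|)%N & (bs <= #|cov O :&: (st.1 :\: red)|)%N]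
    & forall x t cl, lp_ok adj al #|T|.+1 ks (st.1 :&: red) rs (st.1 :\: red) bs x t ->
        (forall q, q \notin st.1 -> cl q = st.2 q) ->
        sparse_lab adj st.1 (Zsum adj al x) cl ->
        (forall q j, cl q = Some j -> (q \in N3 j) && (q \notin N3s S)) /\
        exists A : {set T}, [/\ (#|S| + #|A| <= k)%N,
          (r <= #|N3s S :&: red| + #|[set q in red | labin cl A q]|)%N
          & (b <= #|N3s S :\: red| + #|[set q in ~: red | labin cl A q]|)%N]].

Lemma lab_sound S L cl cl1 Z : L \subset ~: N3s S ->
  (forall q j, cl1 q = Some j -> (q \in N3 j) && (q \in ~: N3s S)) ->
  (forall q, q \notin L -> cl q = cl1 q) -> sparse_lab adj L Z cl ->
  forall q j, cl q = Some j -> (q \in N3 j) && (q \notin N3s S).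
Proof.
move=> LS l1 E [lab _] q j; have [qL|qL] := boolP (q \in L).
  have [j' [-> _ qj _ _]] := lab q qL => -[<-].
  rewrite (subsetP (nb23 adjxx j')) //=.
  by have := subsetP LS q qL; rewrite inE.
by rewrite E // => /l1; rewrite in_setC.
Qed.

(** At most three centres can all be guessed and expanded, which leaves the LP without
    requirements. *)
Lemma good_guess_trivial O k r b : (0 < #|O| <= 3)%N -> (#|O| <= k)%N ->
  (r <= #|cov O :&: red|)%N -> (b <= #|cov O :\: red|)%N ->
  exists s1 s2 s3, good_guess k r b s1 s2 s3 #|T| 0 0 0.
Proof.
move=> O3 Ok Or Ob; have [s1 [s2 [s3 E]]] := set3E O3.
exists s1, s2, s3; rewrite /good_guess -E dfold_trivial /=; split=> //.
  by exists set0; rewrite ?sub0set // cards0.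
move=> x t cl _ clE lab; split; first exact: (lab_sound (subxx _) _ clE lab).
have covN : cov O \subset N3s O.
  apply/subsetP => p /(covsetP adjC)[c cO pc]; apply/nb3sP; exists c => //.
  by apply: (subsetP (nb23 adjxx c)); apply: (subsetP (nb12 adjxx c)).
exists set0; split; first by rewrite cards0 addn0.
- apply: leq_trans Or _; apply: leq_trans (leq_addr _ _).
  by apply: subset_leq_card; apply: setSI.
- apply: leq_trans Ob _; apply: leq_trans (leq_addr _ _).
  by apply: subset_leq_card; apply: setSD.
Qed.

(* If one ball meets two optimal balls, three hops around its centre cover
   both, which frees the extra centre that rounding up needs. *)
Lemma good_guess_touch O k r b : touch2 O -> (#|O| <= k)%N ->
  (r <= #|cov O :&: red|)%N -> (b <= #|cov O :\: red|)%N ->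
  exists i ks rs bs, good_guess k r b i i i #|T| ks rs bs.
Proof.
move=> /existsP[i /exists_inP[c cO /exists_inP[c' c'O /and3P[ne ci c'i]]]] Ok Or Ob.
pose O1 := O :\ c :\ c'.
have O1c : #|O| = #|O1|.+2.
  by rewrite (cardsD1 c) cO (cardsD1 c') !inE eq_sym ne c'O.
pose L := ~: N3s [set i].
have covL : cov O \subset N3s [set i] :|: cov O1.
  apply/subsetP => p /(covsetP adjC)[d dO pd]; rewrite inE.
  have far e : e \in N2 i -> p \in B e -> p \in N3s [set i].
    by move=> ei pe; apply/nb3sP; exists i; rewrite ?set11 //; apply/nb3P; exists e.
  have [E|dc] := eqVneq d c; first by rewrite (far c) // -E.
  have [E|dc'] := eqVneq d c'; first by rewrite (far c') // -E.
  by apply/orP; right; apply/(covsetP adjC); exists d => //; rewrite !inE dc dc'.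
exists i, #|O1|, #|cov O1 :&: (L :&: red)|, #|cov O1 :&: (L :\: red)|.
rewrite /good_guess !setUid dfold_trivial /= -/L; split.
- by split=> //; apply: max_card.
- exists O1; last by split.
  apply/subsetP => j _; rewrite inE; apply/forallP => q; apply/implyP => _.
  by apply: leq_trans (max_card _) _; rewrite leq_pmull.
move=> x t cl ok clE lab; split; first exact: (lab_sound (subxx _) _ clE lab).
have [|_ [A [A1 A2 A3]]] := lp_select (rho := #|T|) erefl ok lab.
  by move=> *; apply: max_card.
exists A; rewrite cards1; split; first by rewrite add1n -ltnS; move: A1 Ok; rewrite O1c; lia.
- apply: leq_trans Or _.
  apply: (@leq_trans (#|cov O :&: red :&: N3s [set i]| + #|cov O :&: red :\: N3s [set i]|)).
    by rewrite cardsID.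
  apply: leq_add.
    by apply: subset_leq_card; apply/subsetP => q /setIP[/setIP[_ qr] qn]; rewrite in_setI qn.
  apply: (@leq_trans #|cov O1 :&: (L :&: red)|).
    apply: subset_leq_card; apply/subsetP => q; rewrite !(in_setD, in_setI, in_setC).
    move=> /andP[qn /andP[qc ->]]; rewrite qn /= andbT.
    by have := subsetP covL q qc; rewrite in_setU (negbTE qn).
  apply: leq_trans A3 _; apply: subset_leq_card; apply/subsetP => q.
  by rewrite !inE => /andP[/andP[_ ->] ->].
- apply: leq_trans Ob _.
  apply: (@leq_trans (#|(cov O :\: red) :&: N3s [set i]| + #|(cov O :\: red) :\: N3s [set i]|)).
    by rewrite cardsID.
  apply: leq_add.
    by apply: subset_leq_card; apply/subsetP => q; rewrite !(in_setI, in_setD) => /andP[/andP[-> _] ->].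
  apply: (@leq_trans #|cov O1 :&: (L :\: red)|).
    apply: subset_leq_card; apply/subsetP => q; rewrite !(in_setD, in_setI, in_setC).
    move=> /andP[qn /andP[-> qc]]; rewrite qn /= andbT.
    by have := subsetP covL q qc; rewrite in_setU (negbTE qn).
  apply: leq_trans A2 _; apply: subset_leq_card; apply/subsetP => q.
  by rewrite !inE => /andP[/andP[-> _] ->].
Qed.

(** The first alternative of [lp_select] respects the number of centres and loses at most 3 tau red
    points, which is what the three expanded centres gain beyond [O]. The guesses for the LP are the
    true values of the centres [O2] that survive the removal. *)
Lemma good_guess_sep O k r b : ~~ touch2 O -> (3 <= #|O| <= k)%N ->
  (r <= #|cov O :&: red|)%N -> (b <= #|cov O :\: red|)%N ->
  exists s1 s2 s3 tau ks rs bs, good_guess k r b s1 s2 s3 tau ks rs bs.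
Proof.
move=> nt /andP[O3 Ok] Or Ob.
have [S [tau [SO S3 tT slack gain]]] := greedy_gain nt O3.
have [|s1 [s2 [s3 E]]] := @set3E S; first by rewrite S3.
pose L0 := ~: N3s S; pose O1 := O :\: S.
have O1O c : c \in O1 -> c \in O by rewrite inE => /andP[].
have inter u c c' : c \in O -> c' \in O -> u \in N2 c -> u \in N2 c' -> c = c'.
  by move=> cO c'O uc uc'; apply: (untouchP nt (i := u)) => //; rewrite nb2_sym.
(* A point in the ball of [c] and within three hops of some [s] in [S] would yield a [u] within two
   hops of both centres. *)
have OL c : c \in O1 -> B c \subset L0.
  move=> cO1; apply/subsetP => p pc; rewrite inE; apply/nb3sP => -[s sS ps].
  have [u us up] := nb3P _ _ _ ps.
  have E' : c = s.
    apply: (inter u) (O1O _ cO1) (subsetP SO _ sS) _ us.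
    by apply/nb2P; exists p => //; rewrite nb1_sym.
  by move: cO1; rewrite inE E' sS.
have Og c q : c \in O1 -> q \in B c -> (#|(N2 q :&: red :&: L0) :\: B c| <= tau)%N.
  move=> cO1 qc; have cS : c \notin S by move: cO1; rewrite inE => /andP[].
  apply: leq_trans (gain c (O1O _ cO1) cS); apply: subset_leq_card; apply/subsetP => v.
  rewrite !(in_setD, in_setI, in_setC) => /andP[-> /andP[/andP[vq ->] ->]] /=.
  rewrite andbT; have [u uq vu] := nb2P _ _ _ vq; apply/nb3P; exists u => //.
  by apply/nb2P; exists q.
have Os p c c' : c \in O1 -> c' \in O1 -> ~~ [disjoint B c & B p] ->
    ~~ [disjoint B c' & B p] -> c = c'.
  move=> cO c'O tc tc'.
  have aux d : ~~ [disjoint B d & B p] -> p \in N2 d.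
    rewrite -setI_eq0 => /set0Pn[q]; rewrite in_setI => /andP[qd qp].
    by apply/nb2P; exists q => //; rewrite nb1_sym.
  by apply: (inter p); rewrite ?O1O ?aux.
have I0 : dinv L0 O1 L0 (fun=> None) set0 set0.
  split=> //; rewrite ?sub0set // ?cards0 //; first by move=> c; rewrite inE.
  by move=> c cO _; apply: OL.
have [Od [Ad [I1 L1L den]]] := dfold_inv Og Os (enum T) I0.
exists s1, s2, s3, tau; rewrite /good_guess -E -/L0.
move: I1 L1L den; case: (foldl _ _ _) => L cl1 /= I1 L1L den.
have [iL iO iC iD iT iV iB] := I1.
pose O2 := O1 :\: Od.
have O2P c : c \in O2 -> [/\ c \in O1, c \notin Od & B c \subset L].
  by rewrite inE => /andP[nd cO]; split=> //; apply: iT.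
exists #|O2|, #|cov O2 :&: (L :&: red)|, #|cov O2 :&: (L :\: red)|; split.
- by split=> //; apply: max_card.
- exists O2; last by split.
  apply/subsetP => c cO2; have [cO1 cd cL] := O2P c cO2.
  rewrite inE; apply/forallP => q; apply/implyP => /andP[cq qL].
  have qc : q \in B c by rewrite inE.
  have := Og c q cO1 qc; have := den c (mem_enum _ _) => h1 h2.
  (* Among the live red points within two hops of [q], at most 2 tau lie in the ball of [c] and at
     most tau outside it. *)
  apply: (@leq_trans (#|B c :&: L :&: red| + #|(N2 q :&: red :&: L0) :\: B c|)); last by lia.
  apply: leq_trans (leq_card_setU _ _); apply: subset_leq_card; apply/subsetP => v.
  rewrite !(in_setU, in_setD, in_setI) => /andP[/andP[-> vL] ->].
  by rewrite vL (subsetP iL _ vL) /=; case: (v \in B c).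
move=> x t cl ok clE lab; split.
  apply: (lab_sound iL _ clE lab) => q j /iB /andP[->]; by rewrite inE => /andP[_ ->].
have [|[A [A1 A2 A3]] _] := lp_select (rho := 3 * tau) erefl ok lab.
  move=> j i jL; rewrite inE => /forallP/(_ j) /implyP H ji.
  by apply: H; rewrite jL adjC ji.
have cD : (#|O1| = #|Od| + #|O2|)%N by rewrite -(cardsID Od O1) (setIidPr iO).
have cO : (#|O| = 3 + #|O1|)%N by rewrite -(cardsID S O) (setIidPr SO) S3.
exists (Ad :|: A); split.
- rewrite S3; apply: leq_trans Ok; rewrite cO cD leq_add2l.
  by apply: leq_trans (leq_card_setU _ _) (leq_add iC A1).
all: have lab1 q : q \in L -> labin cl A q -> labin cl (Ad :|: A) q by
       move=> qL; rewrite /labin; case: (cl q) => // j; rewrite inE => ->; rewrite orbT.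
all: have lab2 q : q \notin L -> labin cl1 Ad q -> labin cl (Ad :|: A) q by
       move=> qL; rewrite /labin clE //; case: (cl1 q) => // j; rewrite inE => ->.
all: have covd c q : c \in Od -> q \in B c -> (q \notin L) && labin cl1 Ad q by
       move=> cd qc; have h := iD c cd q qc; rewrite h andbT;
       apply/negP => qL; move: h; rewrite /labin iV.
all: have covS : cov O \subset N3s S :|: (cov Od :|: cov O2).
1,3: apply/subsetP => p /(covsetP adjC)[c cO' pc]; rewrite !in_setU;
     have [cS|cS] := boolP (c \in S);
     [ by apply/orP; left; apply/nb3sP; exists c => //;
       apply: (subsetP (nb23 adjxx c)); apply: (subsetP (nb12 adjxx c))
     | have [cd|cd] := boolP (c \in Od);
       [ by apply/orP; right; apply/orP; left; apply/(covsetP adjC); exists c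
       | by apply/orP; right; apply/orP; right; apply/(covsetP adjC); exists c => //;
         rewrite !inE cS cd ] ].
all: have covLd q : q \in cov Od -> (q \notin L) && labin cl1 Ad q by
       move=> /(covsetP adjC)[c cd qc]; apply: covd cd qc.
all: have covL2 q : q \in cov O2 -> q \in L by
       move=> /(covsetP adjC)[c /O2P[_ _ cL] qc]; apply: (subsetP cL).
- have h1 : (#|cov O :&: red| <= #|N3s S :&: red :&: cov O| + #|cov Od :&: red| + #|cov O2 :&: (L :&: red)|)%N.
    apply: leq_trans (leq_add (leq_card_setU _ _) (leqnn _)).
    apply: leq_trans (leq_card_setU _ _); apply: subset_leq_card; apply/subsetP => q.
    rewrite in_setI => /andP[qc qr]; have := subsetP covS q qc.
    rewrite !(in_setU, in_setI) qr qc !andbT => /or3P[->|->|q2] //; first by rewrite orbT.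
    by rewrite q2 (covL2 _ q2) !orbT.
  have h2 : (#|N3s S :&: red| = #|N3s S :&: red :&: cov O| + #|(N3s S :&: red) :\: cov O|)%N.
    by rewrite cardsID.
  have h3 : (#|cov Od :&: red| + #|[set q in L :&: red | labin cl A q]| <=
             #|[set q in red | labin cl (Ad :|: A) q]|)%N.
    have h4 : (cov Od :&: red) :&: [set q in L :&: red | labin cl A q] = set0.
      apply/setP => q; rewrite !inE; apply/negP => /andP[/andP[qd _] /andP[/andP[qL _] _]].
      by have := covLd q; rewrite inE qd qL => /(_ isT).
    have := cardsUI (cov Od :&: red) [set q in L :&: red | labin cl A q].
    rewrite h4 cards0 addn0 => <-; apply: subset_leq_card; apply/subsetP => q.
    move=> /setUP[/setIP[qd qr]|/setIdP[/setIP[qL qr] h]]; rewrite in_set qr.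
      by have /andP[q1 q2] := covLd q qd; apply: lab2.
    exact: lab1.
  (* The surplus [slack] of 3 tau pays for the rounding loss in [A3]. *)
  by move: Or slack A3 h1 h2 h3; clear; lia.
- have h1 : (#|cov O :\: red| <= #|N3s S :\: red| + #|cov Od :\: red| + #|cov O2 :&: (L :\: red)|)%N.
    apply: leq_trans (leq_add (leq_card_setU _ _) (leqnn _)).
    apply: leq_trans (leq_card_setU _ _); apply: subset_leq_card; apply/subsetP => q.
    rewrite in_setD => /andP[qr qc]; have := subsetP covS q qc.
    rewrite !(in_setU, in_setI, in_setD) qr /= => /or3P[->|->|q2] //; first by rewrite orbT.
    by rewrite q2 (covL2 _ q2) !orbT.
  have h3 : (#|cov Od :\: red| + #|[set q in L :\: red | labin cl A q]| <=
             #|[set q in ~: red | labin cl (Ad :|: A) q]|)%N.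
    have h4 : (cov Od :\: red) :&: [set q in L :\: red | labin cl A q] = set0.
      apply/setP => q; rewrite !inE; apply/negP => /andP[/andP[_ qd] /andP[/andP[_ qL] _]].
      by have := covLd q; rewrite inE qd qL => /(_ isT).
    have := cardsUI (cov Od :\: red) [set q in L :\: red | labin cl A q].
    rewrite h4 cards0 addn0 => <-; apply: subset_leq_card; apply/subsetP => q.
    move=> /setUP[/setDP[qd qr]|/setIdP[/setDP[qL qr] h]]; rewrite in_set in_setC qr.
      by have /andP[q1 q2] := covLd q qd; apply: lab2.
    exact: lab1.
  by move: Ob A2 h1 h3; clear; lia.
Qed.

Theorem good_guess_exists O k r b : (0 < #|O|)%N -> (#|O| <= k)%N ->
  (r <= #|cov O :&: red|)%N -> (b <= #|cov O :\: red|)%N ->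
  exists s1 s2 s3 tau ks rs bs, good_guess k r b s1 s2 s3 tau ks rs bs.
Proof.
move=> O0 Ok Or Ob; have [tch|nt] := boolP (touch2 O).
  have [i [ks [rs [bs G]]]] := good_guess_touch tch Ok Or Ob.
  by exists i, i, i, #|T|, ks, rs, bs.
have [le3|gt3] := leqP #|O| 2; last by apply: good_guess_sep Or Ob; rewrite ?gt3.
have [|s1 [s2 [s3 G]]] := @good_guess_trivial O k r b _ Ok Or Ob.
  by rewrite O0 leqW.
by exists s1, s2, s3, #|T|, 0%N, 0%N, 0%N.
Qed.

End Guess.

(** * Reasoning about loop programs *)

Fixpoint rdv (e : expr) : seq nat :=
  match e with
  | Cst _ => [::]
  | Var x => [:: x]
  | Arr _ e1 => rdv e1
  | Add e1 e2 | Sub e1 e2 => rdv e1 ++ rdv e2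
  | Ifp e1 e2 e3 => rdv e1 ++ rdv e2 ++ rdv e3
  | Sum b x e1 => b :: [seq y <- rdv e1 | y != x]
  end.

Fixpoint rda (e : expr) : seq nat :=
  match e with
  | Cst _ | Var _ => [::]
  | Arr a e1 => a :: rda e1
  | Add e1 e2 | Sub e1 e2 => rda e1 ++ rda e2
  | Ifp e1 e2 e3 => rda e1 ++ rda e2 ++ rda e3
  | Sum b x e1 => rda e1
  end.

Fixpoint wrv (c : cmd) : seq nat :=
  match c with
  | Skip | Sto _ _ _ => [::]
  | Asg x _ => [:: x]
  | Seq c1 c2 | If _ c1 c2 => wrv c1 ++ wrv c2
  | For _ x c1 => x :: wrv c1
  end.

Fixpoint wra (c : cmd) : seq nat :=
  match c with
  | Skip | Asg _ _ => [::]
  | Sto a _ _ => [:: a]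
  | Seq c1 c2 | If _ c1 c2 => wra c1 ++ wra c2
  | For _ _ c1 => wra c1
  end.

Definition same_on (V A : seq nat) s1 s2 :=
  (forall x, x \in V -> sc s1 x = sc s2 x) /\
  (forall a i, a \in A -> ar s1 a i = ar s2 a i).

Lemma same_on_cat V1 V2 A1 A2 s1 s2 : same_on (V1 ++ V2) (A1 ++ A2) s1 s2 ->
  same_on V1 A1 s1 s2 /\ same_on V2 A2 s1 s2.
Proof.
by move=> [V A]; split; split=> [x|a i] h; [apply: V|apply: A|apply: V|apply: A];
   rewrite mem_cat h ?orbT.
Qed.

Lemma eval_ext e s1 s2 : same_on (rdv e) (rda e) s1 s2 -> eval s1 e = eval s2 e.
Proof.
elim: e s1 s2 => [z|x|a e1 H1|e1 H1 e2 H2|e1 H1 e2 H2|e1 H1 e2 H2 e3 H3|b x e1 H1] //= s1 s2.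
- by move=> [V _]; apply: V; rewrite inE.
- move=> [V A]; rewrite (H1 s1 s2) ?A ?inE ?eqxx //; split=> // a0 i h.
  by apply: A; rewrite inE h orbT.
- by move=> /same_on_cat[/H1-> /H2->].
- by move=> /same_on_cat[/H1-> /H2->].
- by move=> /same_on_cat[/H1-> /same_on_cat[/H2-> /H3->]].
- move=> [V A]; rewrite V ?inE ?eqxx //; apply: eq_bigr => i _; apply: H1.
  split=> // y yv /=; rewrite !updE; case: eqP => // /eqP ne; apply: V.
  by rewrite inE mem_filter ne yv orbT.
Qed.

Lemma run_sc c s x : x \notin wrv c -> sc (run c s) x = sc s x.
Proof.
elim: c s => [|y e|a e1 e2|c1 IH1 c2 IH2|e c1 IH1 c2 IH2|b y c IH] s //=.
- by rewrite inE => ne; rewrite upd_neq.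
- by rewrite mem_cat negb_or => /andP[n1 n2]; rewrite IH2 ?IH1.
- by rewrite mem_cat negb_or => /andP[n1 n2]; case: ifP => _; [apply: IH1|apply: IH2].
- rewrite inE negb_or => /andP[ne nin]; move: (iota _ _) => l.
  by elim: l s => //= i l IHl s; rewrite IHl IH //= upd_neq.
Qed.

Lemma run_ar c s a i : a \notin wra c -> ar (run c s) a i = ar s a i.
Proof.
elim: c s => [|y e|a' e1 e2|c1 IH1 c2 IH2|e c1 IH1 c2 IH2|b y c IH] s //=.
- by rewrite inE => /negbTE->.
- by rewrite mem_cat negb_or => /andP[n1 n2]; rewrite IH2 ?IH1.
- by rewrite mem_cat negb_or => /andP[n1 n2]; case: ifP => _; [apply: IH1|apply: IH2].
- move=> nin; move: (iota _ _) => l.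
  by elim: l s => //= j l IHl s; rewrite IHl IH.
Qed.

Lemma for_inv b x c s (P : nat -> store -> Prop) : P 0%N s ->
  (forall i s', (i < cnt (sc s b))%N -> P i s' -> P i.+1 (run c (sset x i%:Z s'))) ->
  P (cnt (sc s b)) (run (For b x c) s).
Proof.
move=> P0 PS /=; set m := cnt _ in PS *.
have: forall k j s', (j + k = m)%N -> P j s' ->
    P m (foldl (fun s i => run c (sset x i%:Z s)) s' (iota j k)).
  elim=> [|k IH] j s' E Pj /=; first by rewrite -E addn0.
  by apply: IH; [rewrite addSnnS|apply: PS => //; lia].
by apply.
Qed.

Definition vI := 16%N.
Definition Fill b a e := For b vI (Sto a (Var vI) e).

(** As [a] does not occur in [e], every evaluation sees the initial arrays and the loop is a
    simultaneous assignment. For this reason in-place updates pass through an auxiliary array such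
    as [aTmp]. *)
Lemma fillE b a e s : a \notin rda e -> b != vI ->
  forall a' i, ar (run (Fill b a e) s) a' i =
    if (a' == a) && (i < cnt (sc s b))%N then eval (sset vI i%:Z s) e
    else ar s a' i.
Proof.
move=> na nb.
pose P m s' := (forall x, x != vI -> sc s' x = sc s x) /\
   forall a' i, ar s' a' i =
    if (a' == a) && (i < m)%N then eval (sset vI i%:Z s) e else ar s a' i.
suff: P (cnt (sc s b)) (run (Fill b a e) s) by case.
apply: for_inv => [|m s' _ [Hv Ha]]; first by split=> // a' i; rewrite andbF.
split=> [x ne|a' i] /=; first by rewrite upd_neq ?Hv.
have E : eval (sset vI m%:Z s') e = eval (sset vI m%:Z s) e.
  apply: eval_ext; split=> [x _|a0 i0 h] /=.
    by rewrite !updE; case: eqP => // /eqP; apply: Hv.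
  by rewrite Ha (_ : (a0 == a) = false) //; apply: contraNF na => /eqP<-.
rewrite ?upd_eq; case: eqP => [->|ne] /=; last by rewrite Ha; case: eqP.
rewrite updE ?absz_nat; case: eqP => [->|/eqP ni]; first by rewrite ltnSn E.
by rewrite Ha eqxx /= ltnS [(i <= m)%N]leq_eqVlt (negbTE ni).
Qed.

Lemma fill_sc b a e s x : x != vI -> sc (run (Fill b a e) s) x = sc s x.
Proof. by move=> ne; apply: run_sc; rewrite /= inE. Qed.

Section Counting.
Variable n : nat.

Lemma sum_bool (P : nat -> bool) :
  \sum_(0 <= i < n) (if P i then 1 else 0 : int) = #|[set i : 'I_n | P i]|%:Z.
Proof.
rewrite big_mkord -big_mkcond /= sumr_const natz.
by congr (Posz _); apply: eq_card => i; rewrite !inE.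
Qed.

End Counting.

Definition Cnt x e := Sum 0 x (Ifp e (Cst 1) (Cst 0)).
Definition And e1 e2 := Ifp e1 (Ifp e2 (Cst 1) (Cst 0)) (Cst 0).
Definition Not e := Ifp e (Cst 0) (Cst 1).

Lemma cntE n s x e : sc s 0%N = n%:Z ->
  eval s (Cnt x e) = #|[set i : 'I_n | 0 < eval (sset x i%:Z s) e]|%:Z.
Proof. by move=> E; rewrite /= E /= sum_bool. Qed.

Lemma andE s e1 e2 : (0 < eval s (And e1 e2)) = (0 < eval s e1) && (0 < eval s e2).
Proof. by rewrite /=; case: (0 < eval s e1) => //; case: (0 < eval s e2). Qed.

Lemma notE s e : (0 < eval s (Not e)) = ~~ (0 < eval s e).
Proof. by rewrite /=; case: (0 < eval s e). Qed.

Lemma anyE n s x e : sc s 0%N = n%:Z ->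
  (0 < eval s (Cnt x e)) = [exists i : 'I_n, 0 < eval (sset x i%:Z s) e].
Proof.
move=> E; rewrite (cntE _ _ E) ltz_nat; apply/card_gt0P/existsP => -[i].
  by rewrite inE => h; exists i.
by move=> h; exists i; rewrite inE.
Qed.

(* Multiplication by the read-only scalar N = n + 1, by a scalar at most N,
   and row-major indexing with row length N. *)
Definition mulN e := Sum 1 39 e.
Definition mulV x e := Sum 1 38 (Ifp (Sub (Var x) (Var 38)) e (Cst 0)).
Definition idx e1 e2 := Add (mulN e1) e2.

Lemma mulNE N s e : sc s 1%N = N%:Z -> 39%N \notin rdv e ->
  eval s (mulN e) = N%:Z * eval s e.
Proof.
move=> E nv; rewrite /= E /= (eq_bigr (fun=> eval s e)) => [|i _].
  by rewrite big_const_nat subn0 iter_addr addr0 -mulr_natl natz.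
apply: eval_ext; split=> // x xv /=; rewrite upd_neq //.
by apply: contraNneq nv => <-.
Qed.

Lemma mulVE N k s x e : sc s 1%N = N%:Z -> sc s x = k%:Z -> (k <= N)%N ->
  38%N \notin rdv e -> x != 38%N -> eval s (mulV x e) = k%:Z * eval s e.
Proof.
move=> E Ek kN nv nx; rewrite /= E /=.
rewrite (eq_bigr (fun i => if (i < k)%N then eval s e else 0)) => [|i _]; last first.
  rewrite upd_neq // Ek upd_eq (_ : (0 < k%:Z - i%:Z) = (i < k)%N); last by lia.
  case: ifP => // _; apply: eval_ext; split=> // y yv /=; rewrite upd_neq //.
  by apply: contraNneq nv => <-.
rewrite (@big_cat_nat _ _ _ k) //= big_nat [X in _ + X]big_nat.
rewrite [X in _ + X]big1 => [|i /andP[ki _]]; last by rewrite ltnNge ki.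
rewrite (eq_bigr (fun=> eval s e)) => [|i /andP[_ ->]] //.
by rewrite -big_nat big_const_nat subn0 iter_addr addr0 addr0 -mulr_natl natz.
Qed.

Definition nest b (xs : seq nat) body := foldr (For b) body xs.

Lemma nest_inv b xs body (P : store -> Prop) :
  (forall x v s, x \in xs -> P s -> P (sset x v s)) ->
  (forall s, P s -> P (run body s)) -> forall s, P s -> P (run (nest b xs body) s).
Proof.
move=> Ps Pb; elim: xs Ps => [|x xs IH] Ps s Hs; first exact: Pb.
have {}IH : forall s, P s -> P (run (nest b xs body) s).
  by apply: IH => y v s' yx; apply: Ps; rewrite inE yx orbT.
apply: (for_inv (P := fun _ => P)) => // i s' _ Hs'.
by apply: IH; apply: Ps; rewrite ?inE ?eqxx.
Qed.

(* A brute-force search: once Q is established, for the one valuation nu at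
   which the body establishes it, it is never lost. *)
Lemma nest_hit b xs body N (nu : nat -> nat) (I Q : store -> Prop) :
  uniq xs -> (forall x, x \in xs -> x \notin wrv body) ->
  (forall x, x \in xs -> (nu x < N)%N) ->
  (forall x v s, x \in xs -> I s -> I (sset x v s)) ->
  (forall x v s, x \in xs -> Q s -> Q (sset x v s)) ->
  (forall s, I s -> cnt (sc s b) = N) ->
  (forall s, I s -> I (run body s)) -> (forall s, I s -> Q s -> Q (run body s)) ->
  (forall s, I s -> (forall x, x \in xs -> sc s x = (nu x)%:Z) -> Q (run body s)) ->
  forall s, I s -> Q (run (nest b xs body) s).
Proof.
move=> U W nuN Is Qs Icnt Ib Qb.
(* [K] carries the values of the outer loop variables that are already right; the induction on [xs]
   extends it. *)
suff: forall K : store -> Prop, (forall x v s, x \in xs -> K s -> K (sset x v s)) ->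
    (forall s, K s -> K (run body s)) ->
    (forall s, I s -> K s -> (forall x, x \in xs -> sc s x = (nu x)%:Z) -> Q (run body s)) ->
    forall s, I s -> K s -> Q (run (nest b xs body) s).
  move=> H est s Hs; apply: (H (fun=> True)) => // s' Hs' _; exact: est.
elim: xs U W nuN Is Qs => [|x xs IH] U W nuN Is Qs K Ks Kb est s Hs HK.
  by apply: est.
have sub y : y \in xs -> y \in x :: xs by rewrite inE orbC => ->.
have /andP[xn U'] := U.
have hx : x \in x :: xs by rewrite inE eqxx.
pose P i s' := [/\ I s', K s' & (nu x < i)%N -> Q s'].
suff: P (cnt (sc s b)) (run (For b x (nest b xs body)) s).
  by case=> _ _; apply; rewrite Icnt // nuN.
apply: for_inv; first by split.
move=> i s' _ [Hs' HK' HQ'].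
have I1 := Is x i%:Z s' hx Hs'.
split.
- by apply: (@nest_inv b xs body I) => // y v s2 /sub; apply: Is.
- by apply: (@nest_inv b xs body K) => // [y v s2 /sub|]; [apply: Ks|apply: Ks].
rewrite ltnS leq_eqVlt => /orP[/eqP E|lt].
  apply: (IH U' _ _ _ _ (fun s => K s /\ sc s x = (nu x)%:Z)) => //.
  - by move=> y /sub; apply: W.
  - by move=> y /sub; apply: nuN.
  - by move=> y v s2 /sub; apply: Is.
  - by move=> y v s2 /sub; apply: Qs.
  - move=> y v s2 yx [K2 E2]; split; first exact: Ks (sub _ yx) K2.
    by rewrite /= upd_neq //; apply: contraNneq xn => ->.
  - by move=> s2 [K2 E2]; split; [apply: Kb|rewrite run_sc ?W].
  - move=> s2 Hs2 [K2 E2] V; apply: est => // y; rewrite inE => /orP[/eqP->//|].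
    exact: V.
  - by split; [apply: Ks|rewrite /= upd_eq E].
suff [] : I (run (nest b xs body) (sset x i%:Z s')) /\ Q (run (nest b xs body) (sset x i%:Z s')) by [].
apply: (@nest_inv b xs body (fun s => I s /\ Q s)).
- by move=> y v s2 /sub yx [h1 h2]; split; [apply: Is|apply: Qs].
- by move=> s2 [h1 h2]; split; [apply: Ib|apply: Qb].
by split=> //; apply: Qs => //; apply: HQ'.
Qed.

(** * The program *)

(* Read-only scalars: 0 is n, 1 is N = n + 1, 2 bounds the bit lengths,
   3 is N ^ 3 and 4 is N ^ 7.  The guessed scalars are 5, 6 (the pair whose
   distance is the radius), 7, 8, 9 (the three expanded centres), 10 (tau) and
   11, 12, 13 (the size and the two requirements of the LP); 14 and 15 are the
   best pair found so far.  Scalars from 30 on are bound by sums. *)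
Notation "'Do' c1 ; .. ; c2 'End'" := (Seq c1 .. (Seq c2 Skip) ..)
  (at level 0, c1 at level 99, c2 at level 99, only parsing).

Definition aIn := 0%N.
Definition aAdj := 1%N.
Definition aNb2 := 2%N.
Definition aNb3 := 3%N.
Definition aLive := 4%N.
Definition aLab := 5%N.
Definition aMark := 6%N.
Definition aAllow := 7%N.
Definition aX := 8%N.
Definition aZ := 9%N.
Definition aF := 10%N.
Definition aG := 11%N.
Definition aPow := 12%N.
Definition aCh := 13%N.
Definition aOut := 14%N.
Definition aKey := 15%N.
Definition aTmp := 16%N.

Definition eRed e := Arr aIn (Add (Cst 4) e).
Definition eLive x := Arr aLive (Var x).
Definition eAdj x y := Arr aAdj (idx (Var x) (Var y)).
Definition eNb2 x y := Arr aNb2 (idx (Var x) (Var y)).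
Definition eNb3 x y := Arr aNb3 (idx (Var x) (Var y)).
Definition eMul0 x := Sum 0 39 (Var x).
(** Position 4 + n + 2 (n x + y) of a numerator in the encoded input, with the factor 2 written as a
    sum. *)
Definition eDist x y := Add (Add (Cst 4) (Var 0))
  (Add (Add (eMul0 x) (Var y)) (Add (eMul0 x) (Var y))).
Definition eNum x y := Arr aIn (eDist x y).
Definition eDen x y := Arr aIn (Add (eDist x y) (Cst 1)).

(* Scalar 20 becomes the product of 18 and 19. *)
Definition cMult := Do
  Asg 20 (Cst 0);
  For 2 21 (Do
    Asg 22 (Arr aPow (Sub (Sub (Var 2) (Cst 1)) (Var 21)));
    If (Add (Sub (Var 19) (Var 22)) (Cst 1))
      (Do Asg 19 (Sub (Var 19) (Var 22));
          Asg 20 (Add (Add (Var 20) (Var 20)) (Var 18)) End)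
      (Asg 20 (Add (Var 20) (Var 20))) End) End.

Definition cProd e1 e2 := Do Asg 18 e1; Asg 19 e2; cMult End.

(** Distances are compared by cross-multiplication, the only place where input numbers are
    multiplied with each other. *)
Definition cAdj := For 0 16 (For 0 17 (Do
  cProd (eNum 16 17) (eDen 5 6); Asg 23 (Var 20);
  cProd (eNum 5 6) (eDen 16 17);
  Sto aAdj (idx (Var 16) (Var 17)) (Add (Sub (Var 20) (Var 23)) (Cst 1)) End)).

Definition Fill2 a e := For 0 16 (For 0 17 (Sto a (idx (Var 16) (Var 17)) e)).

Definition cNb2 := Fill2 aNb2 (Cnt 30 (And (eAdj 16 30) (eAdj 30 17))).
Definition cNb3 := Fill2 aNb3 (Cnt 30 (And (eNb2 16 30) (eAdj 30 17))).

Definition cLive := Do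
  Fill 0 aLive (Ifp (eNb3 7 16) (Cst 0) (Ifp (eNb3 8 16) (Cst 0)
    (Ifp (eNb3 9 16) (Cst 0) (Cst 1))));
  Fill 0 aLab (Cst (-1)) End.

Definition cRelabel x := Do
  Fill 0 aTmp (Ifp (Arr aMark (Var 16)) (Var x) (Arr aLab (Var 16)));
  Fill 0 aLab (Arr aTmp (Var 16));
  Fill 0 aTmp (Ifp (Arr aMark (Var 16)) (Cst 0) (eLive 16));
  Fill 0 aLive (Arr aTmp (Var 16)) End.

Definition cDense := For 0 23 (If
  (Sub (Cnt 30 (And (And (eAdj 23 30) (eLive 30)) (eRed (Var 30))))
       (Add (Var 10) (Var 10)))
  (Do Fill 0 aMark (And (eLive 16) (Cnt 31 (And (eAdj 31 16)
        (Sub (Cnt 30 (And (And (And (eAdj 31 30) (eAdj 23 30)) (eLive 30))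
                     (eRed (Var 30)))) (Var 10)))));
      cRelabel 23 End)
  Skip).

Definition cAllow := Fill 0 aAllow (Not (Cnt 31 (And (And (eAdj 16 31) (eLive 31))
  (Sub (Cnt 30 (And (And (eNb2 31 30) (eLive 30)) (eRed (Var 30))))
       (Add (Var 10) (Add (Var 10) (Var 10))))))).

Definition eX x := Arr aX (Var x).
Definition eZ x := Arr aZ (Var x).
Definition eAl x := Arr aAllow (Var x).
Definition cZ := Fill 0 aZ (Sum 0 30 (Ifp (And (eAl 30) (eAdj 16 30)) (eX 30) (Cst 0))).

(* Scalar 22 is the homogenizing coordinate t of the perceptron. *)
Definition cCount := If
  (Sub (Cst 1) (Add (mulN (Sub (mulV 11 (Var 22))
                     (Sum 0 30 (Ifp (eAl 30) (eX 30) (Cst 0))))) (Var 22)))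
  (Do Fill 0 aTmp (Ifp (Sub (eX 16) (Var 1)) (Sub (eX 16) (Var 1)) (Cst 0));
      Fill 0 aX (Arr aTmp (Var 16));
      Asg 22 (Add (Var 22) (Add (mulV 11 (Var 1)) (Cst 1))) End)
  Skip.

Definition eCol (c : bool) x :=
  And (eLive x) (if c then eRed (Var x) else Not (eRed (Var x))).

Definition cColour c q := Do
  cZ;
  If (Sub (Cst 1) (Add (mulN (Sub
       (Sum 0 30 (Ifp (eCol c 30) (Ifp (Sub (Var 22) (eZ 30)) (eZ 30) (Var 22)) (Cst 0)))
       (mulV q (Var 22)))) (Var 22)))
  (Do Fill 0 aTmp (Add (eX 16) (mulN (Cnt 30
        (And (eCol c 30) (And (eAdj 30 16) (Sub (Var 22) (eZ 30)))))));
      Fill 0 aX (Arr aTmp (Var 16));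
      Asg 24 (Add (Var 22) (Add (mulN (Sub (Cnt 30 (And (eCol c 30)
        (Add (Sub (eZ 30) (Var 22)) (Cst 1)))) (Var q))) (Cst 1)));
      Asg 22 (Ifp (Var 24) (Var 24) (Cst 0)) End)
  Skip End.

Definition cLP := Do
  Fill 0 aX (Cst 0); Asg 22 (Cst 0);
  For 4 23 (Do cCount; cColour true 12; cColour false 13 End) End.

Definition cPick := Do
  Asg 21 (Cst (-1));
  For 0 24 (If (And (eLive 24) (Ifp (Add (Var 21) (Cst 1)) (Sub (eZ 24) (eZ 21)) (Cst 1)))
    (Asg 21 (Var 24)) Skip) End.

Definition cSparse := Do
  cZ;
  For 0 23 (Do cPick;
    If (Add (Var 21) (Cst 1))
      (Do Fill 0 aMark (And (eNb2 21 16) (eLive 16)); cRelabel 21 End) Skip End) End.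

Definition eEq e1 e2 := And (Add (Sub e1 e2) (Cst 1)) (Add (Sub e2 e1) (Cst 1)).
Definition eLab x y := eEq (Arr aLab (Var x)) (Var y).

(** The triple (1, red points, blue points) of a cluster as a number in base N. Clusters are
    disjoint, so in a sum over distinct clusters every digit stays at most n and nothing carries:
    the key of a choice determines its three totals. *)
Definition cKey := Fill 0 aKey (Add (mulN (Add (Var 1)
  (Cnt 30 (And (eLab 30 16) (eRed (Var 30))))))
  (Cnt 30 (And (eLab 30 16) (Not (eRed (Var 30)))))).

Definition eF e := Arr aF e.
(** Subset sum over keys with a witness in each entry: -1 if the key is unreachable, otherwise the
    bit mask of a set of clusters with that key. *)
Definition cKnap := Do
  Fill 3 aF (Ifp (Var 16) (Cst (-1)) (Cst 0));
  For 0 23 (Do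
    Fill 3 aG (Ifp (Add (eF (Var 16)) (Cst 1)) (eF (Var 16))
      (Ifp (And (Add (Sub (Var 16) (Arr aKey (Var 23))) (Cst 1))
                (Add (eF (Sub (Var 16) (Arr aKey (Var 23)))) (Cst 1)))
           (Add (eF (Sub (Var 16) (Arr aKey (Var 23)))) (Arr aPow (Var 23)))
           (Cst (-1))));
    Fill 3 aF (Arr aG (Var 16)) End) End.

Definition cDecode := Do
  Asg 24 (eF (Var 23));
  For 0 25 (Do
    Asg 26 (Sub (Sub (Var 0) (Cst 1)) (Var 25));
    If (Add (Sub (Var 24) (Arr aPow (Var 26))) (Cst 1))
      (Do Asg 24 (Sub (Var 24) (Arr aPow (Var 26)));
          Sto aCh (Var 26) (Cst 1) End)
      (Sto aCh (Var 26) (Cst 0)) End);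
  Sto aCh (Var 7) (Cst 1); Sto aCh (Var 8) (Cst 1); Sto aCh (Var 9) (Cst 1) End.

Definition eCh x := Arr aCh (Var x).
Definition eHit := Cnt 31 (And (eCh 31) (eNb3 31 30)).
Definition eOk := And (Add (Sub (Arr aIn (Cst 1)) (Cnt 30 (eCh 30))) (Cst 1))
  (And (Add (Sub (Cnt 30 (And (eRed (Var 30)) eHit)) (Arr aIn (Cst 2))) (Cst 1))
       (Add (Sub (Cnt 30 (And (Not (eRed (Var 30))) eHit)) (Arr aIn (Cst 3))) (Cst 1))).
(** True when nothing is recorded yet, or when the recorded distance exceeds the current radius,
    with which [eAdj] compares. *)
Definition eBetter := Ifp (Add (Var 14) (Cst 1)) (Not (eAdj 14 15)) (Cst 1).

Definition cTry := For 3 23 (If (Add (eF (Var 23)) (Cst 1))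
  (Do cDecode;
      If (And eOk eBetter)
        (Do Asg 14 (Var 5); Asg 15 (Var 6);
            Fill 0 aOut (Ifp (eCh 16) (Var 16) (Cst (-1))) End) Skip End)
  Skip).

(** All guessed scalars run over 0, ..., n because the counts among them may equal n; the guard
    discards the value n where a point is meant. *)
Definition ePoint x := And (Add (Var x) (Cst 1)) (Sub (Var 0) (Var x)).
Definition eGuard := And (And (ePoint 5) (ePoint 6))
  (And (ePoint 7) (And (ePoint 8) (ePoint 9))).

Definition cBody := If eGuard
  (Do cAdj; cNb2; cNb3; cLive; cDense; cAllow; cLP; cSparse; cKey; cKnap; cTry End)
  Skip.

Definition cPow := Do Asg 23 (Cst 1);
  For 2 21 (Do Sto aPow (Var 21) (Var 23); Asg 23 (Add (Var 23) (Var 23)) End) End.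

Definition guessed := [:: 5; 6; 7; 8; 9; 10; 11; 12; 13]%N.

Definition cSearch := Do
  cPow; Fill 0 aOut (Cst (-1)); Asg 14 (Cst (-1)); Asg 15 (Cst (-1));
  nest 1 guessed cBody End.

Definition cReadonly1 := Do
  Asg 0 (Arr aIn (Cst 0)); Asg 1 (Add (Var 0) (Cst 1)) End.
Definition cReadonly2 := Do
  Asg 3 (mulN (mulN (Var 1)));
  Asg 4 (mulN (mulN (mulN (mulN (Var 3))))) End.

(* Every cell that the output convention may scan is made negative, except
   those of aOut. *)
Definition addn_times k x := iter k (Add (Var x)) (Cst 0).
Definition cClean := foldr Seq Skip (rcons (rcons
  [seq Fill 1 a (Cst (-1)) | a <- iota 0 NA & a != aOut]
  (Sto aOut (Var 0) (Cst (-1))))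
  (Asg 5 (Add (Cst OFF%:Z) (addn_times NA 0)))).

Transparent NA.
(** The read-only part grows with the stages: bounds computed by one stage can no longer be assigned
    in the next. *)
Lemma wf_all : [&& wfc 0 0 cReadonly1, wfc 3 0 cReadonly2, wfc 5 0 cSearch
  & wfc 5 0 cClean].
Proof. by vm_compute. Qed.

(** * Correctness of the program *)

Arguments upd _ _ _ _ /.
Arguments run : simpl never.
Arguments eval : simpl never.

Lemma run_seq c1 c2 s : run (Seq c1 c2) s = run c2 (run c1 s). Proof. by []. Qed.
Lemma run_skip s : run Skip s = s. Proof. by []. Qed.
Lemma run_asg x e s : run (Asg x e) s = sset x (eval s e) s. Proof. by []. Qed.
Lemma run_sto a e1 e2 s :
  run (Sto a e1 e2) s = aset a (absz (eval s e1)) (eval s e2) s.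
Proof. by []. Qed.
Lemma run_if e c1 c2 s :
  run (If e c1 c2) s = if 0 < eval s e then run c1 s else run c2 s.
Proof. by []. Qed.
Definition runE := (run_seq, run_skip, run_asg, run_sto).

Lemma eval_cst z s : eval s (Cst z) = z. Proof. by []. Qed.
Lemma eval_var x s : eval s (Var x) = sc s x. Proof. by []. Qed.
Lemma eval_arr a e s : eval s (Arr a e) = ar s a (absz (eval s e)).
Proof. by []. Qed.
Lemma eval_add e1 e2 s : eval s (Add e1 e2) = eval s e1 + eval s e2.
Proof. by []. Qed.
Lemma eval_sub e1 e2 s : eval s (Sub e1 e2) = eval s e1 - eval s e2.
Proof. by []. Qed.
Lemma eval_ifp e1 e2 e3 s :
  eval s (Ifp e1 e2 e3) = if 0 < eval s e1 then eval s e2 else eval s e3.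
Proof. by []. Qed.
Lemma eval_sum bb x e s : eval s (Sum bb x e) =
  \sum_(0 <= i < cnt (sc s bb)) eval (sset x i%:Z s) e.
Proof. by []. Qed.
Definition evalE := (eval_cst, eval_var, eval_arr, eval_add, eval_sub, eval_ifp).

(** Uniqueness of digits in base n + 1, used for row-major addresses and for keys. *)
Lemma idx_inj n i j m l : (j <= n)%N -> (l <= n)%N ->
  (n.+1 * i + j = n.+1 * m + l)%N -> i = m /\ j = l.
Proof.
move=> jn ln E; suff im : i = m by split=> //; move: E; rewrite im => /addnI.
have := congr1 (fun x => x %/ n.+1)%N E.
by rewrite ![(n.+1 * _)%N]mulnC !divnMDl // !divn_small ?addn0.
Qed.

Lemma fill2E n a e s : a \notin rda e -> sc s 0%N = n%:Z -> sc s 1%N = n.+1%:Z ->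
  forall i j : nat, (i < n)%N -> (j < n)%N -> ar (run (Fill2 a e) s) a (n.+1 * i + j)%N
     = eval (sset 17 j%:Z (sset 16 i%:Z s)) e.
Proof.
move=> na s0 s1.
pose E i j := eval (sset 17 j%:Z (sset 16 i%:Z s)) e.
pose fr s' := (forall x, x != 16%N -> x != 17%N -> sc s' x = sc s x) /\
              (forall a' i, a' != a -> ar s' a' i = ar s a' i).
pose P m s' := fr s' /\ forall i j, (i < m)%N -> (j < n)%N ->
  ar s' a (n.+1 * i + j)%N = E i j.
suff: P (cnt (sc s 0%N)) (run (Fill2 a e) s) by rewrite s0 /= => -[_ H] i j; apply: H.
apply: for_inv; first by split.
move=> m s' _ [[F1 F2] H].
pose Q l s'' := [/\ sc s'' 16%N = m%:Z, fr s'' &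
  forall i j, ((i < m)%N && (j < n)%N) || ((i == m) && (j < l)%N) ->
    ar s'' a (n.+1 * i + j)%N = E i j].
suff: Q (cnt (sc (sset 16 m%:Z s') 0%N)) (run (For 0 17 (Sto a (idx (Var 16) (Var 17)) e)) (sset 16 m%:Z s')).
  rewrite /= F1 // s0 /= => -[_ fr' H']; split=> // i j; rewrite ltnS leq_eqVlt => h jn.
  by apply: H'; rewrite jn !andbT orbC.
apply: for_inv.
  split=> //; first by split=> // x n16 n17 /=; rewrite (negbTE n16) F1.
  by move=> i j; rewrite ltn0 andbF orbF => /andP[]; apply: H.
rewrite /= F1 // s0 /= => l s'' ln [v16 [G1 G2] K].
have e17 : eval (sset 17 l%:Z s'') (idx (Var 16) (Var 17)) = (n.+1 * m + l)%N%:Z.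
  rewrite eval_add (@mulNE n.+1) //= ?G1 // !eval_var /= v16; lia.
have eE : eval (sset 17 l%:Z s'') e = E m l.
  apply: eval_ext; split=> [x _|a' i ha] /=.
    case: eqP => // /eqP n17; case: eqP => [->|/eqP n16]; first by rewrite v16.
    exact: G1.
  by rewrite G2 //; apply: contraNneq na => <-.
split.
- by rewrite /= v16.
- split=> [x n16 n17|a' i ne] /=; first by rewrite (negbTE n17) G1.
  by rewrite (negbTE ne) G2.
move=> i j h.
rewrite -[LHS]/(ar (aset a `|eval (sset 17 l%:Z s'') (idx (Var 16) (Var 17))|%N
  (eval (sset 17 l%:Z s'') e) (sset 17 l%:Z s'')) a (n.+1 * i + j)%N) e17 eE /= eqxx updE.
case: (@eqP _ (n.+1 * i + j)%N (n.+1 * m + l)%N) => [Ei|ni].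
  suff [-> ->] : i = m /\ j = l by [].
  by move: h Ei ln; nia.
apply: K; move: h; rewrite ltnS [(j <= l)%N]leq_eqVlt => /orP[->//|/andP[/eqP im /orP[/eqP jl|jl]]].
  by case: ni; rewrite im jl.
by rewrite im eqxx jl orbT.
Qed.

Section Verify.
Variables (n SZ : nat) (inp : nat -> int).
Variables (d : 'I_n -> 'I_n -> rat) (redp : 'I_n -> bool) (k r b : nat).
Hypothesis dmet : is_metric d.
Hypothesis inp_k : inp 1 = k%:Z.
Hypothesis inp_r : inp 2 = r%:Z.
Hypothesis inp_b : inp 3 = b%:Z.
Hypothesis inp_red : forall i : 'I_n, inp (4 + i) = (redp i)%:Z.
Hypothesis inp_num : forall i j : 'I_n,
  inp (4 + n + ((n * i + j) + (n * i + j))) = numq (d i j).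
Hypothesis inp_den : forall i j : 'I_n,
  inp (4 + n + ((n * i + j) + (n * i + j)) + 1) = denq (d i j).
Hypothesis nSZ : (n <= SZ)%N.
Hypothesis den_SZ : forall i j, denq (d i j) < (2 ^ SZ)%N%:Z.

Local Notation N := n.+1.
Local Notation len := (4 + n + ((n * n) + (n * n)))%N.

Record env (s : store) : Prop := Env {
  env0 : sc s 0%N = n%:Z;
  env1 : sc s 1%N = N%:Z;
  env2 : sc s 2%N = SZ%:Z;
  env3 : sc s 3%N = (N ^ 3)%N%:Z;
  env4 : sc s 4%N = (N ^ 7)%N%:Z;
  envI : forall i, (i < len)%N -> ar s aIn i = inp i;
  envP : forall i, (i < SZ)%N -> ar s aPow i = (2 ^ i)%N%:Z }.

Lemma env_set s x v : (4 < x)%N -> env s -> env (sset x v s).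
Proof. by case: x => [|[|[|[|[|x]]]]] // _ []; split. Qed.

Lemma env_run c s : all (leq 5) (wrv c) -> aIn \notin wra c -> aPow \notin wra c ->
  env s -> env (run c s).
Proof.
move=> /allP W nI nP [e0 e1 e2 e3 e4 eI eP].
have R x : (x < 5)%N -> sc (run c s) x = sc s x.
  by move=> lx; apply: run_sc; apply/negP => /W; rewrite leqNgt lx.
by split; rewrite ?R // => i h; rewrite run_ar ?eI ?eP.
Qed.

Lemma evalA a x y s (i j : nat) : sc s 1%N = N%:Z -> sc s x = i%:Z -> sc s y = j%:Z ->
  x != 39%N -> eval s (Arr a (idx (Var x) (Var y))) = ar s a (N * i + j)%N.
Proof.
move=> s1 sx sy nx; rewrite eval_arr eval_add (@mulNE N) ?inE 1?eq_sym // !eval_var sx sy.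
by congr (ar s a _); lia.
Qed.

Definition rep1 s a (P : pred 'I_n) := forall i : 'I_n, (0 < ar s a i) = P i.
Definition rep2 s a (P : rel 'I_n) :=
  forall i j : 'I_n, (0 < ar s a (N * i + j)%N) = P i j.

Lemma rep2_eval s a P x y (i j : 'I_n) : rep2 s a P -> sc s 1%N = N%:Z ->
  sc s x = i%:Z -> sc s y = j%:Z -> x != 39%N ->
  (0 < eval s (Arr a (idx (Var x) (Var y)))) = P i j.
Proof. by move=> R s1 sx sy nx; rewrite (evalA a s1 sx sy nx) R. Qed.

Lemma rep1_eval s a P x (i : 'I_n) : rep1 s a P -> sc s x = i%:Z ->
  (0 < eval s (Arr a (Var x))) = P i.
Proof. by move=> R sx; rewrite !evalE sx absz_nat R. Qed.

Lemma red_eval s x (i : 'I_n) : env s -> sc s x = i%:Z ->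
  (0 < eval s (eRed (Var x))) = redp i.
Proof.
move=> E sx; rewrite !evalE sx -PoszD absz_nat (envI E) ?inp_red; first by case: (redp i).
by have := ltn_ord i; lia.
Qed.

(** Horner's scheme from the top bit: after [i] steps scalar 19 holds the low SZ - i bits of [y],
    and scalar 20 is [x] times the number [q] formed by the other bits. *)
Lemma multP s (x y : int) : env s -> sc s 18%N = x -> sc s 19%N = y ->
  0 <= y < (2 ^ SZ)%N%:Z -> sc (run cMult s) 20%N = x * y.
Proof.
move=> E sx sy /andP[y0 ySZ].
pose P i s' := [/\ env s', sc s' 18%N = x, 0 <= sc s' 19%N < (2 ^ (SZ - i))%N%:Z &
  exists2 q : int, y = q * (2 ^ (SZ - i))%N%:Z + sc s' 19%N & sc s' 20%N = x * q].
rewrite /cMult !runE eval_cst; set c := For 2 21 _; set s1 := sset 20 0 s.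
have E1 : env s1 by apply: env_set.
have: P (cnt (sc s1 2%N)) (run c s1).
  apply: for_inv.
    split=> //; first by rewrite subn0 /= sy y0.
    by exists 0; rewrite ?mul0r ?mulr0 /= ?sy ?add0r.
  move=> i s'; rewrite (env2 E1) /= => iS [E' x' /andP[r0 rlt] [q yq s20]].
  have pw : ar s' aPow (SZ - 1 - i)%N = (2 ^ (SZ - i.+1))%N%:Z.
    by rewrite (envP E'); [congr (Posz (2 ^ _)); lia|lia].
  have p2 : (2 ^ (SZ - i) = 2 * 2 ^ (SZ - i.+1))%N by rewrite -expnS; congr (2 ^ _)%N; lia.
  have idxE : absz (SZ%:Z - 1 - i%:Z)%R = (SZ - 1 - i)%N by lia.
  rewrite !runE !evalE /= (env2 E') idxE pw run_if !evalE /=.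
  set p := (2 ^ (SZ - i.+1))%N in pw p2 *.
  rewrite p2 PoszM in yq rlt.
  case: ifP => h; rewrite !runE !evalE /=.
    split.
    - by do 4?apply: env_set.
    - by rewrite /= x'.
    - by rewrite /= -/p; lia.
    - exists (2 * q + 1); rewrite /=; last by rewrite s20 x'; ring.
      by rewrite yq; ring.
  split.
  - by do 3?apply: env_set.
  - by rewrite /= x'.
  - by rewrite /= -/p; lia.
  - exists (2 * q); rewrite /=; last by rewrite s20; ring.
    by rewrite yq; ring.
rewrite /P (env2 E1) /= subnn expn0 => -[_ _ /andP[h1 h2] [q yq ->]].
rewrite yq (_ : sc _ 19%N = 0); first by ring.
by lia.
Qed.

Lemma prodP e1 e2 s (x y : int) : env s -> eval s e1 = x -> eval s e2 = y ->
  18%N \notin rdv e2 -> 0 <= y < (2 ^ SZ)%N%:Z ->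
  [/\ env (run (cProd e1 e2) s), sc (run (cProd e1 e2) s) 20%N = x * y,
    forall z, z \notin [:: 18; 19; 20; 21; 22]%N -> sc (run (cProd e1 e2) s) z = sc s z
    & forall a i, ar (run (cProd e1 e2) s) a i = ar s a i].
Proof.
move=> E e1x e2y nv yb; rewrite /cProd 3!run_seq run_skip !run_asg e1x.
have -> : eval (sset 18 x s) e2 = y.
  rewrite -e2y; apply: eval_ext; split=> // z zv /=; rewrite ifN //.
  by apply: contraNneq nv => <-.
have E' : env (sset 19 y (sset 18 x s)) by do 2?apply: env_set.
split.
- exact: env_run.
- exact: multP.
- move=> z; rewrite !inE !negb_or => /and5P[h18 h19 h20 h21 h22].
  rewrite run_sc; last by rewrite !inE !negb_or h19 h20 h21 h22.
  by rewrite /= (negbTE h19) (negbTE h18).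
- by move=> a i; rewrite run_ar.
Qed.

Definition dle (i j i' j' : 'I_n) := d i j <= d i' j'.

Lemma dleE i j i' j' : dle i j i' j' =
  (numq (d i j) * denq (d i' j') <= numq (d i' j') * denq (d i j)).
Proof.
rewrite /dle -{1}(divq_num_den (d i j)) -{1}(divq_num_den (d i' j')).
rewrite ler_pdivrMr ?ltr0z ?denq_gt0 // mulrAC ler_pdivlMr ?ltr0z ?denq_gt0 //.
by rewrite -!rmorphM /= ler_int.
Qed.

Lemma num_den_eval s x y (i j : 'I_n) : env s -> sc s x = i%:Z -> sc s y = j%:Z ->
  x != 39%N -> eval s (eNum x y) = numq (d i j) /\ eval s (eDen x y) = denq (d i j).
Proof.
move=> E sx sy nx.
have e0 : eval s (eMul0 x) = (n * i)%N%:Z.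
  rewrite eval_sum (env0 E) /= (eq_bigr (fun=> i%:Z)) => [|l _]; last first.
    by rewrite eval_var /= (negbTE nx).
  by rewrite big_const_nat subn0 iter_addr addr0 -mulr_natl natz PoszM.
have e1 : eval s (eDist x y) = (4 + n + ((n * i + j) + (n * i + j)))%N%:Z.
  by rewrite /eDist !eval_add e0 !evalE (env0 E) sy; lia.
have le : (n * i + j < n * n)%N.
  have := ltn_ord i; have := ltn_ord j => h1 h2.
  by apply: leq_trans (_ : n * i + n <= _)%N; nia.
split.
  by rewrite /eNum eval_arr e1 absz_nat (envI E) ?inp_num //; lia.
by rewrite /eDen eval_arr eval_add e1 eval_cst -PoszD absz_nat (envI E) ?inp_den //; lia.
Qed.

Lemma adjP s (a c : 'I_n) : env s -> sc s 5%N = a%:Z -> sc s 6%N = c%:Z ->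
  rep2 (run cAdj s) aAdj (fun i j => dle i j a c).
Proof.
move=> E s5 s6.
pose fr s' := [/\ env s', sc s' 5%N = a%:Z & sc s' 6%N = c%:Z].
pose P m s' := fr s' /\ forall i j : 'I_n, (i < m)%N -> (0 < ar s' aAdj (N * i + j)%N) = dle i j a c.
suff: P (cnt (sc s 0%N)) (run cAdj s).
  by rewrite /P (env0 E) => -[_ H] i j; apply: H; rewrite /= ltn_ord.
apply: for_inv; first by split.
rewrite (env0 E) /= => m s' mn [[E' s5' s6'] H].
pose Q l s'' := [/\ fr s'', sc s'' 16%N = m%:Z & forall i j : 'I_n,
  (i < m)%N || ((i == m :> nat) && (j < l)%N) -> (0 < ar s'' aAdj (N * i + j)%N) = dle i j a c].
set body := For 0 17 _; set s1 := sset 16 m%:Z s'.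
suff: Q (cnt (sc s1 0%N)) (run body s1).
  rewrite /Q /= (env0 E') /= => -[fr' _ H']; split=> // i j; rewrite ltnS leq_eqVlt => h.
  by apply: H'; rewrite ltn_ord andbT orbC.
apply: for_inv.
  split=> //; first by split=> //; apply: env_set.
  by move=> i j; rewrite ltn0 andbF orbF; apply: H.
rewrite /= (env0 E') /= => l s2 ln [[E2 s52 s62] s162 H2].
rewrite 4!run_seq run_skip; set s3 := sset 17 l%:Z s2.
have E3 : env s3 by apply: env_set.
pose im := Ordinal mn; pose jl := Ordinal ln.
have [n1 _] := @num_den_eval s3 16 17 im jl E3 s162 erefl isT.
have [_ d2] := @num_den_eval s3 5 6 a c E3 s52 s62 isT.
have bnd i j : 0 <= denq (d i j) < (2 ^ SZ)%N%:Z by rewrite denq_ge0 den_SZ.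
have [E4 m4 f4 g4] := prodP E3 n1 d2 isT (bnd a c).
set s4 := run _ s3 in E4 m4 f4 g4 *.
rewrite run_asg run_sto eval_var m4; set sa := sset 23 _ s4.
have E5 : env sa by apply: env_set.
have a5 : sc sa 5%N = a%:Z by rewrite /= f4.
have a6 : sc sa 6%N = c%:Z by rewrite /= f4.
have a16 : sc sa 16%N = im%:Z by rewrite /= f4.
have a17 : sc sa 17%N = jl%:Z by rewrite /= f4.
have [n5 _] := @num_den_eval sa 5 6 a c E5 a5 a6 isT.
have [_ d5] := @num_den_eval sa 16 17 im jl E5 a16 a17 isT.
have [E6 m6 f6 g6] := prodP E5 n5 d5 isT (bnd im jl).
set sb := run _ sa in E6 m6 f6 g6 *.
have i6 : eval sb (idx (Var 16) (Var 17)) = (N * m + l)%N%:Z.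
  by rewrite eval_add (mulNE (env1 E6)) // !eval_var !f6 // a16 a17 /=; lia.
rewrite i6 !eval_add !eval_sub !eval_var eval_cst m6 f6 //.
split.
- split; first by case: E6 => *; split.
  + by rewrite -[LHS]/(sc sb 5%N) f6.
  + by rewrite -[LHS]/(sc sb 6%N) f6.
- by rewrite -[LHS]/(sc sb 16%N) f6.
move=> i j h; rewrite /=.
case: (@eqP _ (N * i + j)%N (N * m + l)%N) => [Ei|ni].
  have [-> ->] : i = im /\ j = jl.
    by have [h1 h2] := idx_inj (ltnW (ltn_ord j)) (ltnW ln) Ei; split; apply: val_inj.
  by rewrite dleE ltzD1 subr_ge0.
rewrite g6 /= g4 /=; apply: H2.
move: h; rewrite ltnS [(j <= l)%N]leq_eqVlt => /orP[->//|/andP[/eqP im' /orP[/eqP jl'|jl']]].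
  by case: ni; rewrite im' jl'.
by rewrite im' eqxx jl' orbT.
Qed.

(** * The phases on the graph of one radius *)

Definition redS := [set i : 'I_n | redp i].

Section Graph.
Variable ad : rel 'I_n.
Hypotheses (adxx : reflexive ad) (adC : symmetric ad).

Lemma nb2_fill s : env s -> rep2 s aAdj ad ->
  rep2 (run cNb2 s) aNb2 (fun i j => j \in nb2 ad i).
Proof.
move=> E R i j /=; rewrite (fill2E (n := n)) ?(env0 E) ?(env1 E) //.
have Eij : env (sset 17 j%:Z (sset 16 i%:Z s)) by do 2?apply: env_set.
rewrite (anyE _ _ (env0 Eij)) inE; apply: eq_existsb => u.
rewrite andE; congr (_ && _).
  by apply: (@rep2_eval _ _ ad 16 30 i u) => //; exact: (env1 E).
by apply: (@rep2_eval _ _ ad 30 17 u j) => //; exact: (env1 E).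
Qed.

Lemma nb3_fill s : env s -> rep2 s aAdj ad ->
  rep2 s aNb2 (fun i j => j \in nb2 ad i) ->
  rep2 (run cNb3 s) aNb3 (fun i j => j \in nb3 ad i).
Proof.
move=> E R R2 i j /=; rewrite (fill2E (n := n)) ?(env0 E) ?(env1 E) //.
have Eij : env (sset 17 j%:Z (sset 16 i%:Z s)) by do 2?apply: env_set.
rewrite (anyE _ _ (env0 Eij)) [RHS]inE; apply: eq_existsb => u.
rewrite andE; congr (_ && _).
  by apply: (@rep2_eval _ _ (fun i j => j \in nb2 ad i) 16 30 i u) => //; exact: (env1 E).
by apply: (@rep2_eval _ _ ad 30 17 u j) => //; exact: (env1 E).
Qed.

Record gr s : Prop := Gr {
  gr_env : env s;
  gr1 : rep2 s aAdj ad;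
  gr2 : rep2 s aNb2 (fun i j => j \in nb2 ad i);
  gr3 : rep2 s aNb3 (fun i j => j \in nb3 ad i) }.

Definition ro_arrays := [:: aIn; aPow; aAdj; aNb2; aNb3].

Lemma gr_run c s : all (leq 5) (wrv c) -> ~~ has (mem (wra c)) ro_arrays ->
  gr s -> gr (run c s).
Proof.
move=> W; rewrite /= !negb_or => /and5P[h1 h2 h3 h4 /andP[h5 _]] [E g1 g2 g3].
by split; [exact: env_run|..] => i j; rewrite run_ar // ?g1 ?g2 ?g3.
Qed.

Lemma gr_set x v s : (4 < x)%N -> gr s -> gr (sset x v s).
Proof. by move=> lx [E g1 g2 g3]; split=> //; apply: env_set. Qed.

Lemma eAdjP s x y (i j : 'I_n) : gr s -> sc s x = i%:Z -> sc s y = j%:Z ->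
  x != 39%N -> (0 < eval s (eAdj x y)) = ad i j.
Proof. by move=> G sx sy nx; apply: (rep2_eval (gr1 G) (env1 (gr_env G)) sx sy nx). Qed.

Lemma eNb2P s x y (i j : 'I_n) : gr s -> sc s x = i%:Z -> sc s y = j%:Z ->
  x != 39%N -> (0 < eval s (eNb2 x y)) = (j \in nb2 ad i).
Proof. by move=> G sx sy nx; apply: (rep2_eval (gr2 G) (env1 (gr_env G)) sx sy nx). Qed.

Lemma eNb3P s x y (i j : 'I_n) : gr s -> sc s x = i%:Z -> sc s y = j%:Z ->
  x != 39%N -> (0 < eval s (eNb3 x y)) = (j \in nb3 ad i).
Proof. by move=> G sx sy nx; apply: (rep2_eval (gr3 G) (env1 (gr_env G)) sx sy nx). Qed.

Definition repL s (L : {set 'I_n}) := rep1 s aLive (fun q => q \in L).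
Definition repC s (cl : 'I_n -> option 'I_n) := forall q : 'I_n,
  ar s aLab q = if cl q is Some j then (j : nat)%:Z else -1.

Lemma liveP s (s1 s2 s3 : 'I_n) : gr s -> sc s 7%N = s1%:Z -> sc s 8%N = s2%:Z ->
  sc s 9%N = s3%:Z ->
  repL (run cLive s) (~: nb3s ad [set s1; s2; s3]) /\ repC (run cLive s) (fun=> None).
Proof.
move=> G h1 h2 h3; have E := gr_env G; rewrite /cLive 2!run_seq run_skip.
set s' := run (Fill 0 aLive _) s.
split=> q; rewrite fillE //.
  rewrite [_ && _]/= /s' fillE //= (env0 E) ltn_ord !eval_ifp !eval_cst.
  have G' : gr (sset vI q%:Z s) by apply: gr_set.
  rewrite (@eNb3P _ 7 16 s1 q G') // (@eNb3P _ 8 16 s2 q G') // (@eNb3P _ 9 16 s3 q G') //.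
  rewrite in_setC; case: (nb3sP ad [set s1; s2; s3] q) => [[c]|no] /=.
    by rewrite !inE => /orP[/orP[/eqP->|/eqP->]|/eqP->] ->; rewrite ?if_same.
  by do 3?[case: ifP => [h|_]; first by case: no; eexists; last exact: h; rewrite !inE eqxx ?orbT].
by rewrite /= fill_sc // (env0 E) ltn_ord.
Qed.

Lemma relabelP x s (p : 'I_n) (D L : {set 'I_n}) cl : env s -> sc s x = p%:Z -> x != 16%N ->
  rep1 s aMark (fun q => q \in D) -> repL s L -> repC s cl ->
  repL (run (cRelabel x) s) (L :\: D) /\
  repC (run (cRelabel x) s) (fun q => if q \in D then Some p else cl q).
Proof.
move=> E sx nx mD rL rC; rewrite /cRelabel 4!run_seq run_skip.
set s1 := run (Fill 0 aTmp _) s; set s2 := run (Fill 0 aLab _) s1.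
set s3 := run (Fill 0 aTmp _) s2; set s4 := run _ s3.
have z0 : cnt (sc s 0%N) = n by rewrite (env0 E).
have z1 : cnt (sc s1 0%N) = n by rewrite fill_sc.
have z2 : cnt (sc s2 0%N) = n by rewrite fill_sc.
have z3 : cnt (sc s3 0%N) = n by rewrite fill_sc.
split=> q.
  rewrite /s4 fillE // z3 ltn_ord /= !evalE /= ?absz_nat /s3 fillE // z2 ltn_ord /=.
  rewrite !evalE /= ?absz_nat /s2 !fillE // /s1 ?fillE //=.
  by rewrite mD in_setD; case: ifP => // _; rewrite rL.
rewrite /s4 fillE //= /s3 fillE //= /s2 fillE // z1 ltn_ord /= !evalE /= ?absz_nat.
rewrite /s1 fillE // z0 ltn_ord /= !evalE /= ?absz_nat mD (negbTE nx) sx.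
by case: ifP => // _; rewrite rC.
Qed.

Lemma eRedP s x (i : 'I_n) : gr s -> sc s x = i%:Z ->
  (0 < eval s (eRed (Var x))) = (i \in redS).
Proof. by move=> G sx; rewrite (red_eval (gr_env G) sx) inE. Qed.

Lemma eLiveP s L x (i : 'I_n) : repL s L -> sc s x = i%:Z ->
  (0 < eval s (eLive x)) = (i \in L).
Proof. by move=> rL sx; apply: rep1_eval sx. Qed.

Lemma subz_gt0 (u v : nat) : (0 < u%:Z - v%:Z) = (v < u)%N.
Proof. by rewrite subr_gt0 ltz_nat. Qed.

Lemma sub1_gt0 (y : int) : (0 < 1 - y) = (y <= 0). Proof. by lia. Qed.

Lemma take_enum_ord m (mn : (m < n)%N) :
  take m.+1 (enum 'I_n) = rcons (take m (enum 'I_n)) (Ordinal mn).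
Proof.
rewrite (take_nth (Ordinal mn)) ?size_enum_ord //; congr rcons.
by apply: val_inj; rewrite /= nth_enum_ord.
Qed.

Lemma denseP s tau L cl : gr s -> sc s 10%N = tau%:Z -> repL s L -> repC s cl ->
  let st := foldl (dstep ad redS tau) (L, cl) (enum 'I_n) in
  repL (run cDense s) st.1 /\ repC (run cDense s) st.2.
Proof.
move=> G s10 rL rC.
pose st m := foldl (dstep ad redS tau) (L, cl) (take m (enum 'I_n)).
pose P m s' := [/\ gr s', sc s' 10%N = tau%:Z, repL s' (st m).1 & repC s' (st m).2].
suff: P (cnt (sc s 0%N)) (run cDense s).
  rewrite /P (env0 (gr_env G)) /= => -[_ _]; rewrite /st take_oversize //.
  by rewrite size_enum_ord.
apply: for_inv; first by split=> //; rewrite /st take0.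
rewrite (env0 (gr_env G)) /= => m s' mn [G' t' L' C'].
pose p := Ordinal mn; set s1 := sset 23 m%:Z s'.
have G1 : gr s1 by apply: gr_set.
have E1 := gr_env G1.
rewrite /P [st m.+1]/st take_enum_ord foldl_rcons -/(st m) -/p /dstep run_if.
move: (st m) L' C' => [L1 cl1] /= L1r C1r.
have big : (0 < eval s1 (Sub (Cnt 30 (And (And (eAdj 23 30) (eLive 30)) (eRed (Var 30))))
       (Add (Var 10) (Var 10)))) = (2 * tau < #|nb1 ad p :&: L1 :&: redS|)%N.
  rewrite eval_sub (@cntE n) ?(env0 E1) // eval_add eval_var /= t' -PoszD addnn -mul2n.
  rewrite subz_gt0; congr (_ < _)%N; apply: eq_card => q.
  have Gq : gr (sset 30 q%:Z s1) by apply: gr_set.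
  rewrite !inE !andE (eAdjP Gq (i := p) (j := q)) // (eLiveP (L := L1) (i := q)) //.
  by rewrite (eRedP Gq (i := q)) // inE.
rewrite big; case: ifP => _; last by rewrite run_skip; split.
rewrite 2!run_seq run_skip; set s2 := run (Fill 0 aMark _) s1.
have G2 : gr s2 by apply: gr_run.
have mk : rep1 s2 aMark (fun q => q \in dset ad redS tau L1 p).
  move=> q; rewrite /s2 fillE // (env0 E1) ltn_ord /=.
  have Gq : gr (sset vI q%:Z s1) by apply: gr_set.
  rewrite andE (eLiveP (L := L1) (i := q)) // (@anyE n) ?(env0 (gr_env Gq)) //.
  rewrite [RHS]inE; congr (_ && _); apply: eq_existsb => c.
  have Gc : gr (sset 31 c%:Z (sset vI q%:Z s1)) by apply: gr_set.
  rewrite andE (eAdjP Gc (i := c) (j := q)) //; congr (_ && _).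
  rewrite eval_sub (@cntE n) ?(env0 (gr_env Gc)) // eval_var /= t' subz_gt0.
  congr (_ < _)%N; apply: eq_card => u.
  have Gu : gr (sset 30 u%:Z (sset 31 c%:Z (sset vI q%:Z s1))) by apply: gr_set.
  rewrite !inE !andE (eAdjP Gu (i := c) (j := u)) // (eAdjP Gu (i := p) (j := u)) //.
  by rewrite (eLiveP (L := L1) (i := u)) // (eRedP Gu (i := u)) // inE.
have rL2 : repL s2 L1 by move=> q; rewrite /s2 fillE //=; apply: L1r.
have rC2 : repC s2 cl1 by move=> q; rewrite /s2 fillE //=; apply: C1r.
have s223 : sc s2 23%N = p%:Z by rewrite fill_sc.
have [rL3 rC3] := relabelP (gr_env G2) s223 isT mk rL2 rC2.
split=> //; first exact: gr_run.
by rewrite run_sc // fill_sc.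
Qed.

Lemma allowP s tau L : gr s -> sc s 10%N = tau%:Z -> repL s L ->
  rep1 (run cAllow s) aAllow (fun i => i \in allowed ad redS tau L).
Proof.
move=> G t' rL i; have E := gr_env G; rewrite fillE // (env0 E) ltn_ord /=.
have Gi : gr (sset vI i%:Z s) by apply: gr_set.
rewrite notE (@anyE n) ?(env0 (gr_env Gi)) // [RHS]inE negb_exists.
apply: eq_forallb => q; rewrite andE andE.
have Gq : gr (sset 31 q%:Z (sset vI i%:Z s)) by apply: gr_set.
rewrite (eAdjP Gq (i := i) (j := q)) // (eLiveP (L := L) (i := q)) //.
rewrite negb_and -implybE; congr (_ ==> _).
rewrite eval_sub (@cntE n) ?(env0 (gr_env Gq)) // !eval_add eval_var /= t'.
rewrite -!PoszD subz_gt0 -leqNgt (_ : tau + (tau + tau) = 3 * tau)%N; last by lia.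
congr (_ <= _)%N; apply: eq_card => u.
have Gu : gr (sset 30 u%:Z (sset 31 q%:Z (sset vI i%:Z s))) by apply: gr_set.
rewrite [in LHS]inE !in_setI !andE (eNb2P Gu (i := q) (j := u)) // (eLiveP (L := L) (i := u)) //.
by rewrite (eRedP Gu (i := u)).
Qed.

Record lpi L (al : {set 'I_n}) (ks rs bs : nat) (st : ('I_n -> int) * int) s : Prop := Lpi {
  lpi_gr : gr s;
  lpi_L : repL s L;
  lpi_al : rep1 s aAllow (fun i => i \in al);
  lpi_x : forall i : 'I_n, ar s aX i = st.1 i;
  lpi_t : sc s 22%N = st.2;
  lpi_k : sc s 11%N = ks%:Z;
  lpi_r : sc s 12%N = rs%:Z;
  lpi_b : sc s 13%N = bs%:Z }.

Section LPPhase.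
Variables (L al : {set 'I_n}) (ks rs bs : nat).
Hypotheses (ksN : (ks <= n)%N) (rsN : (rs <= n)%N) (bsN : (bs <= n)%N).
Local Notation I := (lpi L al ks rs bs).
Local Notation Zs := (Zsum ad al).

Lemma lpi_set st x v s : (24 < x)%N || (x == 23%N) || (x == 16%N) -> I st s -> I st (sset x v s).
Proof.
move=> hx [G H1 H2 H3 H4 H5 H6 H7]; split=> //=; first by apply: gr_set => //; lia.
all: by rewrite ifN //; lia.
Qed.

Lemma zP st s : I st s -> I st (run cZ s) /\
  forall p : 'I_n, ar (run cZ s) aZ p = Zs st.1 p.
Proof.
move=> H; have [G H1 H2 H3 H4 H5 H6 H7] := H; split.
  split; first exact: gr_run.
  - by move=> i; rewrite run_ar // H1.
  - by move=> i; rewrite run_ar // H2.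
  - by move=> i; rewrite run_ar // H3.
  - by rewrite fill_sc.
  - by rewrite fill_sc.
  - by rewrite fill_sc.
  - by rewrite fill_sc.
move=> p; have E := gr_env G; rewrite fillE // (env0 E) ltn_ord /= eval_sum /= (env0 E) /=.
rewrite big_mkord /Zsum [RHS]big_mkcond /=; apply: eq_bigr => i _.
rewrite eval_ifp andE eval_cst.
have Gi : gr (sset 30 i%:Z (sset vI p%:Z s)) by do 2?apply: gr_set.
rewrite (eAdjP Gi (i := p) (j := i)) // (@rep1_eval _ aAllow (fun i => i \in al) 30 i) //.
by case: ifP => // _; rewrite !evalE /= H3.
Qed.

Lemma countP st s : I st s -> I (cupd al N ks st) (run cCount s).
Proof.
case: st => x t H; have [G H1 H2 H3 H4 H5 H6 H7] := H; have E := gr_env G.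
rewrite /cCount run_if.
have sumx : eval s (Sum 0 30 (Ifp (eAl 30) (eX 30) (Cst 0))) = \sum_(i in al) x i.
  rewrite eval_sum (env0 E) /= big_mkord [RHS]big_mkcond /=; apply: eq_bigr => i _.
  rewrite eval_ifp eval_cst (@rep1_eval _ aAllow (fun i => i \in al) 30 i) //.
  by case: ifP => // _; rewrite !evalE /= H3.
have -> : (0 < eval s (Sub (Cst 1) (Add (mulN (Sub (mulV 11 (Var 22))
   (Sum 0 30 (Ifp (eAl 30) (eX 30) (Cst 0))))) (Var 22)))) = cviol al N ks x t.
  rewrite eval_sub eval_cst eval_add eval_var (mulNE (env1 E)) // eval_sub.
  rewrite (mulVE (env1 E) H5) ?sumx //; last by apply: leq_trans ksN _.
  by rewrite eval_var H4 /= /cviol sub1_gt0.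
rewrite /cupd; case: ifP => V; last by rewrite run_skip.
rewrite 3!run_seq run_skip run_asg.
set s1 := run (Fill 0 aTmp _) s; set s2 := run (Fill 0 aX _) s1.
have G2 : gr s2 by do 2?apply: gr_run.
have f1 z : z != 16%N -> sc s2 z = sc s z by move=> nz; rewrite !fill_sc.
have g1 z i : z != aTmp -> z != aX -> ar s2 z i = ar s z i.
  by move=> n1 n2; rewrite !run_ar ?inE.
have z1 : cnt (sc s1 0%N) = n by rewrite fill_sc // (env0 E).
split=> /=; rewrite ?f1 //.
- exact: gr_set.
- by move=> i; rewrite /= g1 // H1.
- by move=> i; rewrite /= g1 // H2.
- move=> i; rewrite /= /s2 fillE // z1 ltn_ord /= !evalE /= /s1 fillE // (env0 E) ltn_ord /=.
  by rewrite !evalE /= H3 (env1 E) /Num.max.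
- rewrite !eval_add eval_var eval_cst f1 // H4.
  rewrite (@mulVE N ks) ?f1 ?(env1 E) //; last by apply: leq_trans ksN _.
  by rewrite eval_var f1 // (env1 E) [X in _ + (X + _)]mulrC.
Qed.

Definition colset (c : bool) := if c then L :&: redS else L :\: redS.

Lemma eColP st s c x (i : 'I_n) : I st s -> sc s x = i%:Z ->
  (0 < eval s (eCol c x)) = (i \in colset c).
Proof.
move=> H sx; rewrite andE (eLiveP (lpi_L H) sx).
case: c; rewrite ?notE (eRedP (lpi_gr H) sx) /colset !inE //.
by rewrite andbC.
Qed.

Lemma colourP st s c q (qv : nat) : I st s -> (q, qv) \in [:: (12, rs); (13, bs)]%N ->
  I (qupd ad al N (colset c) qv st) (run (cColour c q) s).
Proof.
case: st => x t H hq; have [sq qN] : sc s q = qv%:Z /\ (qv <= n)%N.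
  by move: hq; rewrite !inE => /orP[] /eqP[-> ->]; split=> //; [exact: lpi_r H|exact: lpi_b H].
have [q38 [q24 [q22 [q16 q23]]]] : q != 38%N /\ q != 24%N /\ q != 22%N /\ q != 16%N /\ q != 23%N.
  by move: hq; rewrite !inE => /orP[] /eqP[-> _].
rewrite /cColour 2!run_seq run_skip.
have [{}H Z'] := zP H; have {}sq : sc (run cZ s) q = qv%:Z by rewrite fill_sc.
move: (run cZ s) H Z' sq => {}s H Z' sq.
have [G H1 H2 H3 H4 H5 H6 H7] := H; have E := gr_env G; rewrite /= in H3 H4 Z'.
rewrite run_if.
have sumz : eval s (Sum 0 30 (Ifp (eCol c 30) (Ifp (Sub (Var 22) (eZ 30)) (eZ 30) (Var 22)) (Cst 0)))
    = \sum_(p in colset c) Num.min (Zs x p) t.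
  rewrite eval_sum (env0 E) /= big_mkord [RHS]big_mkcond /=; apply: eq_bigr => i _.
  rewrite eval_ifp (@eColP (x, t) _ c 30 i) //; last exact: lpi_set.
  by case: ifP => // _; rewrite !evalE /= Z' H4 subr_gt0 /Num.min.
have -> : (0 < eval s (Sub (Cst 1) (Add (mulN (Sub
       (Sum 0 30 (Ifp (eCol c 30) (Ifp (Sub (Var 22) (eZ 30)) (eZ 30) (Var 22)) (Cst 0)))
       (mulV q (Var 22)))) (Var 22)))) = qviol ad al N (colset c) qv x t.
  rewrite eval_sub eval_cst eval_add eval_var (mulNE (env1 E)); last first.
    by move: hq; rewrite !inE => /orP[] /eqP[-> _]; case: (c).
  rewrite eval_sub (mulVE (env1 E) sq) ?sumz //; last by apply: leq_trans qN _.
  by rewrite eval_var H4 /qviol sub1_gt0.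
rewrite /qupd; case: ifP => V; last by rewrite run_skip.
rewrite 4!run_seq run_skip 2!run_asg.
set s1 := run (Fill 0 aTmp _) s; set s2 := run (Fill 0 aX _) s1.
have G2 : gr s2 by do 2?apply: gr_run.
have f1 z : z != 16%N -> sc s2 z = sc s z by move=> nz; rewrite !fill_sc.
have g1 z i : z != aTmp -> z != aX -> ar s2 z i = ar s z i.
  by move=> n1 n2; rewrite !run_ar ?inE.
have z1 : cnt (sc s1 0%N) = n by rewrite fill_sc // (env0 E).
(* The coverages in [aZ] are not refreshed between the two updates, so the new [t] is computed from
   the old coverage although [aX] has changed. *)
have I2 : I (fun i : 'I_n => ar s2 aX i, t) s2.
  split=> /=; rewrite ?f1 // => i; rewrite ?g1 ?H1 ?H2 //.
set e24 := Add (Var 22) _.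
have E24 : eval s2 e24 = t + (N%:Z * (#|[set p in colset c | t <= Zs x p]|%:Z - qv%:Z) + 1).
  have E2 := gr_env G2.
  rewrite /e24 !eval_add !eval_var eval_cst f1 // H4 (mulNE (env1 E2)); last first.
    by move: hq; rewrite !inE => /orP[] /eqP[-> _]; case: (c).
  rewrite eval_sub eval_var f1 // sq (cntE _ _ (env0 E2)).
  congr (_ + (_ * (_ - _) + _)); congr (Posz _); apply: eq_card => p.
  rewrite [in LHS]inE [in RHS]inE andE
    (eColP _ (st := (fun i : 'I_n => ar s2 aX i, t)) (i := p)) //; last exact: lpi_set.
  by congr (_ && _); rewrite !evalE /= g1 // Z' f1 // H4 ltzD1 subr_ge0.
rewrite E24; set t1 := t + _ in E24 *.
split=> /=; rewrite ?f1 //.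
- by do 2?apply: gr_set.
- by move=> i; rewrite /= g1 // H1.
- by move=> i; rewrite /= g1 // H2.
- move=> i; rewrite /= /s2 fillE // z1 ltn_ord /= !evalE /= /s1 fillE //; last by case: (c).
  rewrite (env0 E) ltn_ord /=.
  have Ei : env (sset vI i%:Z s) by apply: env_set.
  rewrite eval_add (mulNE (env1 Ei)); last by case: (c).
  rewrite !evalE /= H3 (cntE _ _ (env0 Ei)).
  congr (_ + _); congr (_ * _); congr Posz.
  apply: eq_card => p; rewrite [in LHS]inE [in RHS]inE andE (@eColP (x, t) _ c 30 p) //; last first.
    by do 2?apply: lpi_set.
  rewrite andE; congr (_ && (_ && _)); last by rewrite !evalE /= Z' H4 subr_gt0.
  by apply: eAdjP => //; do 2?apply: gr_set.
Qed.

Lemma lpP s : gr s -> repL s L -> rep1 s aAllow (fun i => i \in al) ->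
  sc s 11%N = ks%:Z -> sc s 12%N = rs%:Z -> sc s 13%N = bs%:Z ->
  I (iter (N ^ 7) (lp_round ad al N ks (L :&: redS) rs (L :\: redS) bs) (fun=> 0, 0))
    (run cLP s).
Proof.
move=> G H1 H2 H5 H6 H7; have E := gr_env G; rewrite /cLP 3!run_seq run_skip run_asg.
set s1 := sset 22 _ _; set rd := lp_round _ _ _ _ _ _ _ _.
have I1 : I (fun=> 0, 0) s1.
  split=> //=; rewrite ?fill_sc //.
  - by apply: gr_set => //; apply: gr_run.
  - by move=> i; rewrite /= fillE //= H1.
  - by move=> i; rewrite /= fillE //= H2.
  - by move=> i; rewrite /= fillE // (env0 E) ltn_ord.
have c4 : cnt (sc s1 4%N) = (N ^ 7)%N by rewrite (env4 (gr_env (lpi_gr I1))).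
rewrite -c4; apply: (for_inv (P := fun m => I (iter m rd (fun=> 0, 0)))) => // m s' _ H.
rewrite 3!run_seq run_skip iterS; move: (iter m rd _) H => st0 H; rewrite /rd /lp_round.
have H1' : I (cupd al N ks st0) (run cCount (sset 23 m%:Z s')) by apply: countP; apply: lpi_set.
have H2' := @colourP _ _ true 12 rs H1' (mem_head _ _).
by apply: (@colourP _ _ false 13 bs H2'); rewrite !inE eqxx orbT.
Qed.

End LPPhase.

(** [L] is what is still unlabelled. [sp_far] keeps the separation inductive: a later centre is not
    within two hops of an earlier one, so their one-hop balls are disjoint. *)
Record sp_inv (L1 : {set 'I_n}) (Z : 'I_n -> int) cl1 (L : {set 'I_n})
    (cl : 'I_n -> option 'I_n) : Prop := SpInv {
  sp_sub : L \subset L1;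
  sp_old : forall q, q \notin L1 -> cl q = cl1 q;
  sp_lab : forall q, q \in L1 :\: L -> exists j, [/\ cl q = Some j, j \in L1 :\: L,
             q \in nb2 ad j, Z q <= Z j & cl j = Some j];
  sp_sep : forall j j', j \in L1 :\: L -> j' \in L1 :\: L -> cl j = Some j ->
             cl j' = Some j' -> j != j' -> [disjoint nb1 ad j & nb1 ad j'];
  sp_far : forall q j, q \in L -> j \in L1 :\: L -> cl j = Some j -> q \notin nb2 ad j }.

Lemma sp_inv0 L1 Z cl1 : sp_inv L1 Z cl1 L1 cl1.
Proof. by split=> // [q|j j'|q j]; rewrite setDv inE. Qed.

Lemma sp_step L1 Z cl1 L cl j : sp_inv L1 Z cl1 L cl -> j \in L ->
  (forall q, q \in L -> Z q <= Z j) ->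
  sp_inv L1 Z cl1 (L :\: (nb2 ad j :&: L))
    (fun q => if q \in nb2 ad j :&: L then Some j else cl q).
Proof.
move=> [i1 i2 i3 i4 i5] jL jmax; set D := nb2 ad j :&: L.
have jj : j \in nb2 ad j by apply: (subsetP (nb12 adxx j)); apply: mem_nb1.
have jD : j \in D by rewrite in_setI jj.
have inD q : q \in D -> q \in L by rewrite in_setI => /andP[].
have cases q : q \in L1 :\: (L :\: D) -> q \in D \/ q \notin D /\ q \in L1 :\: L.
  rewrite !in_setD; case: (q \in D) => /=; first by left.
  by move=> /andP[h1 h2]; right; rewrite h1.
have DL q : q \in D -> q \in L1 :\: (L :\: D).
  by move=> qD; rewrite !in_setD qD /= (subsetP i1) // inD.
have OL q : q \in L1 :\: L -> q \notin D /\ q \in L1 :\: (L :\: D).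
  rewrite !in_setD => /andP[qL ->]; rewrite (negbTE qL) andbF; split=> //.
  by apply: contra qL; apply: inD.
split.
- by apply: subset_trans (subsetDl _ _) i1.
- move=> q qL1; rewrite ifN ?i2 //; apply: contra qL1 => /inD; exact: (subsetP i1).
- move=> q /cases[qD|[nD qL]].
    exists j; rewrite qD jD; split=> //; first exact: DL.
      by move: qD; rewrite in_setI => /andP[].
    by apply: jmax; apply: inD.
  have [j0 [c0 j0L qj0 Z0 cj0]] := i3 q qL; have [nj0 j0L'] := OL _ j0L.
  by exists j0; rewrite (negbTE nD) (negbTE nj0).
- move=> u v /cases[uD|[nu uL]] /cases[vD|[nv vL]].
  + by rewrite uD vD => -[<-] [<-]; rewrite eqxx.
  + rewrite uD (negbTE nv) => -[<-] cv _; apply/pred0P => w /=; apply/negP => /andP[h1 h2].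
    by have /negP := i5 j v jL vL cv; apply; apply/nb2P; exists w => //; rewrite nb1_sym.
  + rewrite vD (negbTE nu) => cu [<-] _; apply/pred0P => w /=; apply/negP => /andP[h1 h2].
    by have /negP := i5 j u jL uL cu; apply; apply/nb2P; exists w => //; rewrite nb1_sym.
  + by rewrite (negbTE nu) (negbTE nv); apply: i4.
- move=> q v; rewrite in_setD => /andP[qD qL] /cases[vD|[nv vL]].
    by rewrite vD => -[<-]; apply: contra qD => h; rewrite in_setI h.
  by rewrite (negbTE nv); apply: i5.
Qed.

Lemma pickP s L (Z : 'I_n -> int) : gr s -> repL s L ->
  (forall q : 'I_n, ar s aZ q = Z q) ->
  (sc (run cPick s) 21%N = -1 /\ L = set0) \/
  (exists j : 'I_n, [/\ sc (run cPick s) 21%N = j%:Z, j \in L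
     & forall q, q \in L -> Z q <= Z j]).
Proof.
move=> G rL rZ; rewrite /cPick 2!run_seq run_skip run_asg eval_cst.
set s1 := sset 21 _ s; set c := For _ _ _.
pose P m s' := [/\ gr s', repL s' L, forall q : 'I_n, ar s' aZ q = Z q &
  (sc s' 21%N = -1 /\ forall q : 'I_n, q \in L -> ~~ (q < m)%N) \/
  (exists j : 'I_n, [/\ sc s' 21%N = j%:Z, j \in L
     & forall q : 'I_n, q \in L -> (q < m)%N -> Z q <= Z j])].
have G1 : gr s1 by apply: gr_set.
have : P (cnt (sc s1 0%N)) (run c s1).
  apply: for_inv; first by split=> //; left; split.
  rewrite (env0 (gr_env G1)) /= => m s' mn [G' L' Z' H].
  pose p := Ordinal mn; set s2 := sset 24 m%:Z s'.
  have G2 : gr s2 by apply: gr_set.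
  have next (q : 'I_n) : (q < m.+1)%N -> (q < m)%N \/ q = p.
    rewrite ltnS leq_eqVlt => /orP[/eqP E|]; last by left.
    by right; apply: val_inj.
  rewrite run_if andE (@eLiveP s2 L 24 p) // eval_ifp eval_add eval_var !eval_cst.
  case: H => [[h21 H]|[j [h21 jL H]]].
    rewrite [sc s2 21]h21 /= andbT; case: ifP => pL.
      rewrite run_asg; split=> //; first by apply: gr_set.
      by right; exists p; split=> // q qL /next[|->//]; move/negP: (H q qL).
    rewrite run_skip; split=> //; left; split=> // q qL; apply/negP => /next[].
      by apply/negP; apply: H.
    by move=> E; rewrite -E qL in pL.
  rewrite [sc s2 21]h21 (_ : 0 < j%:Z + 1); last by lia.
  rewrite eval_sub !eval_arr !eval_var [sc s2 24]/= [sc s2 21]h21 !absz_nat.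
  rewrite [ar s2 aZ m]/= (Z' p) [ar s2 aZ j]/= Z' subr_gt0; case: ifP => [/andP[pL lt]|nn].
    rewrite run_asg; split=> //; first by apply: gr_set.
    right; exists p; split=> // q qL /next[qm|->//].
    by apply: le_trans (ltW lt); apply: H.
  rewrite run_skip; split=> //; right; exists j; split=> // q qL /next[|E]; first exact: H.
  by move: nn; rewrite -E qL /= ltNge => /negbFE.
rewrite /P (env0 (gr_env G1)) /= => -[_ _ _ [[h H]|[j [h jL H]]]]; [left|right].
  split=> //; apply/setP => q; rewrite inE; apply/negP => qL.
  by have := H q qL; rewrite ltn_ord.
by exists j; split=> // q qL; apply: H.
Qed.

Lemma sparseP L al ks rs bs st cl1 s : lpi L al ks rs bs st s -> repC s cl1 ->
  exists cl, [/\ repC (run cSparse s) cl, forall q, q \notin L -> cl q = cl1 q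
    & sparse_lab ad L (Zsum ad al st.1) cl].
Proof.
move=> H rC; rewrite /cSparse 2!run_seq run_skip.
have [[G rL _ _ _ _ _ _] rZ] := zP H.
have {}rC : repC (run cZ s) cl1 by move=> q; rewrite run_ar.
move: (run cZ s) G rL rZ rC => {H}s G rL rZ rC.
set Z := Zsum ad al st.1 in rZ *; set c := For _ _ _.
(* While live points remain, a round labels at least the chosen centre, so n rounds exhaust them. *)
pose P m s' := exists L' cl, [/\ gr s', repL s' L', repC s' cl,
  forall q : 'I_n, ar s' aZ q = Z q & sp_inv L Z cl1 L' cl /\ (#|L'| <= n - m)%N].
have : P (cnt (sc s 0%N)) (run c s).
  apply: for_inv.
    exists L, cl1; split=> //; split; first exact: sp_inv0.
    by rewrite subn0 -[X in (_ <= X)%N]card_ord max_card.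
  rewrite (env0 (gr_env G)) /= => m s' mn [L' [cl [G' rL' rC' rZ' [I' cL]]]].
  have G1 : gr (sset 23 m%:Z s') by apply: gr_set.
  have pick := @pickP (sset 23 m%:Z s') L' Z G1 rL' rZ'.
  rewrite 2!run_seq run_skip; set s2 := run cPick _ in pick *.
  have G2 : gr s2 by apply: gr_run.
  have rL2 : repL s2 L' by move=> q; rewrite run_ar // -rL'.
  have rC2 : repC s2 cl by move=> q; rewrite run_ar // -rC'.
  have rZ2 (q : 'I_n) : ar s2 aZ q = Z q by rewrite run_ar // -rZ'.
  rewrite run_if eval_add eval_var eval_cst.
  case: pick => [[-> L0]|[j [s21 jL jmax]]].
    rewrite run_skip; exists L', cl; split=> //; split=> //.
    by rewrite L0 cards0.
  rewrite s21 (_ : 0 < j%:Z + 1); last by lia.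
  rewrite 2!run_seq run_skip; set s3 := run (Fill 0 aMark _) s2.
  have G3 : gr s3 by apply: gr_run.
  have mk : rep1 s3 aMark (fun q => q \in nb2 ad j :&: L').
    move=> q; rewrite /s3 fillE // (env0 (gr_env G2)) ltn_ord /= andE.
    have Gq : gr (sset vI q%:Z s2) by apply: gr_set.
    by rewrite (eNb2P Gq (i := j) (j := q)) // (@eLiveP _ L' _ q) // in_setI.
  have rL3 : repL s3 L' by move=> q; rewrite /s3 fillE //=; apply: rL2.
  have rC3 : repC s3 cl by move=> q; rewrite /s3 fillE //=; apply: rC2.
  have s321 : sc s3 21%N = j%:Z by rewrite fill_sc.
  have [rL4 rC4] := relabelP (gr_env G3) s321 isT mk rL3 rC3.
  exists (L' :\: (nb2 ad j :&: L')), (fun q => if q \in nb2 ad j :&: L' then Some j else cl q).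
  split=> //; first by apply: gr_run.
    by move=> q; rewrite run_ar // run_ar.
  split; first exact: sp_step.
  have jj : j \in nb2 ad j by apply: (subsetP (nb12 adxx j)); apply: mem_nb1.
  have : (#|L' :\: (nb2 ad j :&: L')| < #|L'|)%N.
    apply: proper_card; rewrite properEneq subsetDl andbT; apply/eqP => E.
    by have := jL; rewrite -{1}E in_setD in_setI jj jL.
  by move: cL mn; clear; lia.
rewrite /P (env0 (gr_env G)) /= => -[L' [cl [_ _ rC' _ [[i1 i2 i3 i4 i5] cL]]]].
have L0 : L' = set0 by apply/eqP; rewrite -cards_eq0; move: cL; rewrite subnn leqn0.
rewrite {}L0 !setD0 in i3 i4.
by exists cl; split=> //; split.
Qed.

Lemma eEqP s e1 e2 : (0 < eval s (eEq e1 e2)) = (eval s e1 == eval s e2).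
Proof. by rewrite andE !eval_add !eval_sub !eval_cst; lia. Qed.

Lemma eLabP s cl x y (q j : 'I_n) : repC s cl -> sc s x = q%:Z -> sc s y = j%:Z ->
  (0 < eval s (eLab x y)) = (cl q == Some j).
Proof.
move=> rC sx sy; rewrite eEqP eval_arr !eval_var sx sy absz_nat rC.
by case: (cl q).
Qed.

(** * Choosing clusters by subset sum *)

Definition ccol (cl : 'I_n -> option 'I_n) (C : {set 'I_n}) j :=
  #|[set q in C | cl q == Some j]|.
Definition keyv cl j := (N * (N + ccol cl redS j) + ccol cl (~: redS) j)%N.
Definition covl cl (C A : {set 'I_n}) := #|[set q in C | labin cl A q]|.

Lemma keyP s cl : gr s -> repC s cl ->
  forall j : 'I_n, ar (run cKey s) aKey j = (keyv cl j)%:Z.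
Proof.
move=> G rC j; rewrite fillE // (env0 (gr_env G)) ltn_ord /=.
have Gj : gr (sset vI j%:Z s) by apply: gr_set.
have Ej := gr_env Gj.
rewrite eval_add (mulNE (env1 Ej)) // eval_add eval_var (env1 Ej) !(cntE _ _ (env0 Ej)).
rewrite /keyv PoszD PoszM PoszD; congr (_ * (_ + Posz _) + Posz _); apply: eq_card => q.
  have Gq : gr (sset 30 q%:Z (sset vI j%:Z s)) by apply: gr_set.
  rewrite [in LHS]inE [in RHS]inE andE (eRedP Gq (i := q)) // andbC; congr (_ && _).
  exact: (@eLabP _ cl 30 16 q j).
have Gq : gr (sset 30 q%:Z (sset vI j%:Z s)) by apply: gr_set.
rewrite [in LHS]inE [in RHS]inE in_setC andE notE (eRedP Gq (i := q)) // andbC; congr (_ && _).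
exact: (@eLabP _ cl 30 16 q j).
Qed.

Definition keys cl (A : {set 'I_n}) := (\sum_(j in A) keyv cl j)%N.

Lemma key_sum cl A : keys cl A =
  (N * (N * #|A| + covl cl redS A) + covl cl (~: redS) A)%N.
Proof.
rewrite /keys big_split -big_distrr big_split /= sum_nat_const /covl -!sum_labin.
by rewrite [(#|A| * N)%N]mulnC.
Qed.

Lemma covl_le cl C A : (covl cl C A <= n)%N.
Proof. by rewrite -[X in (_ <= X)%N]card_ord max_card. Qed.

Lemma key_sum_lt cl A : (keys cl A < N ^ 3)%N.
Proof.
rewrite key_sum; have h1 := covl_le cl redS A; have h2 := covl_le cl (~: redS) A.
have h3 : (#|A| <= n)%N by rewrite -[X in (_ <= X)%N]card_ord max_card.
apply: (@leq_ltn_trans (N * (N * n + n) + n)).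
  by rewrite leq_add // leq_mul // leq_add // leq_mul.
rewrite !expnS expn0 muln1 -ltnS; clear; nia.
Qed.

Lemma key_sum_inj cl A A' : keys cl A = keys cl A' ->
  [/\ #|A| = #|A'|, covl cl redS A = covl cl redS A'
    & covl cl (~: redS) A = covl cl (~: redS) A'].
Proof.
rewrite !key_sum => /(idx_inj (covl_le _ _ _) (covl_le _ _ _))[E ->].
by have [-> ->] := idx_inj (covl_le _ _ _) (covl_le _ _ _) E.
Qed.

Definition mask (A : {set 'I_n}) := (\sum_(j in A) 2 ^ j)%N.
Definition below m (A : {set 'I_n}) := A :&: [set j : 'I_n | j < m]%N.

Lemma belowS m (mn : (m < n)%N) A : below m.+1 A =
  if Ordinal mn \in A then Ordinal mn |: below m A else below m A.
Proof.
apply/setP => j.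
have E : (j < m.+1)%N = (j == Ordinal mn) || (j < m)%N by rewrite ltnS leq_eqVlt.
case: ifP => h; rewrite /below ?in_setU1 !in_setI !in_set E; case: eqP => [->|_] //=.
all: by rewrite h.
Qed.

Lemma not_below m (mn : (m < n)%N) A : Ordinal mn \notin below m A.
Proof. by rewrite !inE /= ltnn andbF. Qed.

Lemma mask_lt m A : (m <= n)%N -> (mask (below m A) < 2 ^ m)%N.
Proof.
elim: m => [|m IH] mn.
  rewrite /mask big1 // => j; rewrite !inE ltn0 andbF //.
rewrite (belowS mn) expnS mul2n -addnn; have := IH (ltnW mn); case: ifP => _ lt.
  by rewrite /mask big_setU1 ?not_below //= -/(mask _) -addnS leq_add2l.
by apply: ltn_addr.
Qed.

Lemma knapP s cl : env s -> (forall j : 'I_n, ar s aKey j = (keyv cl j)%:Z) ->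
  forall kp, (kp < N ^ 3)%N ->
  (ar (run cKnap s) aF kp = -1 /\ forall A, keys cl A <> kp) \/
  (exists2 A, keys cl A = kp & ar (run cKnap s) aF kp = (mask A)%:Z).
Proof.
move=> E rK.
(* After [m] rounds the table is exact for the sets of labels below [m]. *)
pose R m s' := forall kp, (kp < N ^ 3)%N ->
  (ar s' aF kp = -1 /\ forall A, A = below m A -> keys cl A <> kp) \/
  (exists2 A, A = below m A & keys cl A = kp /\ ar s' aF kp = (mask A)%:Z).
rewrite /cKnap 2!run_seq run_skip; set s1 := run (Fill _ _ _) s; set c := For _ _ _.
have E1 : env s1 by apply: env_run.
pose P m s' := [/\ env s', forall j : 'I_n, ar s' aKey j = (keyv cl j)%:Z & R m s'].
suff: P (cnt (sc s1 0%N)) (run c s1).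
  rewrite /P (env0 E1) /= => -[_ _ H] kp /H.
  have full A : A = below n A by apply/setP => j; rewrite !inE ltn_ord andbT.
  by case=> [[h1 h2]|[A _ [h1 h2]]]; [left; split=> // A; apply: h2|right; exists A].
apply: for_inv.
  split=> //; first by move=> j; rewrite run_ar // rK.
  move=> kp kN; rewrite /s1 fillE // (env3 E) /= kN !evalE /=.
  have b0 A : below 0 A = set0 by apply/setP => j; rewrite !inE ltn0 andbF.
  case: kp kN => [|kp] kN /=.
    by right; exists set0; rewrite ?b0 // /mask /keys !big_set0.
  by left; split=> // A ->; rewrite b0 /keys big_set0.
rewrite (env0 E1) /= => m s' mn [E' K' H].
pose p := Ordinal mn; set s2 := sset 23 m%:Z s'.
have E2 : env s2 by apply: env_set.
rewrite 2!run_seq run_skip; set s3 := run (Fill 3 aG _) s2; set s4 := run _ s3.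
have E3 : env s3 by apply: env_run.
split; first exact: env_run.
  by move=> j; rewrite !run_ar // -K'.
move=> kp kN; rewrite /s4 fillE // (env3 E3) [cnt _]/= kN [_ && _]/= eval_arr eval_var /=.
rewrite /s3 fillE // (env3 E2) [cnt _]/= kN [_ && _]/=.
rewrite eval_ifp eval_add eval_cst eval_arr eval_var [sc _ _]/= absz_nat [ar _ _ _]/=.
have Fge A : 0 < (mask A)%:Z + 1 by lia.
case: (H kp kN) => [[F0 no]|[A Am [Ak FA]]]; last first.
  rewrite FA Fge; right; exists A => //.
  apply/setP => j; rewrite in_setI in_set; case: (boolP (j \in A)) => //=.
  by rewrite {1}Am in_setI in_set => /andP[_ lt]; rewrite ltnS ltnW.
rewrite F0 /= eval_ifp andE !eval_add !eval_sub !eval_var !eval_cst !eval_arr !eval_sub.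
rewrite !eval_arr !eval_var [sc _ 16]/= [sc _ 23]/= absz_nat [ar _ aKey _]/= (K' p).
have split1 A : A = below m.+1 A -> p \in A -> A :\ p = below m (A :\ p) /\
    keys cl A = (keyv cl p + keys cl (A :\ p))%N.
  move=> Am pA; rewrite /keys (big_setD1 p) //; split=> //.
  apply/setP => j; rewrite in_setI; case: (boolP (j \in A :\ p)) => //=.
  rewrite !inE => /andP[ne]; rewrite {1}Am !inE => /andP[_]; rewrite ltnS leq_eqVlt.
  by rewrite -[(j : nat) == m]/(j == p) (negbTE ne).
have nop A : A = below m.+1 A -> p \notin A -> A = below m A.
  by move=> Am pA; rewrite {1}Am (belowS mn) (negbTE pA).
have [lek|ltk] := leqP (keyv cl p) kp; last first.
  rewrite (_ : (0 < _) = false); last by move: ltk; clear; lia.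
  rewrite andFb; left; split=> // A Am; have [pA|pA] := boolP (p \in A).
    by have [_ ->] := split1 A Am pA; move=> E0; move: ltk; rewrite -E0; clear; lia.
  exact: no (nop A Am pA).
rewrite (_ : 0 < _ = true); last by move: lek; clear; lia.
have -> : absz (kp%:Z - (keyv cl p)%:Z)%R = (kp - keyv cl p)%N by move: lek; clear; lia.
rewrite [ar _ aF _]/= [true && _]/= [ar _ aPow _]/= (envP E'); last exact: leq_trans mn nSZ.
case: (H (kp - keyv cl p)%N) => [|[G0 no']|[A Am [Ak FA]]].
- by apply: leq_ltn_trans kN; apply: leq_subr.
- rewrite G0; left; split=> // A Am; have [pA|pA] := boolP (p \in A); last exact: no (nop A Am pA).
  have [A1 A2] := split1 A Am pA; rewrite A2 => E0; apply: no' A1 _.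
  by rewrite -E0 addKn.
- rewrite FA Fge; right; have pA : p \notin A by rewrite Am not_below.
  exists (p |: A).
    rewrite (belowS mn) setU11; congr (_ |: _); apply/setP => j; rewrite {1}Am !inE.
    by case: eqP => [->|_] //=; rewrite ltnn !andbF.
  rewrite /mask /keys !big_setU1 //= -/(keys _ _) Ak subnKC // -/(mask A); split=> //.
  by rewrite PoszD addrC.
Qed.

Lemma decodeP s kp A (s1 s2 s3 : 'I_n) : env s -> sc s 23%N = kp%:Z ->
  ar s aF kp = (mask A)%:Z -> sc s 7%N = s1%:Z -> sc s 8%N = s2%:Z -> sc s 9%N = s3%:Z ->
  [set j : 'I_n | 0 < ar (run cDecode s) aCh j] = A :|: [set s1; s2; s3].
Proof.
move=> E s23 Fk h7 h8 h9; rewrite /cDecode 5!run_seq run_skip run_asg eval_arr eval_var s23 absz_nat Fk.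
set s0 := sset 24 _ s; set c := For _ _ _.
(* Bits are read from the top. Scalar 24 keeps the mask of the undecided labels, and the lower bits
   together stay below the next power of two, so one comparison decides a bit. *)
pose P i s' := [/\ env s', [/\ sc s' 7%N = s1%:Z, sc s' 8%N = s2%:Z & sc s' 9%N = s3%:Z],
  sc s' 24%N = (mask (below (n - i) A))%:Z &
  forall j : 'I_n, (n - i <= j)%N -> (0 < ar s' aCh j) = (j \in A)].
have E0 : env s0 by apply: env_set.
have : P (cnt (sc s0 0%N)) (run c s0).
  apply: for_inv.
    split=> //; last by move=> j; rewrite subn0 leqNgt ltn_ord.
    by congr (Posz (mask _)); apply/setP => j; rewrite subn0 !inE ltn_ord andbT.
  rewrite (env0 E0) /= => i s' lin [E' [k7 k8 k9] k24 H].
  have [mn mE] : (n - i.+1 < n)%N /\ (n - i = (n - i.+1).+1)%N by move: lin; clear; lia.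
  set m := (n - i.+1)%N in mn mE *; pose p := Ordinal mn.
  rewrite 2!run_seq run_skip run_asg !eval_sub !eval_var eval_cst [sc _ 0]/= (env0 E') [sc _ 25]/=.
  have -> : n%:Z - 1 - i%:Z = m%:Z by rewrite /m; move: lin; clear; lia.
  set t := sset 26 _ _; have Et : env t by do 2?apply: env_set.
  have pw : ar t aPow m = (2 ^ m)%N%:Z by rewrite (envP Et) // (leq_trans mn).
  have t24 : sc t 24%N = (mask (below m.+1 A))%:Z by rewrite -mE -k24.
  have low := mask_lt A (ltnW mn).
  have Hn (j : 'I_n) : (m <= j)%N -> j != p -> (m < j)%N.
    rewrite leq_eqVlt => /orP[/eqP E1|//]; case/eqP; exact: val_inj.
  have Hj (j : 'I_n) : (m <= j)%N -> j != p -> (0 < ar t aCh j) = (j \in A).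
    by move=> le ne; rewrite -H ?mE // Hn.
  rewrite run_if eval_add eval_sub eval_arr !eval_var eval_cst t24 [sc t 26]/= absz_nat pw.
  have jm (j : 'I_n) : (j == m :> nat) = (j == p) by [].
  have [pA|pA] := boolP (p \in A).
    have eM : mask (below m.+1 A) = (2 ^ m + mask (below m A))%N.
      by rewrite (belowS mn) pA /mask big_setU1 ?not_below.
    rewrite eM PoszD (_ : 0 < _); last by lia.
    rewrite 2!run_seq run_skip run_asg eval_sub eval_arr !eval_var t24 [sc t 26]/= absz_nat pw eM.
    rewrite run_sto eval_var eval_cst [sc _ 26]/= absz_nat; split.
    - by have := env_set (x := 24) (mask (below m A))%:Z isT Et => -[*]; split.
    - by [].
    - by rewrite /= PoszD addrC addKr.
    - by move=> j le /=; rewrite jm; case: eqP => [->|/eqP ne]; rewrite ?pA // -Hj.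
  have eM : mask (below m.+1 A) = mask (below m A) by rewrite (belowS mn) (negbTE pA).
  rewrite eM (_ : (0 < _) = false); last by move: low; clear; lia.
  rewrite run_sto eval_var eval_cst [sc _ 26]/= absz_nat; split.
  - by case: Et => *; split.
  - by [].
  - by rewrite /= -/t -eM -t24.
  - by move=> j le /=; rewrite jm; case: eqP => [->|/eqP ne]; rewrite ?(negbTE pA) // -Hj.
rewrite /P (env0 E0) /= subnn => -[_ [k7 k8 k9] _ H].
apply/setP => j; rewrite !run_sto !eval_var !eval_cst /= k7 k8 k9 !absz_nat !inE.
have eqj (u : 'I_n) : (j == u :> nat) = (j == u) by [].
rewrite !eqj; case: (j == s3); first by rewrite !orbT.
case: (j == s2); first by rewrite !orbT.
by case: (j == s1); rewrite ?orbT //= orbF H.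
Qed.

Lemma okP s : gr s -> let C := [set j : 'I_n | 0 < ar s aCh j] in
  (0 < eval s eOk) = [&& #|C| <= k, r <= #|nb3s ad C :&: redS| & b <= #|nb3s ad C :\: redS|]%N.
Proof.
move=> G C; have E := gr_env G.
have inK i : (i < 4)%N -> eval s (Arr aIn (Cst i%:Z)) = inp i.
  by move=> i4; rewrite eval_arr eval_cst absz_nat (envI E) //; move: i4; clear; lia.
have hit (q : 'I_n) : (0 < eval (sset 30 q%:Z s) eHit) = (q \in nb3s ad C).
  have Eq : env (sset 30 q%:Z s) by apply: env_set.
  rewrite (anyE _ _ (env0 Eq)) [RHS]inE; apply: eq_existsb => j.
  have Gj : gr (sset 31 j%:Z (sset 30 q%:Z s)) by do 2?apply: gr_set.
  rewrite andE (eNb3P Gj (i := j) (j := q)) //; congr (_ && _); by rewrite inE.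
have le (u v : nat) : (0 < u%:Z - v%:Z + 1) = (v <= u)%N by clear; lia.
rewrite /eOk !andE !eval_add !eval_sub !eval_cst (inK 1%N) // (inK 2%N) // (inK 3%N) //.
rewrite inp_k inp_r inp_b !(cntE _ _ (env0 E)) !le; congr [&& (_ <= _)%N, (_ <= _)%N & (_ <= _)%N].
- apply: eq_card => q; rewrite [in LHS]inE in_setI andE hit andbC.
  by rewrite (@eRedP _ 30 q) //; apply: gr_set.
- apply: eq_card => q; rewrite [in LHS]inE in_setD andE hit notE.
  by rewrite (@eRedP _ 30 q) //; apply: gr_set.
Qed.

End Graph.

(** * The best solution found so far *)

Definition outset s (C : {set 'I_n}) :=
  forall j : 'I_n, ar s aOut j = if j \in C then (j : nat)%:Z else -1.

Definition best1 s (a c : 'I_n) C := [/\ sc s 14%N = a%:Z, sc s 15%N = c%:Z, outset s C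
  & is_solution d redp k r b C (3%:R * d a c)].

(** [None] asks only that the record, if there is one, is valid at three times its radius; [Some p]
    asks also that it exists and that its radius is at most the distance of [p]. Both survive every
    guess, right or wrong. *)
Definition best (o : option ('I_n * 'I_n)) s :=
  if o is Some p then exists a c C, best1 s a c C /\ d a c <= d p.1 p.2
  else (sc s 14%N = -1 /\ outset s set0) \/ exists a c C, best1 s a c C.

Lemma best_None o s : best o s -> best None s.
Proof. by case: o => // p [a [c [C [h _]]]]; right; exists a, c, C. Qed.

Lemma best_same o s s' : sc s' 14%N = sc s 14%N -> sc s' 15%N = sc s 15%N ->
  (forall j, ar s' aOut j = ar s aOut j) -> best o s -> best o s'.
Proof.
move=> e14 e15 eO.
have H a c C : best1 s a c C -> best1 s' a c C.
  by move=> [h1 h2 h3 h4]; split=> //; rewrite ?e14 ?e15 // => j; rewrite eO h3.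
case: o => [p|] /=.
  by move=> [a [c [C [h h']]]]; exists a, c, C; split=> //; apply: H.
case=> [[h1 h2]|[a [c [C h]]]]; last by right; exists a, c, C; apply: H.
by left; rewrite e14; split=> // j; rewrite eO h2.
Qed.

Lemma best_run o e s : 14%N \notin wrv e -> 15%N \notin wrv e -> aOut \notin wra e ->
  best o s -> best o (run e s).
Proof. by move=> h1 h2 h3; apply: best_same; rewrite ?run_sc // => j; rewrite run_ar. Qed.

Lemma best_set o x v s : x != 14%N -> x != 15%N -> best o s -> best o (sset x v s).
Proof. by move=> h1 h2; apply: best_same => //=; rewrite ifN // eq_sym. Qed.

Section Radius.
Variables a c : 'I_n.
Local Notation ad := (fun i j => dle i j a c).

Lemma dd0 i : d i i = 0. Proof. by case: dmet => _ /(_ i i)[_ ->]. Qed.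

Lemma ad_refl : reflexive ad.
Proof. by move=> i; rewrite /dle dd0; case: dmet => H _ _ _; apply: H. Qed.

Lemma ad_sym : symmetric ad.
Proof. by move=> i j; rewrite /dle; case: dmet => _ _ -> _. Qed.

Lemma hop3 C q : q \in nb3s ad C -> q \in covered d C (3%:R * d a c).
Proof.
move=> /nb3sP[j jC /nb3P[u /nb2P[v]]]; rewrite !inE /dle => h1 h2 h3.
apply/bigcupP; exists j => //; rewrite inE.
case: dmet => _ _ _ tri; have t1 := tri j u q; have t2 := tri j v u.
by lra.
Qed.

Definition okset (C : {set 'I_n}) :=
  [&& #|C| <= k, r <= #|nb3s ad C :&: redS| & b <= #|nb3s ad C :\: redS|]%N.

Lemma okset_solution C : okset C -> is_solution d redp k r b C (3%:R * d a c).
Proof.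
move=> /and3P[h1 h2 h3]; split=> //.
  apply: leq_trans h2 _; apply: subset_leq_card; apply/subsetP => q.
  by rewrite in_setI => /andP[h]; rewrite !in_set => ->; rewrite andbT; apply: hop3.
apply: leq_trans h3 _; apply: subset_leq_card; apply/subsetP => q.
by rewrite in_setD => /andP[]; rewrite in_set => nr h; rewrite in_set nr andbT; apply: hop3.
Qed.

Definition cRecord := If (And eOk eBetter)
  (Do Asg 14 (Var 5); Asg 15 (Var 6);
      Fill 0 aOut (Ifp (eCh 16) (Var 16) (Cst (-1))) End) Skip.

(** A set that passes the check is recorded unless the record is already as good; either way the
    bound for the current pair holds afterwards. *)
Lemma recordP o s : gr ad s -> sc s 5%N = a%:Z -> sc s 6%N = c%:Z -> best o s ->
  best o (run cRecord s) /\
  (okset [set j : 'I_n | 0 < ar s aCh j] -> best (Some (a, c)) (run cRecord s)).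
Proof.
move=> G s5 s6 H; have E := gr_env G; rewrite run_if andE (okP G) -/(okset _).
case: (boolP (okset _)) => [ok|_]; last by rewrite run_skip.
have adj1 (a1 c1 : 'I_n) : sc s 14%N = a1%:Z -> sc s 15%N = c1%:Z ->
    (0 < eval s eBetter) = (d a c < d a1 c1).
  move=> h14 h15; rewrite eval_ifp eval_add eval_var eval_cst h14.
  rewrite (_ : 0 < a1%:Z + 1); last by clear; lia.
  by rewrite notE (eAdjP G h14 h15) // /dle ltNge.
case: ifP => /= btr; last first.
  rewrite run_skip; split=> // _.
  case: (best_None H) => [[h14 _]|[a1 [c1 [C1 B1]]]].
    by move: btr; rewrite eval_ifp eval_add eval_var eval_cst h14.
  exists a1, c1, C1; split=> //=; have [h14 h15 _ _] := B1.
  by move: btr; rewrite (adj1 a1 c1) // ltNge => /negbFE.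
set s' := run _ s.
have B : best1 s' a c [set j : 'I_n | 0 < ar s aCh j].
  rewrite /s' 3!run_seq run_skip !run_asg !eval_var s5 [sc _ 6]/= s6.
  set t := sset 15 _ _; have Et : env t by do 2?apply: env_set.
  split; rewrite ?fill_sc //; last exact: okset_solution.
  move=> j; rewrite fillE // (env0 Et) ltn_ord /= eval_ifp !evalE /= in_set.
  by case: ifP.
split=> [|_]; last by exists a, c, [set j : 'I_n | 0 < ar s aCh j].
case: o H => [p|] H; last by right; exists a, c, [set j : 'I_n | 0 < ar s aCh j].
case: H => a1 [c1 [C1 [[h14 h15 _ _] le]]].
exists a, c, [set j : 'I_n | 0 < ar s aCh j]; split=> //.
by apply: le_trans le; move: btr; rewrite (adj1 a1 c1) //; apply: ltW.
Qed.

Lemma tryP o s : gr ad s -> sc s 5%N = a%:Z -> sc s 6%N = c%:Z -> best o s ->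
  best o (run cTry s).
Proof.
move=> G s5 s6 B.
pose P (m : nat) s' := [/\ gr ad s', sc s' 5%N = a%:Z, sc s' 6%N = c%:Z & best o s'].
suff: P (cnt (sc s 3%N)) (run cTry s) by case.
apply: for_inv => // m s' _ [G' s5' s6' B'].
rewrite run_if; case: ifP => _; last by rewrite run_skip; split=> //; apply: gr_set.
rewrite 2!run_seq run_skip -/cRecord; set t := run cDecode _.
have Gt : gr ad t by apply: gr_run => //; apply: gr_set.
have t5 : sc t 5%N = a%:Z by rewrite run_sc.
have t6 : sc t 6%N = c%:Z by rewrite run_sc.
have Bt : best o t by apply: best_run => //; apply: best_set.
by split; [apply: gr_run|rewrite run_sc|rewrite run_sc|case: (recordP Gt t5 t6 Bt)].
Qed.

Lemma tryH s kp A (s1 s2 s3 : 'I_n) : gr ad s -> sc s 5%N = a%:Z -> sc s 6%N = c%:Z ->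
  sc s 7%N = s1%:Z -> sc s 8%N = s2%:Z -> sc s 9%N = s3%:Z -> (kp < N ^ 3)%N ->
  ar s aF kp = (mask A)%:Z -> okset (A :|: [set s1; s2; s3]) -> best None s ->
  best (Some (a, c)) (run cTry s).
Proof.
move=> G s5 s6 s7 s8 s9 kN Fk ok B.
pose P (m : nat) s' := [/\ gr ad s', forall x, x \in [:: 5; 6; 7; 8; 9]%N -> sc s' x = sc s x,
  ar s' aF kp = (mask A)%:Z, best None s' & (kp < m)%N -> best (Some (a, c)) s'].
suff: P (cnt (sc s 3%N)) (run cTry s) by rewrite (env3 (gr_env G)) /= => -[_ _ _ _]; apply.
apply: for_inv => //; rewrite (env3 (gr_env G)) /= => m s' mN [G' S' F' B' H'].
set s0 := sset 23 m%:Z s'; have G0 : gr ad s0 by apply: gr_set.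
have S0 x : x \in [:: 5; 6; 7; 8; 9]%N -> sc s0 x = sc s x.
  by move=> hx; rewrite -S' //; move: hx; rewrite !inE => /or4P[/eqP->|/eqP->|/eqP->|/orP[/eqP->|/eqP->]].
have B0 : best None s0 by apply: best_set.
rewrite run_if eval_add eval_arr eval_cst eval_var absz_nat.
case: ifP => h; last first.
  rewrite run_skip; split=> //; rewrite ltnS leq_eqVlt => /orP[/eqP E|lt].
    by move: h; rewrite -E [ar _ _ _]F' => /negbT; clear; lia.
  by apply: best_set => //; apply: H'.
rewrite 2!run_seq run_skip -/cRecord; set t := run cDecode _.
have Gt : gr ad t by apply: gr_run.
have St x : x \in [:: 5; 6; 7; 8; 9]%N -> sc t x = sc s x.
  move=> hx; rewrite -S0 // run_sc //; move: hx; rewrite !inE.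
  by move=> /or4P[/eqP->|/eqP->|/eqP->|/orP[/eqP->|/eqP->]].
have t5 : sc t 5%N = a%:Z by rewrite St.
have t6 : sc t 6%N = c%:Z by rewrite St.
have Bt : best None t by apply: best_run.
have [R1 R2] := recordP Gt t5 t6 Bt; split=> //.
- exact: gr_run.
- move=> x hx; rewrite run_sc ?St //; move: hx; rewrite !inE.
  by move=> /or4P[/eqP->|/eqP->|/eqP->|/orP[/eqP->|/eqP->]].
- by rewrite run_ar // run_ar.
rewrite ltnS leq_eqVlt => /orP[/eqP E|lt].
  have s023 : sc s0 23%N = kp%:Z by rewrite /= E.
  by apply: R2; rewrite (decodeP (gr_env G0) s023 F' (s1 := s1) (s2 := s2) (s3 := s3)) // S0.
have Bt' : best (Some (a, c)) t by apply: best_run => //; exact: H'.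
by have [] := recordP Gt t5 t6 Bt'.
Qed.

End Radius.

Lemma pointP s x : env s -> 0 < eval s (ePoint x) -> exists a : 'I_n, sc s x = a%:Z.
Proof.
move=> E; rewrite andE eval_add eval_sub !eval_var eval_cst (env0 E) => /andP[h1 h2].
have lt : (absz (sc s x) < n)%N by move: h1 h2; clear; lia.
by exists (Ordinal lt) => /=; move: h1; clear; lia.
Qed.

Definition cGraph := Do cAdj; cNb2; cNb3 End.
Lemma graphP s (a c : 'I_n) : env s -> sc s 5%N = a%:Z -> sc s 6%N = c%:Z ->
  gr (fun i j => dle i j a c) (run cGraph s).
Proof.
move=> E s5 s6; rewrite /cGraph 3!run_seq run_skip.
have R1 := adjP E s5 s6; set s1 := run cAdj s in R1 *.
have E1 : env s1 by apply: env_run.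
have R2 := nb2_fill E1 R1; set s2 := run cNb2 s1 in R2 *.
have E2 : env s2 by apply: env_run.
have R1' : rep2 s2 aAdj (fun i j => dle i j a c) by move=> i j; rewrite run_ar // R1.
have R3 := nb3_fill E2 R1' R2; split=> //; first exact: env_run.
  by move=> i j; rewrite run_ar // R1'.
by move=> i j; rewrite run_ar // R2.
Qed.

Lemma body_env s : env s -> env (run cBody s).
Proof. exact: env_run. Qed.

Lemma bodyP o s : env s -> best o s -> best o (run cBody s).
Proof.
move=> E B; rewrite run_if; case: ifP => [|_]; last by rewrite run_skip.
rewrite /eGuard andE [X in X && _]andE => /andP[/andP[/(pointP E)[a s5] /(pointP E)[c s6]] _].
have G := graphP E s5 s6; have f5 : sc (run cGraph s) 5%N = a%:Z by rewrite run_sc.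
have f6 : sc (run cGraph s) 6%N = c%:Z by rewrite run_sc.
have {}B : best o (run cGraph s) by apply: best_run.
change (best o (run (Do cLive; cDense; cAllow; cLP; cSparse; cKey; cKnap; cTry End)
  (run cGraph s))).
move: (run cGraph s) G f5 f6 B => {E s5 s6}s G s5 s6 B.
set c1 := Do cLive; cDense; cAllow; cLP; cSparse; cKey; cKnap End.
change (best o (run cTry (run c1 s))).
apply: (@tryP a c); first exact: gr_run.
- by rewrite run_sc.
- by rewrite run_sc.
- exact: best_run.
Qed.

Lemma pointI s x (a : 'I_n) : env s -> sc s x = a%:Z -> 0 < eval s (ePoint x).
Proof.
move=> E sx; rewrite andE eval_add eval_sub !eval_var eval_cst (env0 E) sx.
by have := ltn_ord a; clear; lia.
Qed.

Lemma cover_count (ad : rel 'I_n) cl (S A C : {set 'I_n}) :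
  (forall q j, cl q = Some j -> (q \in nb3 ad j) && (q \notin nb3s ad S)) ->
  (#|nb3s ad S :&: C| + covl cl C A <= #|nb3s ad (A :|: S) :&: C|)%N.
Proof.
move=> lab; rewrite /covl -cardsUI [X in (_ + X <= _)%N](_ : _ = 0)%N ?addn0.
  apply: subset_leq_card; apply/subsetP => q; rewrite in_setU => /orP[].
    rewrite !in_setI => /andP[/nb3sP[j jS jq] ->]; rewrite andbT; apply/nb3sP.
    by exists j => //; rewrite in_setU jS orbT.
  rewrite in_set /labin in_setI => /andP[->]; rewrite andbT.
  case E: (cl q) => [j|] // jA; have /andP[qj _] := lab q j E.
  by apply/nb3sP; exists j => //; rewrite in_setU jA.
apply/eqP; rewrite cards_eq0; apply/eqP/setP => q; rewrite in_setI in_set0.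
apply/negP => /andP[]; rewrite in_setI => /andP[qS _]; rewrite in_set /labin => /andP[_].
by case E: (cl q) => [j|] // _; have /andP[_] := lab q j E; rewrite qS.
Qed.

Lemma bodyH s (a c s1 s2 s3 : 'I_n) tau ks rs bs : env s -> best None s ->
  sc s 5%N = a%:Z -> sc s 6%N = c%:Z -> sc s 7%N = s1%:Z -> sc s 8%N = s2%:Z ->
  sc s 9%N = s3%:Z -> sc s 10%N = tau%:Z -> sc s 11%N = ks%:Z -> sc s 12%N = rs%:Z ->
  sc s 13%N = bs%:Z ->
  good_guess (fun i j => dle i j a c) redS k r b s1 s2 s3 tau ks rs bs ->
  best (Some (a, c)) (run cBody s).
Proof.
move=> E B s5 s6 s7 s8 s9 s10 s11 s12 s13; set ad := fun i j => dle i j a c.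
set S := [set s1; s2; s3]; rewrite /good_guess -/S.
set st := foldl _ _ _; set al := allowed _ _ _ _ => -[[tn kn rn bn] [O Oal [Ok Or Ob]] sound].
rewrite !card_ord in tn kn rn bn sound.
rewrite run_if (_ : 0 < eval s eGuard); last first.
  by rewrite /eGuard andE [X in X && _]andE [X in _ && X]andE [X in _ && (_ && X)]andE
    (pointI E s5) (pointI E s6) (pointI E s7) (pointI E s8) (pointI E s9).
change (best (Some (a, c)) (run (Do cLive; cDense; cAllow; cLP; cSparse; cKey; cKnap; cTry End)
  (run cGraph s))).
have G := graphP E s5 s6; have {}B : best None (run cGraph s) by apply: best_run.
have fr x : x \in guessed -> sc (run cGraph s) x = sc s x.
  by move=> hx; rewrite run_sc //; move: x hx; apply/allP.
rewrite -(fr 5%N) // in s5; rewrite -(fr 6%N) // in s6; rewrite -(fr 7%N) // in s7.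
rewrite -(fr 8%N) // in s8; rewrite -(fr 9%N) // in s9; rewrite -(fr 10%N) // in s10.
rewrite -(fr 11%N) // in s11; rewrite -(fr 12%N) // in s12; rewrite -(fr 13%N) // in s13.
move: (run cGraph s) G s5 s6 s7 s8 s9 s10 s11 s12 s13 B => {E fr}s G s5 s6 s7 s8 s9 s10 s11 s12 s13 B.
rewrite 8!run_seq run_skip.
have [rL rC] := liveP G s7 s8 s9; rewrite -/S in rL.
set t1 := run cLive s in rL rC *; have G1 : gr ad t1 by apply: gr_run.
have t10 : sc t1 10%N = tau%:Z by rewrite run_sc.
have [{}rL {}rC] := denseP G1 t10 rL rC; rewrite -/st in rL rC.
set t2 := run cDense t1 in rL rC *; have G2 : gr ad t2 by apply: gr_run.
have t210 : sc t2 10%N = tau%:Z by rewrite run_sc.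
have rA := allowP G2 t210 rL; rewrite -/al in rA.
set t3 := run cAllow t2 in rA *; have G3 : gr ad t3 by apply: gr_run.
have rL3 : repL t3 st.1 by move=> q; rewrite run_ar // rL.
have t11 : sc t3 11%N = ks%:Z by rewrite !run_sc.
have t12 : sc t3 12%N = rs%:Z by rewrite !run_sc.
have t13 : sc t3 13%N = bs%:Z by rewrite !run_sc.
have I4 := lpP kn rn bn G3 rL3 rA t11 t12 t13.
set xt := iter _ _ _ in I4; set t4 := run cLP t3 in I4 *.
have rC4 : repC t4 st.2 by move=> q; rewrite run_ar // run_ar // rC.
have [cl [rC5 old lab]] := sparseP (ad_refl a c) (ad_sym a c) I4 rC4.
have ok : lp_ok ad al N ks (st.1 :&: redS) rs (st.1 :\: redS) bs xt.1 xt.2.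
  (* The existence of a point makes N at least 2, so the N ^ 7 rounds of the program exceed N ^
     6. *)
  have n1 : (1 < N)%N by have := ltn_ord a; clear; lia.
  have := @lp_solve _ ad al N O ks (st.1 :&: redS) rs (st.1 :\: redS) bs (N ^ 7).
  have n67 : (N ^ 6 < N ^ 7)%N by rewrite ltn_exp2l.
  by rewrite card_ord => /(_ erefl Oal Ok kn rn bn Or Ob n67); rewrite -/xt; case: (xt).
have [labs [A [A1 A2 A3]]] := sound xt.1 xt.2 cl ok old lab.
set t5 := run cSparse t4 in rC5 *; have G5 : gr ad t5 by do 2?apply: gr_run.
have rK := keyP G5 rC5; set t6 := run cKey t5 in rK *.
have G6 : gr ad t6 by apply: gr_run.
case: (knapP (gr_env G6) rK (key_sum_lt cl A)) => [[_ /(_ A)//]|[A' eA F']].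
set t7 := run cKnap t6 in F' *; have G7 : gr ad t7 by apply: gr_run.
(* The stored mask may belong to a set other than [A]; equal keys give it the same size and the same
   red and blue counts, and nothing else matters. *)
have [c1 c2 c3] := key_sum_inj eA.
have fr x : x \in guessed -> sc t7 x = sc s x.
  move=> hx; rewrite /t7 /t6 /t5 /t4 /t3 /t2 /t1 !run_sc //;
  by move: x hx; apply/allP.
apply: (tryH G7 _ _ _ _ _ (key_sum_lt cl A) F' (s1 := s1) (s2 := s2) (s3 := s3)); rewrite ?fr //.
  rewrite -/S; apply/and3P; split.
  - apply: leq_trans A1; apply: leq_trans (leq_card_setU _ _) _.
    by rewrite c1 addnC.
  - apply: leq_trans A2 _; rewrite -/(covl cl redS A) -c2; exact: cover_count.
  - apply: leq_trans A3 _; rewrite -/(covl cl (~: redS) A) -c3 !setDE; exact: cover_count.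
by do 7?[apply: best_run].
Qed.

Record env_in (s : store) : Prop := EnvIn {
  ein0 : sc s 0%N = n%:Z;
  ein1 : sc s 1%N = N%:Z;
  ein2 : sc s 2%N = SZ%:Z;
  ein3 : sc s 3%N = (N ^ 3)%N%:Z;
  ein4 : sc s 4%N = (N ^ 7)%N%:Z;
  einI : forall i, (i < len)%N -> ar s aIn i = inp i }.

Lemma powP s : env_in s -> env (run cPow s).
Proof.
move=> [e0 e1 e2 e3 e4 eI]; rewrite /cPow 2!run_seq run_skip run_asg eval_cst.
set s1 := sset 23 1 s; set c := For _ _ _.
pose P m s' := [/\ env_in s', sc s' 23%N = (2 ^ m)%N%:Z
  & forall i, (i < m)%N -> ar s' aPow i = (2 ^ i)%N%:Z].
suff: P (cnt (sc s1 2%N)) (run c s1).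
  by rewrite [sc s1 2]/= e2 => -[[h0 h1 h2 h3 h4 hI] _ H]; split.
apply: for_inv; first by split.
move=> m s' _ [[h0 h1 h2 h3 h4 hI] s23 H]; rewrite 2!run_seq run_skip run_sto run_asg eval_add !eval_var.
rewrite [sc _ 21]/= absz_nat [sc _ 23]/= s23; split.
- by split.
- by rewrite /= expnS mul2n -addnn PoszD.
move=> i; rewrite ltnS leq_eqVlt /= => /orP[/eqP->|lt]; first by rewrite eqxx.
by rewrite ltn_eqF // H.
Qed.

Lemma searchP s rho : env_in s -> is_opt_radius d redp k r b rho ->
  (0 < n)%N -> exists2 C, outset (run cSearch s) C
    & is_solution d redp k r b C (3%:R * rho).
Proof.
move=> E [[rho0 [O [O1 O2 O3]]] _] n0.
rewrite /cSearch 5!run_seq run_skip !run_asg !eval_cst.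
set t1 := run cPow s; have E1 : env t1 by apply: powP.
set t2 := run (Fill 0 aOut _) t1; set t3 := sset 14 _ t2; set t4 := sset 15 _ t3.
have E4 : env t4 by apply: env_set => //; apply: env_set => //; apply: env_run.
have B4 : best None t4.
  by left; split=> // j; rewrite [ar _ _ _]/= fillE // (env0 E1) ltn_ord in_set0.
have stab o x v t : x \in guessed -> env t /\ best o t -> env (sset x v t) /\ best o (sset x v t).
  move=> hx [h1 h2]; split.
    by apply: env_set h1; move: x hx; apply/allP.
  by apply: best_set h2; move: x hx; apply/allP.
have stab2 o t : env t /\ best o t -> env (run cBody t) /\ best o (run cBody t).
  by move=> [h1 h2]; split; [apply: body_env|apply: bodyP].
have mono (C : {set 'I_n}) (u v : rat) : u <= v -> is_solution d redp k r b C u ->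
    is_solution d redp k r b C v.
  move=> uv [h1 h2 h3]; have sub q : q \in covered d C u -> q \in covered d C v.
    move=> /bigcupP[j jC]; rewrite inE => le; apply/bigcupP; exists j => //.
    by rewrite inE (le_trans le).
  split=> //; [apply: leq_trans h2 _|apply: leq_trans h3 _]; apply: subset_leq_card;
    by apply/subsetP => q; rewrite !in_set => /andP[/sub-> ->].
(* Without centres nothing is covered, so nothing is required and the recorded set, possibly empty,
   is a solution. *)
have [O0|O0] := posnP #|O|.
  have c0 : covered d O rho = set0.
    by move/eqP: O0; rewrite cards_eq0 => /eqP->; rewrite /covered big_set0.
  have none (P : pred 'I_n) : #|[set p in covered d O rho | P p]| = 0%N.
    by rewrite c0; apply/eqP; rewrite cards_eq0; apply/eqP/setP => q; rewrite !inE.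
  have r0 : r = 0%N by apply/eqP; rewrite -leqn0 -(none redp).
  have b0 : b = 0%N by apply/eqP; rewrite -leqn0 -(none (fun p => ~~ redp p)).
  have [_] := @nest_inv 1 guessed cBody (fun t => env t /\ best None t)
    (stab None) (stab2 None) t4 (conj E4 B4).
  case=> [[_ H]|[a [c [C [_ _ H [h1 _ _]]]]]].
    by exists set0 => //; split; rewrite ?cards0 ?r0 ?b0.
  by exists C => //; split; rewrite ?r0 ?b0.
pose i0 := Ordinal n0.
(* The largest distance not above [rho] defines the same adjacency as [rho]; the pair (i0, i0), at
   distance 0, shows that there is one. *)
have [[a c] /= dac dmax] : exists2 p : 'I_n * 'I_n, d p.1 p.2 <= rho &
    forall q : 'I_n * 'I_n, d q.1 q.2 <= rho -> d q.1 q.2 <= d p.1 p.2.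
  have P0 : d (i0, i0).1 (i0, i0).2 <= rho by rewrite dd0.
  have := @arg_maxP _ rat _ (i0, i0) (fun p => d p.1 p.2 <= rho) (fun p => d p.1 p.2) P0.
  by case=> p h1 h2; exists p.
pose ad := fun i j => dle i j a c.
have adE i j : ad i j = (d i j <= rho).
  apply/idP/idP => [h|h]; first exact: le_trans h dac.
  exact: (dmax (i, j)).
have covE q : (q \in covered d O rho) = (q \in covset ad O).
  apply/bigcupP/(covsetP (ad_sym a c)) => -[j jO]; rewrite inE => h; exists j => //.
    by rewrite inE -[dle _ _ _ _]/(ad j q) adE.
  by rewrite inE -adE.
have [||s1 [s2 [s3 [tau [ks [rs [bs gg]]]]]]] :=
  @good_guess_exists _ ad redS (ad_refl a c) (ad_sym a c) O k r b O0 O1.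
- apply: leq_trans O2 _; apply: subset_leq_card; apply/subsetP => q.
  by rewrite in_set covE in_setI => /andP[-> h]; rewrite in_set h.
- apply: leq_trans O3 _; apply: subset_leq_card; apply/subsetP => q.
  by rewrite in_set covE in_setD => /andP[-> h]; rewrite in_set h.
have [[tn kn rn bn] _ _] := gg; rewrite !card_ord in tn kn rn bn.
pose nu x : nat := nth 0%N [:: a : nat; c : nat; s1 : nat; s2 : nat; s3 : nat; tau; ks; rs; bs] (x - 5).
have : best (Some (a, c)) (run (nest 1 guessed cBody) t4).
  apply: (@nest_hit 1 guessed cBody N nu (fun s => env s /\ best None s)) => //.
  - by move=> x hx; move: x hx; apply/allP; vm_compute.
  - apply/allP; rewrite /= !ltnS tn kn rn bn.
    by rewrite !(ltnW (ltn_ord _)).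
  - by move=> x v t hx h; have [] := @stab None x v t hx h.
  - move=> x v t hx h; apply: best_set h; move: x hx; apply/allP => //.
  - by move=> t [h _]; rewrite (env1 h).
  - exact: stab2.
  - by move=> t [h _] h'; apply: bodyP.
  - move=> t [h hb] V.
    by apply: (bodyH h hb _ _ _ _ _ _ _ _ _ gg); rewrite V.
case=> a1 [c1 [C [[_ _ H1 H2] le]]]; exists C => //.
by apply: mono H2; move: le dac => /=; lra.
Qed.

End Verify.

(** * Reading the encoded instance *)

Lemma nth_flatten_pairs (T : Type) (x0 : T) (ps : seq (T * T)) p :
  (p < size ps)%N ->
  let s := flatten [seq [:: q.1; q.2] | q <- ps] in
  nth x0 s (p + p) = (nth (x0, x0) ps p).1 /\
  nth x0 s (p + p + 1) = (nth (x0, x0) ps p).2.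
Proof.
elim: ps p => [|q ps IH] [|p] // lt; have [h1 h2] := IH p lt.
by rewrite addSn addnS addn1 /= h1 -addn1 h2.
Qed.

Lemma nth_allpairs_ord (T : Type) (x0 : T) n (f : 'I_n -> 'I_n -> T) (i j : 'I_n) :
  nth x0 [seq f i j | i <- enum 'I_n, j <- enum 'I_n] (n * i + j) = f i j.
Proof.
have aux (s : seq 'I_n) m : (m < size s)%N ->
    nth x0 [seq f i j | i <- s, j <- enum 'I_n] (n * m + j) = f (nth i s m) j.
  elim: s m => [|u s IH] [|m] //= lt; rewrite nth_cat size_map size_enum_ord.
    by rewrite muln0 add0n ltn_ord (nth_map j) ?size_enum_ord // nth_ord_enum.
  by rewrite mulnS -addnA ltnNge leq_addr /= addKn IH.
by rewrite aux ?size_enum_ord // nth_ord_enum.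
Qed.

Section Encode.
Variables (n : nat) (d : 'I_n -> 'I_n -> rat) (red : 'I_n -> bool) (k r b : nat).
Local Notation code := (encode d red k r b).
Local Notation inp := (nth 0 code).
Local Notation len := (4 + n + ((n * n) + (n * n)))%N.

Definition dpairs := [seq (numq (d i j), denq (d i j)) | i <- enum 'I_n, j <- enum 'I_n].

Lemma size_dpairs : size dpairs = (n * n)%N.
Proof. by rewrite size_allpairs size_enum_ord. Qed.

Lemma encodeE : code = [:: n%:Z; k%:Z; r%:Z; b%:Z]
  ++ [seq (red i)%:Z | i <- enum 'I_n] ++ flatten [seq [:: q.1; q.2] | q <- dpairs].
Proof. by rewrite /encode /dpairs map_allpairs. Qed.

Lemma size_encode : size code = len.
Proof.
rewrite encodeE !size_cat /= size_map size_enum_ord size_flatten /shape -map_comp.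
rewrite (eq_map (g := fun=> 2%N)) // -[X in sumn X](_ : nseq (size dpairs) 2%N = _); last first.
  by elim: dpairs => //= q ps ->.
by rewrite sumn_nseq size_dpairs; lia.
Qed.

Lemma inp_redE (i : 'I_n) : inp (4 + i) = (red i)%:Z.
Proof.
rewrite encodeE nth_cat; case: ltnP => [//|_].
rewrite (_ : (4 + i - _)%N = i); last exact: addKn.
by rewrite nth_cat size_map size_enum_ord ltn_ord (nth_map i) ?size_enum_ord // nth_ord_enum.
Qed.

Lemma inp_distE (i j : 'I_n) (p := (n * i + j)%N) :
  inp (4 + n + (p + p)) = numq (d i j) /\ inp (4 + n + (p + p) + 1) = denq (d i j).
Proof.
have pn : (p < size dpairs)%N.
  rewrite size_dpairs /p; have := ltn_ord i; have := ltn_ord j => h1 h2.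
  by apply: leq_trans (_ : n * i + n <= _)%N; nia.
have red_size : size [seq (red i)%:Z | i <- enum 'I_n] = n by rewrite size_map size_enum_ord.
have skip q : inp (4 + n + q) = nth 0 (flatten [seq [:: q.1; q.2] | q <- dpairs]) q.
  rewrite encodeE -addnA nth_cat; case: ltnP => [//|_].
  rewrite (_ : (4 + _ - _)%N = n + q)%N; last exact: addKn.
  by rewrite nth_cat red_size ltnNge leq_addr /= addKn.
have [h1 h2] := nth_flatten_pairs 0 pn.
rewrite -(addnA (4 + n)) !skip h1 h2 /p /dpairs.
by rewrite (nth_allpairs_ord (0, 0) (fun i j => (numq (d i j), denq (d i j)))).
Qed.

Lemma bitlen_lt (z : int) : z < (2 ^ bitlen z)%N%:Z.
Proof.
rewrite /bitlen; case: z => [[|m]|m] //.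
by rewrite ltz_nat /= trunc_log_ltn.
Qed.

Lemma bitlen_pow e (z : int) : (2 ^ e)%N%:Z <= z -> (e < bitlen z)%N.
Proof.
rewrite /bitlen ltnS; case: z => // m; rewrite lez_nat => le; apply: trunc_log_max => //.
Qed.

Lemma bitlen_size i : (i < size code)%N -> (bitlen (inp i) <= input_size code)%N.
Proof. by move=> lt; rewrite /input_size (big_nth 0) big_mkord (bigD1 (Ordinal lt)) //= leq_addr. Qed.

Lemma len_input_size : (len <= input_size code)%N.
Proof.
rewrite -size_encode /input_size -sum1_size; apply: leq_sum => z _.
by rewrite /bitlen.
Qed.

End Encode.

(** * Moving the input into the array layout *)

Arguments upd : simpl never.
Opaque NA.

Ltac mem := repeat first [ rewrite upd_eq | rewrite upd_neq; [|by lia] ].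

Definition regs_from B j := (B <= j < B + 7)%N.

(* Splits [2 n + e] at address 0 into e at address 0 and n at address [B.+1]. *)
Definition halve B pc : seq instr :=
  [:: IConst B 1; IConst B.+1 0; IConst B.+2 2;
      ISub 0 0 B.+2; IAdd B.+1 B.+1 B; ISub B.+3 0 B; IJgtz B.+3 (pc + 3)].

(** Adding 2 n + 1 to 4 in [n] rounds yields the input length, and the unrolled additions the target
    address just past the end. [B.+4] and [B.+4.+1] start the pair (e, 2 ^ e) of [grow] at (0,
    1). *)
Definition measure B pc : seq instr :=
  [:: IConst B 1; IConst B.+1 4; IConst B.+4 0; IConst B.+4.+1 1; IConst B.+4.+2 0;
      IAdd B.+4.+2 B.+4.+2 0;
      IAdd B.+1 B.+1 0; IAdd B.+1 B.+1 0; IAdd B.+1 B.+1 B;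
      ISub B.+4.+2 B.+4.+2 B; IJgtz B.+4.+2 (pc + 6);
      IConst B.+2 OFF%:Z]
  ++ nseq NA (IAdd B.+2 B.+2 B.+1).

(* Doubles [K = 2 ^ sz] at [B + 5] until it exceeds the value at [B + 3]. *)
Definition grow B pc : seq instr :=
  [:: ISub B.+4.+2 B.+3 B.+4.+1; IAdd B.+4.+2 B.+4.+2 B; IJgtz B.+4.+2 (pc + 4);
      IJgtz B (pc + 7); IAdd B.+4.+1 B.+4.+1 B.+4.+1; IAdd B.+4 B.+4 B; IJgtz B pc].

(** Runs downwards: the target [OFF + NA * i] lies above every cell still to be read, so the input
    never overwrites itself. *)
Definition copy B lo pc : seq instr :=
  [:: ISub B.+1 B.+1 B; IConst B.+4.+2 NA%:Z; ISub B.+2 B.+2 B.+4.+2;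
      ILoad B.+3 B.+1; IStore B.+2 B.+3]
  ++ grow B (pc + 5)
  ++ [:: IConst B.+4.+2 lo%:Z; ISub B.+4.+2 B.+1 B.+4.+2; IJgtz B.+4.+2 pc].

Section Prologue.
Variables (prog : seq instr) (B : nat).
Hypotheses (B0 : (0 < B)%N) (BOFF : (B + 7 <= OFF)%N).

Lemma reach_instr T p i m s' : nth IHalt prog p = i -> nojump i ->
  reach prog T (RamState p.+1 (exec1 m i)) s' -> reach prog T.+1 (RamState p m) s'.
Proof. by move=> E nj; apply: reach_step; rewrite /ram_step /= E; case: i nj {E}. Qed.

Lemma reach_goto T p i l m s' : nth IHalt prog p = IJgtz i l -> 0 < m i ->
  reach prog T (RamState l m) s' -> reach prog T.+1 (RamState p m) s'.
Proof. by move=> E h; apply: reach_step; rewrite /ram_step /= E h. Qed.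

Lemma reach_skip T p i l m s' : nth IHalt prog p = IJgtz i l -> (0 < m i) = false ->
  reach prog T (RamState p.+1 m) s' -> reach prog T.+1 (RamState p m) s'.
Proof. by move=> E h; apply: reach_step; rewrite /ram_step /= E h. Qed.

Lemma halve_ok pc n (e : bool) m : code_at prog pc (halve B pc) -> (0 < n)%N ->
  m 0%N = (n.*2 + e)%N%:Z -> exists m', [/\ reach prog (4 * n + 3) (RamState pc m) (RamState (pc + 7) m'),
    m' 0%N = e%:Z, m' B.+1 = n%:Z & forall j, j != 0%N -> ~~ regs_from B j -> m' j = m j].
Proof.
rewrite /halve !code_at_cons => -[E0 [E1 [E2 [E3 [E4 [E5 [E6 _]]]]]]] n0 m0.
have P7 : (pc + 7 = pc.+3.+4)%N by rewrite !addnS addn0.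
have loop i : forall m, m 0%N = (i.+1.*2 + e)%N%:Z -> m B = 1 -> m B.+2 = 2 ->
    exists m', [/\ reach prog (4 * i.+1) (RamState pc.+3 m) (RamState (pc + 7) m'),
      m' 0%N = e%:Z, m' B.+1 = m B.+1 + i.+1%:Z
      & forall j, j != 0%N -> ~~ regs_from B j -> m' j = m j].
  elim: i => [|i IH] m1 h0 hB h2.
    pose m2 := upd (upd (upd m1 0 (m1 0%N - 2)) B.+1 (m1 B.+1 + 1)) B.+3 (m1 0%N - 2 - 1).
    exists m2; split.
    - apply: reach_instr E3 _ _ => //; apply: reach_instr E4 _ _ => //.
      apply: reach_instr E5 _ _ => //; apply: reach_skip E6 _ _.
        by rewrite /exec1; mem; rewrite h0 hB h2; case: (e).
      rewrite P7 /exec1 /m2; mem; rewrite hB h2; exact: reach_refl.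
    - by rewrite /m2; mem; rewrite h0; case: (e).
    - by rewrite /m2; mem.
    - by move=> j j0; rewrite /regs_from => jB; rewrite /m2; mem.
  pose m2 := upd (upd (upd m1 0 (m1 0%N - 2)) B.+1 (m1 B.+1 + 1)) B.+3 (m1 0%N - 2 - 1).
  have [||| m3 [R H0 H1 Hj]] := IH m2.
  - by rewrite /m2; mem; rewrite h0; clear; lia.
  - by rewrite /m2; mem.
  - by rewrite /m2; mem.
  exists m3; split=> //.
  - rewrite mulnS; apply: reach_instr E3 _ _ => //; apply: reach_instr E4 _ _ => //.
    apply: reach_instr E5 _ _ => //; apply: reach_goto E6 _ _.
      by rewrite /exec1; mem; rewrite h0 hB h2; clear; lia.
    by rewrite addn3 /exec1; move: R; rewrite /m2; mem; rewrite hB h2.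
  - by rewrite H1 /m2; mem; clear; lia.
  - by move=> j j0 jB; rewrite Hj // /m2; move: jB; rewrite /regs_from => jB; mem.
case: n n0 m0 => // n _ m0.
pose m1 := upd (upd (upd m B 1) B.+1 0) B.+2 2.
have [|||m2 [R H0 H1 Hj]] := loop n m1.
- by rewrite /m1; mem.
- by rewrite /m1; mem.
- by rewrite /m1; mem.
exists m2; split=> //.
- rewrite addn3; apply: reach_instr E0 _ _ => //; apply: reach_instr E1 _ _ => //.
  exact: reach_instr E2 _ _.
- by rewrite H1 /m1; mem; clear; lia.
- by move=> j j0 jB; rewrite Hj // /m1; move: jB; rewrite /regs_from => jB; mem.
Qed.

Lemma foldl_addself k x y m : x != y ->
  forall j, foldl exec1 m (nseq k (IAdd x x y)) j = if j == x then m x + m y *+ k else m j.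
Proof.
move=> xy j; elim: k m => [|k IH] m /=; first by rewrite addr0; case: eqP => [->|].
rewrite IH !updE eqxx [y == x]eq_sym (negbTE xy) mulrS addrA.
by case: (j == x).
Qed.

Lemma measure_ok pc n m : code_at prog pc (measure B pc) -> (0 < n)%N -> m 0%N = n%:Z ->
  let len := (4 + n + (n * n + n * n))%N in
  exists m', [/\ reach prog (5 * n + 30) (RamState pc m) (RamState (pc + size (measure B pc)) m'),
    [/\ m' B = 1, m' B.+1 = len%:Z, m' B.+2 = (OFF + NA * len)%N%:Z, m' B.+4 = 0 & m' B.+4.+1 = 1]
    & forall j, ~~ regs_from B j -> m' j = m j].
Proof.
rewrite /measure code_at_cat => -[C1 C]; move: C1; set c := nseq _ _ in C *.
rewrite !code_at_cons => -[E0 [E1 [E2 [E3 [E4 [E5 [E6 [E7 [E8 [E9 [E10 [E11 _]]]]]]]]]]]] n0 m0.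
set len := (4 + n + (n * n + n * n))%N.
have P6 : (pc + 6 = pc.+3.+3)%N by rewrite !addnS addn0.
have P11 : (pc + 11 = pc.+4.+4.+3)%N by rewrite !addnS addn0.
have loop i : forall m, m 0%N = n%:Z -> m B = 1 -> m B.+4.+2 = i.+1%:Z ->
    exists m', [/\ reach prog (5 * i.+1) (RamState (pc + 6) m) (RamState (pc + 11) m'),
      m' B.+1 = m B.+1 + (i.+1 * (n + n).+1)%N%:Z
      & forall j, j != B.+1 -> j != B.+4.+2 -> m' j = m j].
  elim: i => [|i IH] m1 h0 hB h6; rewrite ?P6.
    exists (foldl exec1 m1 [:: IAdd B.+1 B.+1 0; IAdd B.+1 B.+1 0; IAdd B.+1 B.+1 B;
      ISub B.+4.+2 B.+4.+2 B]); split.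
    - apply: reach_instr E6 _ _ => //; apply: reach_instr E7 _ _ => //.
      apply: reach_instr E8 _ _ => //; apply: reach_instr E9 _ _ => //.
      apply: reach_skip E10 _ _; first by rewrite /exec1; mem; rewrite hB h6.
      by rewrite P11; apply: reach_refl.
    - by rewrite /= ; mem; rewrite h0 hB; clear; lia.
    - by move=> j n1 n6 /=; mem.
  set m2 := foldl exec1 m1 [:: IAdd B.+1 B.+1 0; IAdd B.+1 B.+1 0; IAdd B.+1 B.+1 B;
      ISub B.+4.+2 B.+4.+2 B].
  have [||| m3 [R H1 Hj]] := IH m2.
  - by rewrite /m2 /=; mem.
  - by rewrite /m2 /=; mem.
  - by rewrite /m2 /=; mem; rewrite hB h6; clear; lia.
  exists m3; split=> //.
  - rewrite mulnS; apply: reach_instr E6 _ _ => //; apply: reach_instr E7 _ _ => //.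
    apply: reach_instr E8 _ _ => //; apply: reach_instr E9 _ _ => //.
    apply: reach_goto E10 _ _; last by rewrite P6 in R *.
    by rewrite /exec1; mem; rewrite hB h6; clear; lia.
  - by rewrite H1 /m2 /=; mem; rewrite h0 hB; clear; lia.
  - by move=> j n1 n6; rewrite Hj // /m2 /=; mem.
case: n n0 m0 @len loop => // n _ m0 len loop.
set m1 := foldl exec1 m [:: IConst B 1; IConst B.+1 4; IConst B.+4 0; IConst B.+4.+1 1;
  IConst B.+4.+2 0; IAdd B.+4.+2 B.+4.+2 0].
have m1j j : ~~ regs_from B j -> m1 j = m j by rewrite /regs_from /m1 /= => jB; mem.
have [|||m2 [R H1 Hj]] := loop n m1.
- by rewrite m1j // /regs_from; lia.
- by rewrite /m1 /=; mem.
- by rewrite /m1 /=; mem; rewrite m0 add0r.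
set m3 := upd m2 B.+2 OFF%:Z.
have C' : code_at prog (pc + 12) c by [].
have R3 := @reach_straight prog c (pc + 12) m3 C' _.
exists (foldl exec1 m3 c).
have fE := @foldl_addself NA B.+2 B.+1 m3.
have sc : size c = 18%N by rewrite size_nseq NAE.
split.
- have -> : (5 * n.+1 + 30 = 6 + (5 * n.+1 + (1 + (size c + 5))))%N by rewrite sc; clear; lia.
  apply: reach_trans (_ : reach prog 6 _ (RamState (pc + 6) m1)) _.
    rewrite P6; apply: reach_instr E0 _ _ => //; apply: reach_instr E1 _ _ => //.
    apply: reach_instr E2 _ _ => //; apply: reach_instr E3 _ _ => //.
    apply: reach_instr E4 _ _ => //; apply: reach_instr E5 _ _ => //; exact: reach_refl.
  apply: reach_trans R _; apply: reach_instr (_ : nth _ _ _ = IConst B.+2 OFF%:Z) _ _ => //.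
    by rewrite -E11; congr nth; clear; lia.
  rewrite -addnS; apply: reach_cast (R3 _) _ _.
  + by rewrite /c all_nseq orbT.
  + by rewrite size_cat /= -addnA.
  + by rewrite leq_addr.
- have m31 : m3 B.+1 = len%:Z.
    rewrite /m3; mem; rewrite H1 /m1 /=; mem; rewrite /len; clear; lia.
  split; rewrite fE; try by lia.
  + by rewrite ifN; last lia; rewrite /m3; mem; rewrite Hj /m1 /=; try lia; mem.
  + by rewrite ifN // ; lia.
  + rewrite eqxx m31 /m3; mem; rewrite -mulr_natl natz NAE; clear; lia.
  + by rewrite ifN; last lia; rewrite /m3; mem; rewrite Hj /m1 /=; try lia; mem.
  + by rewrite ifN; last lia; rewrite /m3; mem; rewrite Hj /m1 /=; try lia; mem.
- move=> j jB; rewrite fE; last by lia.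
  move: (jB); rewrite /regs_from => jB'; rewrite ifN; last by lia.
  by rewrite /m3; mem; rewrite Hj ?m1j //; lia.
Qed.

(** The cost is charged to the growth of [e], which never decreases and stays within the largest bit
    length seen; over all cells the doublings are linear in the input size. *)
Lemma grow_ok pc e (z : int) m : code_at prog pc (grow B pc) ->
  m B = 1 -> m B.+3 = z -> m B.+4 = e%:Z -> m B.+4.+1 = (2 ^ e)%N%:Z ->
  exists m' e', [/\ reach prog (7 * (e' - e) + 4) (RamState pc m) (RamState (pc + 7) m'),
    (e <= e')%N /\ (e' <= maxn e (bitlen z))%N, z < (2 ^ e')%N%:Z,
    m' B.+4 = e'%:Z /\ m' B.+4.+1 = (2 ^ e')%N%:Z
    & forall j, ~~ (B.+4 <= j < B + 7)%N -> m' j = m j].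
Proof.
rewrite /grow !code_at_cons => -[E0 [E1 [E2 [E3 [E4 [E5 [E6 _]]]]]]].
have P4 : (pc + 4 = pc.+4)%N by rewrite !addnS addn0.
have : exists f, z < (2 ^ (e + f))%N%:Z.
  exists (bitlen z); apply: lt_le_trans (bitlen_lt z) _.
  by rewrite lez_nat leq_exp2l // leq_addl.
case=> f; elim: f e m => [|f IH] e m ze hB h3 h4 h5; case: (ltP z (2 ^ e)%N%:Z) => cmp.
- exists (upd (upd m B.+4.+2 (z - (2 ^ e)%N%:Z)) B.+4.+2 (z - (2 ^ e)%N%:Z + 1)), e; split.
  + rewrite subnn; apply: reach_instr E0 _ _ => //; apply: reach_instr E1 _ _ => //.
    rewrite /exec1 h3 h5; mem; rewrite hB; apply: reach_skip E2 _ _; first by mem; lia.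
    by apply: reach_goto E3 _ _; [mem; rewrite hB|apply: reach_refl].
  + by rewrite leq_maxl.
  + by [].
  + by mem.
  + by move=> j jB; mem.
- by move: ze; rewrite addn0 ltNge cmp.
- exists (upd (upd m B.+4.+2 (z - (2 ^ e)%N%:Z)) B.+4.+2 (z - (2 ^ e)%N%:Z + 1)), e; split.
  + rewrite subnn; apply: reach_instr E0 _ _ => //; apply: reach_instr E1 _ _ => //.
    rewrite /exec1 h3 h5; mem; rewrite hB; apply: reach_skip E2 _ _; first by mem; lia.
    by apply: reach_goto E3 _ _; [mem; rewrite hB|apply: reach_refl].
  + by rewrite leq_maxl.
  + by [].
  + by mem.
  + by move=> j jB; mem.
set m1 := foldl exec1 m [:: ISub B.+4.+2 B.+3 B.+4.+1; IAdd B.+4.+2 B.+4.+2 B;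
  IAdd B.+4.+1 B.+4.+1 B.+4.+1; IAdd B.+4 B.+4 B].
have [|||||m' [e' [R [ee' e'b] zlt [v1 v2] Hj]]] := IH e.+1 m1.
- by rewrite addSnnS.
- by rewrite /m1 /=; mem.
- by rewrite /m1 /=; mem.
- by rewrite /m1 /=; mem; rewrite hB h4; lia.
- by rewrite /m1 /=; mem; rewrite h5 expnS; lia.
exists m', e'; split=> //.
- have -> : (7 * (e' - e) + 4 = (6 + (1 + (7 * (e' - e.+1) + 4))))%N by lia.
  rewrite -[X in reach _ (X + _)]/(6%N); apply: reach_instr E0 _ _ => //; apply: reach_instr E1 _ _ => //.
  apply: reach_goto E2 _ _; first by rewrite /exec1; mem; rewrite h3 h5 hB; lia.
  rewrite P4; apply: reach_instr E4 _ _ => //; apply: reach_instr E5 _ _ => //.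
  apply: reach_goto E6 _ _; first by rewrite /exec1; mem; rewrite hB.
  by apply: reach_le R; rewrite leq_addl.
- split; first exact: ltnW.
  have := bitlen_pow cmp; move: e'b; lia.
- by move=> j jB; rewrite Hj // /m1 /=; mem.
Qed.

Section Copy.
Variables (inp : nat -> int) (lo len I : nat) (m0 : memory).
Hypothesis Ilen : forall i, (i < len)%N -> (bitlen (inp i) <= I)%N.
Hypothesis Bfree : forall i, (lo <= i < len)%N -> ~~ regs_from B i.

Record copied (a e : nat) (m : memory) : Prop := Copied {
  cp_one : m B = 1;
  cp_a : m B.+1 = a%:Z;
  cp_d : m B.+2 = (OFF + NA * a)%N%:Z;
  cp_sz : m B.+4 = e%:Z;
  cp_K : m B.+4.+1 = (2 ^ e)%N%:Z;
  cp_I : (e <= I)%N;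
  cp_src : forall i, (lo <= i < a)%N -> m i = inp i;
  cp_dst : forall i, (a <= i < len)%N -> m (OFF + NA * i)%N = inp i /\ inp i < (2 ^ e)%N%:Z;
  cp_low : forall j, (j < OFF)%N -> ~~ regs_from B j -> m j = m0 j }.

Lemma copied_tmp a e v m : (a <= len)%N -> copied a e m -> copied a e (upd m B.+4.+2 v).
Proof.
move=> al [h1 ha hd hs hK eI src dst low]; split=> //; try by mem.
- move=> i hi; rewrite upd_neq ?src //.
  have : (lo <= i < len)%N by lia.
  by move=> /Bfree; rewrite /regs_from; lia.
- by move=> i hi; rewrite upd_neq; [apply: dst|rewrite NAE; lia].
- by move=> j jO jB; rewrite upd_neq ?low //; move: jB; rewrite /regs_from; lia.
Qed.

Lemma copy1_ok pc a e m : code_at prog pc (copy B lo pc) -> (lo <= a < len)%N ->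
  copied a.+1 e m -> exists m' e', [/\ reach prog (9 + 7 * (e' - e)) (RamState pc m)
      (RamState (pc + 12) m'), (e <= e')%N & copied a e' m'].
Proof.
rewrite /copy code_at_cat => -[C1]; rewrite code_at_cat => -[C2 _]; move: C1.
rewrite !code_at_cons => -[E0 [E1 [E2 [E3 [E4 _]]]]] al [h1 ha hd hs hK eI src dst low].
have aB := Bfree al; rewrite /regs_from in aB.
have P5 : (pc + 5 = pc.+4.+1)%N by rewrite !addnS addn0.
set m1 := foldl exec1 m [:: ISub B.+1 B.+1 B; IConst B.+4.+2 NA%:Z; ISub B.+2 B.+2 B.+4.+2;
      ILoad B.+3 B.+1; IStore B.+2 B.+3].
have m1E : m1 = upd (upd (upd (upd (upd m B.+1 a%:Z) B.+4.+2 NA%:Z) B.+2 (OFF + NA * a)%N%:Z)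
    B.+3 (inp a)) (OFF + NA * a)%N (inp a).
  rewrite /m1 /=; mem; rewrite ha h1 hd.
  have -> : a.+1%:Z - 1 = a%:Z by clear; lia.
  have -> : (OFF + NA * a.+1)%N%:Z - NA%:Z = (OFF + NA * a)%N%:Z by rewrite mulnS; clear; lia.
  set ma := upd (upd (upd m _ _) _ _) _ _.
  have va1 : ma B.+1 = a%:Z by rewrite /ma; mem.
  have va : ma a = inp a by rewrite /ma; mem; rewrite src //; lia.
  rewrite va1 absz_nat va; set mb := upd ma _ _.
  by have -> : mb B.+2 = (OFF + NA * a)%N%:Z by rewrite /mb /ma; mem.
have big i : (OFF <= OFF + NA * i)%N by rewrite leq_addr.
have NAa i j : (OFF + NA * i == OFF + NA * j)%N = (i == j) by rewrite eqn_add2l NAE; lia.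
have aN : (a <= NA * a)%N by rewrite NAE; lia.
have bO := big a; move: BOFF => bOFF.
have [|||| m2 [e' [R [ee' e'b] zlt [v1 v2] Hj]]] := @grow_ok (pc + 5) e (inp a) m1 C2.
- by rewrite m1E; mem.
- by rewrite m1E; mem.
- by rewrite m1E; mem.
- by rewrite m1E; mem.
have m1j j : ~~ regs_from B j -> j != (OFF + NA * a)%N -> m1 j = m j.
  by rewrite /regs_from m1E => jB ja; mem.
have m2j j : ~~ regs_from B j -> j != (OFF + NA * a)%N -> m2 j = m j.
  by move=> jB ja; rewrite Hj ?m1j //; move: jB; rewrite /regs_from; lia.
exists m2, e'; split=> //.
- have -> : (9 + 7 * (e' - e) = 5 + (7 * (e' - e) + 4))%N by lia.
  apply: reach_trans (_ : reach prog 5 _ (RamState (pc + 5) m1)) _; last first.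
    by rewrite -[12%N]/(5 + 7)%N addnA; apply: R.
  rewrite P5; apply: reach_instr E0 _ _ => //; apply: reach_instr E1 _ _ => //.
  apply: reach_instr E2 _ _ => //; apply: reach_instr E3 _ _ => //.
  apply: reach_instr E4 _ _ => //; exact: reach_refl.
split=> //.
- by rewrite Hj ?m1E; [mem|lia].
- by rewrite Hj ?m1E; [mem|lia].
- by rewrite Hj ?m1E; [mem|lia].
- by apply: leq_trans e'b _; rewrite geq_max eI Ilen //; lia.
- move=> i hi; rewrite m2j ?src //; first by lia.
    by apply: Bfree; lia.
  by lia.
- move=> i hi; have [->|ne] := eqVneq i a.
    split=> //; rewrite Hj ?m1E; first by mem.
    by have := big a; lia.
  have [d1 d2] := dst i ltac:(lia); split.
    by rewrite m2j ?NAa // /regs_from; have := big i; lia.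
  by apply: lt_le_trans d2 _; rewrite lez_nat leq_exp2l.
- by move=> j jO jB; rewrite m2j ?low //; lia.
Qed.

Lemma copy_ok pc a e m : code_at prog pc (copy B lo pc) -> (lo < a <= len)%N ->
  copied a e m -> exists m' e', [/\ reach prog (12 * (a - lo) + 7 * (e' - e)) (RamState pc m)
      (RamState (pc + 15) m'), (e <= e')%N & copied lo e' m'].
Proof.
move=> C; have [E12 E13 E14] : [/\ nth IHalt prog (pc + 12) = IConst B.+4.+2 lo%:Z,
    nth IHalt prog (pc + 12).+1 = ISub B.+4.+2 B.+1 B.+4.+2
    & nth IHalt prog (pc + 12).+2 = IJgtz B.+4.+2 pc].
  move: C; rewrite /copy code_at_cat => -[_]; rewrite code_at_cat => -[_].
  by rewrite -addnA !code_at_cons => -[-> [-> [-> _]]].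
have last_step u e1 m1 : (lo <= u < len)%N -> copied u e1 m1 -> 
    let m2 := upd (upd m1 B.+4.+2 lo%:Z) B.+4.+2 (u%:Z - lo%:Z) in
    copied u e1 m2 /\ reach prog 3 (RamState (pc + 12) m1)
      (RamState (if (lo < u)%N then pc else (pc + 15)%N) m2).
  move=> al cp m2; split; first by do 2?[apply: copied_tmp; first by lia].
  have m2E : exec1 (exec1 m1 (IConst B.+4.+2 lo%:Z)) (ISub B.+4.+2 B.+1 B.+4.+2) = m2.
    by rewrite /exec1 /m2; mem; rewrite (cp_a cp).
  apply: reach_instr E12 _ _ => //; apply: reach_instr E13 _ _ => //; rewrite m2E.
  case: ltnP => h.
    by apply: reach_goto E14 _ _; [rewrite /m2 upd_eq subr_gt0 ltz_nat|apply: reach_refl].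
  apply: reach_skip E14 _ _; first by rewrite /m2 upd_eq subr_gt0 ltz_nat ltnNge h.
  by rewrite -!addnS; apply: reach_refl.
elim: a e m => // a IH e m al cp.
have [|m1 [e1 [R1 ee1 cp1]]] := copy1_ok C _ cp; first by lia.
have [|cp2 R2] := last_step a e1 m1 _ cp1; first by lia.
have [lt|ge] := ltnP lo a; last first.
  have E : a = lo by lia.
  rewrite E ltnn in cp2 R2; exists (upd (upd m1 B.+4.+2 lo%:Z) B.+4.+2 (lo%:Z - lo%:Z)), e1; split=> //.
  by apply: reach_le (reach_trans R1 R2); lia.
rewrite lt in R2; have [|m3 [e3 [R3 ee3 cp3]]] := IH e1 _ _ cp2; first by lia.
exists m3, e3; split=> //; last exact: leq_trans ee3.
by apply: reach_le (reach_trans R1 (reach_trans R2 R3)); lia.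
Qed.

End Copy.

Definition reloc lo pc :=
  measure B pc ++ copy B lo (pc + size (measure B pc)).

Lemma size_reloc lo pc : size (reloc lo pc) = 45%N.
Proof. by rewrite /reloc !size_cat /= size_nseq NAE. Qed.

Lemma reloc_ok lo pc n I (inp : nat -> int) m (len := (4 + n + (n * n + n * n))%N) :
  code_at prog pc (reloc lo pc) -> (0 < n)%N -> (lo < len)%N -> (len <= I)%N ->
  (forall i, (i < len)%N -> (bitlen (inp i) <= I)%N) ->
  (forall i, (lo <= i < len)%N -> ~~ regs_from B i) ->
  m 0%N = n%:Z -> (forall i, (lo <= i < len)%N -> m i = inp i) ->
  exists m' e, [/\ reach prog (24 * I + 30) (RamState pc m) (RamState (pc + 45) m'),
    m' B.+4 = e%:Z /\ (e <= I)%N,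
    forall i, (lo <= i < len)%N -> m' (OFF + NA * i)%N = inp i /\ inp i < (2 ^ e)%N%:Z
    & forall j, (j < OFF)%N -> ~~ regs_from B j -> m' j = m j].
Proof.
move=> C n0 lol lI bI fr m0 src; move: (C); rewrite code_at_cat => -[C1 C2].
have [m1 [R1 [h1 ha hd hs hK] mj]] := measure_ok C1 n0 m0.
have cp : @copied inp lo len I m len 0 m1.
  split=> //; first by move=> i hi; rewrite mj ?src ?fr.
  - by move=> i /andP[h /(leq_ltn_trans h)]; rewrite ltnn.
  - by move=> j _; apply: mj.
have [|m2 [e [R2 _ cp2]]] := @copy_ok inp lo len I m bI fr _ len 0 m1 C2 _ cp.
  by rewrite lol leqnn.
have [_ _ _ g1 _ g2 _ g3 g4] := cp2; exists m2, e; split=> //.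
have E : (pc + 45 = pc + size (measure B pc) + 15)%N.
  by rewrite /= size_nseq NAE; lia.
(* The coefficient 24 collects 5 per point for measuring, 12 per copied cell and 7 per doubling. *)
rewrite E; apply: reach_le (reach_trans R1 R2); rewrite subn0.
have : (n <= len)%N by rewrite /len; lia.
by move: lI g2; clear; lia.
Qed.

End Prologue.

(** * The whole machine *)

Fixpoint packed (l : seq bool) : nat :=
  if l is c :: l' then c * 2 ^ size l' + packed l' else 0.

Lemma packed_lt l : (packed l < 2 ^ size l)%N.
Proof.
elim: l => //= c l IH; rewrite expnS mul2n -addnn -addnS leq_add //.
by case: c; rewrite ?mul1n.
Qed.

Definition pack js := flatten [seq [:: IAdd 4 4 4; IAdd 4 4 j] | j <- js].

Lemma pack_ok js m (f : nat -> bool) : 4%N \notin js ->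
  (forall j, j \in js -> m j = (f j)%:Z) -> forall j, foldl exec1 m (pack js) j =
    if j == 4%N then m 4%N * (2 ^ size js)%N%:Z + (packed (map f js))%:Z else m j.
Proof.
elim: js m => [|u js IH] m nu mf j /=; first by rewrite mulr1 addr0; case: eqP => [->|].
move: nu; rewrite inE negb_or => /andP[nu njs]; rewrite eq_sym in nu.
rewrite /pack /= -/(pack js) IH // => [|v vjs]; last first.
  have nv : v != 4%N by apply: contraNneq njs => <-.
  by rewrite !upd_neq // mf // inE vjs orbT.
rewrite upd_eq upd_eq (upd_neq _ _ (j := u)) // (mf u) ?inE ?eqxx //= size_map expnS.
case: eqP => [_|/eqP nj]; last by rewrite !upd_neq.
by rewrite !PoszD !PoszM; ring.
Qed.

(* The packed bits are in scalar 10. *)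
Fixpoint cUnpack (js : seq nat) : cmd :=
  if js is j :: js' then
    Seq (If (Sub (Var 10) (Cst ((2 ^ size js')%N%:Z - 1)))
           (Seq (Asg 10 (Sub (Var 10) (Cst (2 ^ size js')%N%:Z)))
                (Sto aIn (Cst j%:Z) (Cst 1)))
           (Sto aIn (Cst j%:Z) (Cst 0)))
        (cUnpack js')
  else Skip.

Lemma unpackP js (f : nat -> bool) s : uniq js ->
  sc s 10%N = (packed (map f js))%:Z -> let s' := run (cUnpack js) s in
  (forall x, x != 10%N -> sc s' x = sc s x) /\
  forall i, ar s' aIn i = if i \in js then (f i)%:Z else ar s aIn i.
Proof.
elim: js s => [|j js IH] s // /andP[nj U] s10; rewrite [cUnpack _]/= run_seq.
set s1 := run (If _ _ _) s.
have lt := packed_lt (map f js); rewrite size_map in lt.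
have [h1 [h2 h3]] : sc s1 10%N = (packed (map f js))%:Z /\
    (forall x, x != 10%N -> sc s1 x = sc s x) /\
    forall i, ar s1 aIn i = if i == j then (f j)%:Z else ar s aIn i.
  rewrite /s1 run_if !evalE s10 /= size_map.
  case E: (f j); rewrite ?mul1n ?mul0n.
    rewrite (_ : 0 < _); last by lia.
    rewrite run_seq run_asg run_sto !evalE s10 /= size_map E mul1n; split.
      by rewrite upd_eq; lia.
    by split=> [x nx|i] //; rewrite upd_neq.
  rewrite (_ : (0 < _) = false); last by lia.
  by rewrite run_sto !evalE /=; split; [rewrite s10 /= E|split].
have [g1 g2] := IH s1 U h1; split=> [x nx|i]; first by rewrite g1 ?h2.
rewrite g2 h3 inE; case: (eqVneq i j) => [->|_] //=.
by rewrite (negbTE nj).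
Qed.

(* The input may occupy every low address.  If n <= 8 it ends before address
   140, where registers can be taken; otherwise the first nine colours are bits
   that are packed into one cell, which frees addresses 5 to 12. *)
Definition bits := [:: 5; 6; 7; 8; 9; 10; 11; 12; 4]%N.

Definition small_code pc main : seq instr :=
  halve 140 pc ++ [:: IConst 147 0; IAdd 4 0 147; IAdd 0 141 147]
  ++ reloc 140 0 (pc + 10) ++ [:: IAdd 4 144 0; IConst 0 0; IConst 1 1; IJgtz 1 main].

Definition moves js :=
  flatten [seq [:: IConst 11 (OFF + NA * i)%N%:Z; IStore 11 i] | i <- js].

Lemma moves_ok js m (m' := foldl exec1 m (moves js)) : all (ltn^~ 11%N) js ->
  (forall i, i \in js -> m' (OFF + NA * i)%N = m i) /\
  forall j, j != 11%N -> (forall i, i \in js -> j != OFF + NA * i)%N -> m' j = m j.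
Proof.
rewrite {}/m'; elim: js m => [|u js IH] m // /andP[h js11]; have u11 : (u < 11)%N := h.
set m1 := upd (upd m 11 (OFF + NA * u)%N%:Z) (OFF + NA * u)%N (m u).
have -> : foldl exec1 m (moves (u :: js)) = foldl exec1 m1 (moves js).
  by rewrite /moves /= (upd_neq _ _ (j := u)) // neq_ltn u11.
have [H1 H2] := IH m1 js11.
have big i : (OFF <= OFF + NA * i)%N by rewrite leq_addr.
have m1j j : (j < 11)%N -> m1 j = m j.
  by move=> j11; have := big u; rewrite /m1 /OFF => bu; mem.
split=> [i|j j11 jn].
  have [ijs _|ijs] := boolP (i \in js); first by rewrite H1 // m1j //; apply: (allP js11).
  rewrite inE (negbTE ijs) orbF => /eqP->{i ijs}; have [ujs|ujs] := boolP (u \in js).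
    by rewrite H1 // m1j.
  have -> : m u = m1 (OFF + NA * u)%N by rewrite /m1 upd_eq.
  apply: H2; first by have := big u; rewrite /OFF; lia.
  move=> i ijs; rewrite eqn_add2l NAE eqn_mul2l /=; apply: contraNneq ujs => -> //.
rewrite H2 // => [|i ijs]; last by apply: jn; rewrite inE ijs orbT.
by rewrite /m1 upd_neq ?upd_neq //; apply: jn; rewrite inE eqxx.
Qed.

(** Cell 4 is free because the first colour is kept as the parity of cell 0. It collects the next
    eight colours, and their cells 5 to 12 become registers. The first colour is appended last,
    whence the order of [bits]. Cells 0 to 3 are moved one by one, since [reloc] starts at 13. *)
Definition big_code pc : seq instr :=
  (IConst 4 0 :: pack (iota 5 8)) ++ halve 5 (pc + 17)
  ++ (pack [:: 0] ++ [:: IConst 12 0; IAdd 0 6 12]) ++ reloc 5 13 (pc + 28)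
  ++ (moves (iota 0 4) ++ [:: IAdd 9 9 0; IConst 0 0; IAdd 12 4 0; IAdd 4 9 0; IConst 1 1])
  ++ ccmd 0 (pc + 86) (cUnpack bits).

Section Load.
Variables (prog : seq instr) (n I : nat) (inp : nat -> int) (f : nat -> bool).
Local Notation len := (4 + n + (n * n + n * n))%N.
Hypotheses (n0 : (0 < n)%N) (lI : (len <= I)%N) (inp0 : inp 0 = n%:Z).
Hypothesis bI : forall i, (i < len)%N -> (bitlen (inp i) <= I)%N.
Hypothesis inpf : forall i, (4 <= i < 4 + n)%N -> inp i = (f i)%:Z.

(** [SZ] serves two purposes: the bit masks of clusters need n <= SZ, and multiplication needs the
    denominators below 2 ^ SZ. *)
Record ready (SZ : nat) (m : memory) : Prop := Ready {
  rd0 : m 0%N = 0;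
  rd1 : m 1%N = 1;
  rd4 : m 4%N = SZ%:Z;
  rd_n : (n <= SZ <= I + I)%N;
  rd_in : forall i, (i < len)%N -> m (OFF + NA * i)%N = inp i;
  rd_lt : forall i, (4 + n <= i < len)%N -> inp i < (2 ^ SZ)%N%:Z }.

(* The first two instructions have replaced n by 2 n + (the first bit). *)
Definition start m := m 0%N = (n.*2 + f 4)%N%:Z /\
  forall i, i != 0%N -> i != 4%N -> (i < len)%N -> m i = inp i.

Lemma pow_le e e' (z : int) : z < (2 ^ e)%N%:Z -> (e <= e')%N -> z < (2 ^ e')%N%:Z.
Proof. by move=> h le; apply: lt_le_trans h _; rewrite lez_nat leq_exp2l. Qed.

Lemma small_ok pc main m : code_at prog pc (small_code pc main) -> (n <= 8)%N ->
  start m -> exists m' SZ, reach prog (32 * I + 64) (RamState pc m) (RamState main m') /\ ready SZ m'.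
Proof.
rewrite /small_code code_at_cat => -[C1]; rewrite code_at_cat => -[C2].
rewrite code_at_cat => -[C3 C4] n8 [m0 mi].
rewrite -[(pc + size _)%N]/(pc + 7)%N -?addnA -?[(7 + size _)%N]/10%N size_reloc in C2 C3 C4.
(* 4 + 8 + 2 * 64 = 140, so for n <= 8 the input ends below the registers. *)
have l140 : (len <= 140)%N by nia.
have [m1 [R1 h0 h1 hj]] := @halve_ok prog 140 isT isT pc n (f 4) m C1 n0 m0.
have R2 := @reach_straight prog _ (pc + 7) m1 C2 isT; set m2 := foldl exec1 m1 _ in R2.
have m2E i : (i < len)%N -> m2 i = inp i.
  move=> il; rewrite /m2 /=; have [->|i0] := eqVneq i 0%N.
    by mem; rewrite h1 addr0 inp0.
  have [->|i4] := eqVneq i 4%N.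
    by mem; rewrite h0 addr0 inpf //; lia.
  by mem; rewrite hj ?mi // /regs_from; lia.
have [||||m3 [e [R3 [he eI] hin low]]] := @reloc_ok prog 140 isT isT 0 (pc + 10) n I inp m2 C3 n0 _ lI bI.
- by [].
- by move=> i /andP[_ il]; rewrite /regs_from; lia.
- by rewrite m2E.
- by move=> i /andP[_ il]; apply: m2E.
rewrite -[(7 + (_ + 45))%N]/55%N !code_at_cons in C4; have [E0 [E1 [E2 [E3 _]]]] := C4.
set m4 := foldl exec1 m3 [:: IAdd 4 144 0; IConst 0 0; IConst 1 1].
have m30 : m3 0%N = n%:Z by rewrite low // m2E.
exists m4, (e + n)%N; split.
  have R4 : reach prog 4 (RamState (pc + 55) m3) (RamState main m4).
    apply: reach_instr E0 _ _ => //; apply: reach_instr E1 _ _ => //.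
    apply: reach_instr E2 _ _ => //; apply: reach_goto E3 _ _; first by rewrite /exec1; mem.
    exact: reach_refl.
  have R := reach_trans R1 (reach_trans R2 _).
  rewrite -addnA in R; have {}R := R _ _ (reach_trans R3 _); rewrite -addnA in R.
  by apply: reach_le (R _ _ R4); move: lI; clear; rewrite /=; lia.
split.
- by rewrite /m4 /=; mem.
- by rewrite /m4 /=; mem.
- by rewrite /m4 /=; mem; rewrite he m30.
- by move: eI lI; clear; lia.
- by move=> i il; rewrite /m4 /=; mem; have [] := hin i il.
- by move=> i /andP[_ il]; have [_ h] := hin i il; apply: pow_le h _; rewrite leq_addr.
Qed.

Lemma big_ok pc m : code_at prog pc (big_code pc) -> (9 <= n)%N -> start m ->
  exists m' SZ, reach prog (32 * I + 128 + ccost 0 (cUnpack bits)) (RamState pc m)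
     (RamState (pc + size (big_code pc)) m') /\ ready SZ m'.
Proof.
move=> C n9 [m0 mi]; have [C1 C2 C3 [C4 C5 C6]] : [/\
    code_at prog pc (IConst 4 0 :: pack (iota 5 8)), code_at prog (pc + 17) (halve 5 (pc + 17)),
    code_at prog (pc + 24) (pack [:: 0%N] ++ [:: IConst 12 0; IAdd 0 6 12])
    & [/\ code_at prog (pc + 28) (reloc 5 13 (pc + 28)),
      code_at prog (pc + 73) (moves (iota 0 4) ++
        [:: IAdd 9 9 0; IConst 0 0; IAdd 12 4 0; IAdd 4 9 0; IConst 1 1])
      & code_at prog (pc + 86) (ccmd 0 (pc + 86) (cUnpack bits))]].
  move: C; rewrite /big_code code_at_cat => -[C1]; rewrite code_at_cat => -[C2].
  rewrite code_at_cat => -[C3]; rewrite code_at_cat => -[C4]; rewrite code_at_cat => -[C5 C6].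
  by rewrite size_reloc -!addnA in C2 C3 C4 C5 C6.
have R1 := reach_straight m C1 isT; set m1 := foldl exec1 m _ in R1.
have m1E j : m1 j = if j == 4%N then (packed (map f (iota 5 8)))%:Z else m j.
  have fj i : i \in iota 5 8 -> upd m 4 0 i = (f i)%:Z.
    rewrite mem_iota => /andP[h1 h2]; rewrite upd_neq; last by lia.
    by rewrite mi ?inpf //; lia.
  rewrite -[m1]/(foldl exec1 (upd m 4 0) (pack (iota 5 8))).
  rewrite (pack_ok (f := f)) // upd_eq mul0r add0r.
  by case: eqP => // /eqP nj; rewrite upd_neq.
have m10 : m1 0%N = (n.*2 + f 4)%N%:Z by rewrite m1E.
have [m2 [R2 h0 h6 hj]] := @halve_ok prog 5 isT isT (pc + 17) n (f 4) m1 C2 n0 m10.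
have R3 := reach_straight m2 C3 isT; set m3 := foldl exec1 m2 _ in R3.
have m24 : m2 4%N = (packed (map f (iota 5 8)))%:Z by rewrite hj // m1E.
have m34 : m3 4%N = (packed (map f bits))%:Z.
  rewrite /m3 /=; mem; rewrite m24 h0 /=; clear; lia.
have m30 : m3 0%N = n%:Z by rewrite /m3 /=; mem; rewrite h6 addr0.
have m3j j : j \notin [:: 0; 4; 5; 6; 7; 8; 9; 10; 11; 12]%N -> m3 j = m j.
  rewrite !inE !negb_or => h; rewrite /m3 /=.
  have [j0 j4 j12 jr] : [/\ j != 0, j != 4, j != 12 & ~~ regs_from 5 j]%N.
    by split; rewrite /regs_from; lia.
  by mem; rewrite hj // m1E (negbTE j4).
have src i : (13 <= i < len)%N -> m3 i = inp i.
  by move=> hi; rewrite m3j ?mi ?inE //; lia.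
have [||||m4 [e [R4 [he eI] hin low]]] := @reloc_ok prog 5 isT isT 13 (pc + 28) n I inp m3 C4 n0 _ lI bI.
- by lia.
- by move=> i hi; rewrite /regs_from; lia.
- exact: m30.
- exact: src.
have R5 := reach_straight m4 C5 isT; rewrite foldl_cat in R5.
have [mv1 mv2] := @moves_ok (iota 0 4) m4 isT.
set m5 := foldl exec1 m4 _ in R5 mv1 mv2; set m6 := foldl exec1 m5 _ in R5.
have ne i j : (j < OFF)%N -> j != (OFF + NA * i)%N.
  by move=> jO; rewrite neq_ltn (leq_trans jO) // leq_addr.
have m5j j : (j < OFF)%N -> j != 11%N -> m5 j = m4 j.
  by move=> jO j11; apply: mv2 => // i _; apply: ne.
have m40 : m4 0%N = n%:Z by rewrite low.
have m6lo : [/\ m6 0%N = 0, m6 1%N = 1, m6 4%N = (e + n)%N%:Z & m6 12%N = (packed (map f bits))%:Z].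
  rewrite /m6 /=; split; mem => //.
    by rewrite !m5j // he m40 !addr0.
  by rewrite m5j // low // m34 addr0.
have m6c i : (i < len)%N -> (i \notin bits) -> m6 (OFF + NA * i)%N = inp i.
  move=> il ib; have big : (OFF <= OFF + NA * i)%N by rewrite leq_addr.
  have O2 : OFF = 200%N by [].
  rewrite /m6 /=; mem.
  have [i4|i4] := ltnP i 4.
    rewrite mv1 ?mem_iota // low /OFF; try by rewrite /regs_from; lia.
    have [->|i0] := eqVneq i 0%N; first by rewrite m30 inp0.
    by rewrite m3j ?mi ?inE //; lia.
  have hi : (13 <= i < len)%N by move: ib; rewrite !inE; lia.
  have [<- _] := hin i hi; apply: mv2; first by lia.
  by move=> u; rewrite mem_iota eqn_add2l NAE; lia.
pose s := Store (fun x => m6 x.+2) (fun a i => m6 (cell a i)).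
have [q1 q2 q3 q4] := m6lo.
have ag : agree s m6 by split.
have [||m7 [R6 [a0 a1 av aa] _]] := @ccmd_ok prog 0 0 (cUnpack bits) 0 (pc + 86) s m6 _ C6 ag.
- by vm_compute.
- by [].
have [||g1 g2] := @unpackP bits f s; [by []|by []|].
exists m7, (e + n)%N; split.
  have sz : size (big_code pc) = (86 + size (ccmd 0 (pc + 86) (cUnpack bits)))%N.
    rewrite /big_code; move: (ccmd _ _ _) (reloc 5 13 _) (size_reloc 5 13 (pc + 28)) => cc rl sr.
    by rewrite !size_cat sr.
  rewrite sz addnA.
  have R1' : reach prog 17 (RamState pc m) (RamState (pc + 17) m1) by [].
  have R2' : reach prog (4 * n + 3) (RamState (pc + 17) m1) (RamState (pc + 24) m2).
    by rewrite -[24%N]/(17 + 7)%N addnA.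
  have R3' : reach prog 4 (RamState (pc + 24) m2) (RamState (pc + 28) m3).
    by rewrite -[28%N]/(24 + 4)%N addnA.
  have R4' : reach prog (24 * I + 30) (RamState (pc + 28) m3) (RamState (pc + 73) m4).
    by rewrite -[73%N]/(28 + 45)%N addnA.
  have R5' : reach prog 13 (RamState (pc + 73) m4) (RamState (pc + 86) m6).
    by rewrite -[86%N]/(73 + 13)%N addnA.
  apply: reach_le (reach_trans R1' (reach_trans R2' (reach_trans R3' (reach_trans R4' (reach_trans R5' R6))))).
  by move: (ccost _ _) lI; clear; lia.
have cellIn i : (OFF + NA * i)%N = cell aIn i by rewrite /cell addn0.
split=> //.
- by rewrite (av 2%N) // g1.
- by move: eI lI; clear; lia.
- move=> i il; rewrite cellIn aa // g2; case: ifP => ib; last by rewrite /= -cellIn m6c ?ib.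
  by rewrite inpf //; move: ib; rewrite !inE; move: n9; clear; lia.
- by move=> i hi; have [|_ h] := hin i; [lia|apply: pow_le h _; rewrite leq_addr].
Qed.

End Load.

(** * Linking the stages and reading the output *)

Fixpoint link pc (cs : seq cmd) : seq instr :=
  if cs is c :: cs' then
    ccmd 0 pc c ++ link (pc + size (ccmd 0 pc c)) cs'
  else [::].

Lemma link_cons prog pc c cs (pc' := (pc + size (ccmd 0 pc c))%N) :
  code_at prog pc (link pc (c :: cs)) ->
  [/\ code_at prog pc (ccmd 0 pc c), code_at prog pc' (link pc' cs)
    & (pc + size (link pc (c :: cs)) = pc' + size (link pc' cs))%N].
Proof. by rewrite /= code_at_cat size_cat addnA => -[]. Qed.

Definition stages := [:: cReadonly1; cReadonly2; cSearch; cClean].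

Lemma run_foldr_cat cs1 cs2 s : run (foldr Seq Skip (cs1 ++ cs2)) s =
  run (foldr Seq Skip cs2) (run (foldr Seq Skip cs1) s).
Proof. by elim: cs1 s => //= c cs1 IH s; rewrite !run_seq IH. Qed.

Lemma fills_ok As s N : cnt (sc s 1%N) = N ->
  let s' := run (foldr Seq Skip [seq Fill 1 a (Cst (-1)) | a <- As]) s in
  (forall x, x != vI -> sc s' x = sc s x) /\
  forall a i, ar s' a i = if (a \in As) && (i < N)%N then -1 else ar s a i.
Proof.
elim: As s => [|a0 As IH] s sN //=; rewrite run_seq.
have [|h1 h2] := IH (run (Fill 1 a0 (Cst (-1))) s); first by rewrite fill_sc.
split=> [x nx|a i]; first by rewrite h1 // fill_sc.
rewrite h2 fillE // sN eval_cst inE.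
by case: (a == a0); case: (a \in As); case: (i < N)%N.
Qed.

Lemma eval_times k x s : eval s (addn_times k x) = sc s x *+ k.
Proof. by elim: k => [|k IH] //; rewrite mulrS -IH. Qed.

Lemma cleanP s n : sc s 0%N = n%:Z -> sc s 1%N = n.+1%:Z -> let s' := run cClean s in
  [/\ sc s' 5%N = (OFF + NA * n)%N%:Z,
    forall a i, (a < NA)%N -> a != aOut -> (i <= n)%N -> ar s' a i = -1
    & forall i, (i < n)%N -> ar s' aOut i = ar s aOut i].
Proof.
move=> s0 s1; rewrite /cClean -!cats1 !run_foldr_cat.
set As := filter _ _; have [|h1 h2] := @fills_ok As s n.+1; first by rewrite s1.
move: (run _ s) h1 h2 => t h1 h2; cbv zeta.
have one c u : run (foldr Seq Skip [:: c]) u = run c u by [].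
rewrite !one run_sto run_asg eval_add eval_times !eval_cst eval_var.
rewrite [sc (aset _ _ _ _) 0]/= h1 // s0; split.
- by rewrite /= upd_eq -mulr_natl natz -PoszM -PoszD.
- move=> a i aN na ile; rewrite /= (negbTE na) h2 mem_filter na mem_iota /= aN ltnS ile.
  by [].
- move=> i il; rewrite /= upd_neq; last by rewrite neq_ltn il.
  by rewrite h2 mem_filter eqxx.
Qed.

(** Cell 7 is scalar 5, which holds the output length. The cells 1 to 199 get -1, which is no point,
    so that only the arrays can contribute to the output. *)
Definition epilogue := IAdd 0 7 0 :: [seq IConst j (-1) | j <- iota 1 199] ++ [:: IHalt].

Lemma foldl_const js z m x :
  foldl exec1 m [seq IConst j z | j <- js] x = if x \in js then z else m x.
Proof.
elim: js m => //= j js IH m; rewrite IH inE updE.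
by case: (x \in js); rewrite ?orbT // orbF.
Qed.

Definition main_pc := (66 + size (big_code 66))%N.
Definition end_pc := (main_pc + size (link main_pc stages))%N.

(** An empty point set halts at once. Otherwise cell 0 becomes 2 n plus the first colour, and
    comparing it with 17 separates n <= 8 from n >= 9 whatever that colour is. *)
Definition machine : seq instr :=
  [:: IJgtz 0 2; IHalt; IAdd 0 0 0; IAdd 0 0 4; IConst 4 17; ISub 4 0 4; IJgtz 4 66]
  ++ small_code 7 main_pc ++ big_code 66 ++ link main_pc stages ++ epilogue.

Lemma machine_code : [/\
  code_at machine 0 [:: IJgtz 0 2; IHalt; IAdd 0 0 0; IAdd 0 0 4; IConst 4 17; ISub 4 0 4; IJgtz 4 66],
  code_at machine 7 (small_code 7 main_pc), code_at machine 66 (big_code 66),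
  code_at machine main_pc (link main_pc stages) & code_at machine end_pc epilogue].
Proof.
have : code_at machine 0 machine by [].
have sz : size (small_code 7 main_pc) = 59%N.
  rewrite /small_code; move: (reloc 140 0 _) (size_reloc 140 0 (7 + 10)) => rl sr.
  by rewrite !size_cat sr.
rewrite {2}/machine.
move: (small_code 7 main_pc) sz => c1 sz.
rewrite code_at_cat => -[C0]; rewrite code_at_cat => -[C1]; rewrite code_at_cat => -[C2].
rewrite code_at_cat => -[C3 C4]; rewrite sz in C2 C3 C4.
by split.
Qed.

(** Dominates every loop bound: SZ is at most 2 I, and N ^ 7, the largest power used, has N <= I +
    1. *)
Definition bound I := ((I + I + 2) ^ 7)%N.

Definition time I := (8 + (32 * I + 128 + ccost 0 (cUnpack bits)) +
  (ccost 0 cReadonly1 + (ccost (bound I) cReadonly2 + (ccost (bound I) cSearch +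
   ccost (bound I) cClean))) + 200)%N.

Lemma time_gt0 I : (0 < time I)%N.
Proof. by rewrite /time -addnA addnC addn_gt0 orbC addn_gt0. Qed.

Lemma polyb_time : polyb time.
Proof.
have pb : polyb bound.
  by apply: polyb_exp; do ?[apply: polyb_add]; [apply: polyb_id|apply: polyb_id|apply: polyb_cst].
have pc c : polyb (fun I => ccost (bound I) c) by apply: (polyb_comp (polyb_ccost c) pb).
rewrite /time; move: (ccost 0 _) (ccost 0 _) => k1 k2.
by do ?[exact: polyb_cst|exact: polyb_id|exact: pc|apply: polyb_add|apply: polyb_mul].
Qed.

Lemma search_ro x s : (x < 5)%N -> sc (run cSearch s) x = sc s x.
Proof. by move=> x5; rewrite run_sc //; case: x x5 => [|[|[|[|[|]]]]]. Qed.

Lemma main_ok n I inp SZ m : (4 + n + (n * n + n * n) <= I)%N -> inp 0 = n%:Z ->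
  ready n I inp SZ m ->
  exists m' s, [/\ reach machine (ccost 0 cReadonly1 + (ccost (bound I) cReadonly2 +
      (ccost (bound I) cSearch + ccost (bound I) cClean)))
      (RamState main_pc m) (RamState end_pc m'),
    agree (run cClean (run cSearch s)) m' & env_in n SZ inp s].
Proof.
move=> lI inp0 [r0 r1 r4 /andP[nSZ SZI] rin _].
have nI : (n <= I)%N by move: lI; clear; lia.
have /and4P[w1 w2 w3 w4] := wf_all.
have [_ _ _ C _] := machine_code; rewrite /end_pc.
move: main_pc C => p0 /link_cons[C1]; set p1 := (p0 + _)%N => /link_cons[C2].
set p2 := (p1 + _)%N => /link_cons[C3]; set p3 := (p2 + _)%N => /link_cons[C4 _].
move=> -> -> -> ->; rewrite addn0.
pose s0 := Store (fun x => m x.+2) (fun a i => m (cell a i)).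
have ag : agree s0 m by split.
have ar0 i : (i < 4 + n + (n * n + n * n))%N -> ar s0 aIn i = inp i.
  by move=> il; rewrite /= /cell addn0 rin.
have [//|m1 [R1 A1 _]] := ccmd_ok (B := 0) w1 C1 ag.
set s1 := run cReadonly1 s0 in A1.
have v0 : eval s0 (Arr aIn (Cst 0)) = n%:Z by rewrite eval_arr eval_cst ar0.
have [s10 s11] : sc s1 0%N = n%:Z /\ sc s1 1%N = n.+1%:Z.
  rewrite /s1 /cReadonly1 2!run_seq run_skip !run_asg v0 eval_add eval_var eval_cst.
  have -> : sc (sset 0 n%:Z s0) 0%N = n%:Z by [].
  by rewrite -PoszD addn1.
have s12 : sc s1 2%N = SZ%:Z by rewrite /s1 run_sc.
have ar1 i : (i < 4 + n + (n * n + n * n))%N -> ar s1 aIn i = inp i.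
  by move=> il; rewrite /s1 run_ar // ar0.
have le1 x : (x <= I + I + 2)%N -> (x <= bound I)%N.
  by move=> h; apply: leq_trans h _; rewrite /bound expnS leq_pmulr // expn_gt0 addn2.
have b3 b : (b < 3)%N -> (cnt (sc s1 b) <= bound I)%N.
  case: b => [|[|[|]]] // _; rewrite ?s10 ?s11 ?s12 /=; apply: le1; move: nI SZI; clear; lia.
have [m2 [R2 A2 _]] := ccmd_ok w2 C2 A1 b3.
set s2 := run cReadonly2 s1 in A2.
have E2 : env_in n SZ inp s2.
  rewrite /s2 /cReadonly2 2!run_seq run_skip !run_asg.
  have v3 : eval s1 (mulN (mulN (Var 1))) = (n.+1 ^ 3)%N%:Z.
    rewrite !(mulNE s11) // eval_var s11 !expnS expn0 muln1; lia.
  rewrite v3; set t := sset 3 _ s1.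
  have v4 : eval t (mulN (mulN (mulN (mulN (Var 3))))) = (n.+1 ^ 7)%N%:Z.
    have t1 : sc t 1%N = n.+1%:Z by rewrite /t /= upd_neq.
    have t3 : sc t 3%N = (n.+1 ^ 3)%N%:Z by [].
    by rewrite !(mulNE t1) // eval_var t3.
  rewrite v4 /t; split=> //=; mem => //.
have [e0 e1 e2 e3 e4 _] := E2.
have pw k : (k <= 7)%N -> (n.+1 ^ k <= bound I)%N.
  move=> k7; apply: (@leq_trans (n.+1 ^ 7)); first exact: leq_pexp2l.
  by rewrite /bound leq_exp2r //; move: nI; clear; lia.
have b5 s : (forall x, (x < 5)%N -> sc s x = sc s2 x) ->
    forall b, (b < 5)%N -> (cnt (sc s b) <= bound I)%N.
  move=> H b b5; rewrite H //; case: b b5 => [|[|[|[|[|]]]]] // _.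
  - by rewrite e0; apply: le1; move: nI; clear; rewrite /=; lia.
  - by rewrite e1; apply: le1; move: nI; clear; rewrite /=; lia.
  - by rewrite e2; apply: le1; move: SZI; clear; rewrite /=; lia.
  - by rewrite e3; apply: pw.
  - by rewrite e4; apply: pw.
have [m3 [R3 A3 _]] := ccmd_ok w3 C3 A2 (b5 s2 (fun _ _ => erefl)).
have [m4 [R4 A4 _]] := ccmd_ok w4 C4 A3 (b5 _ (fun x => @search_ro x s2)).
exists m4, s2; split=> //.
exact: (reach_trans R1 (reach_trans R2 (reach_trans R3 R4))).
Qed.

Lemma load_ok n I (inp : nat -> int) (f : nat -> bool) :
  (0 < n)%N -> (4 + n + (n * n + n * n) <= I)%N -> inp 0 = n%:Z ->
  (forall i, (i < 4 + n + (n * n + n * n))%N -> (bitlen (inp i) <= I)%N) ->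
  (forall i, (4 <= i < 4 + n)%N -> inp i = (f i)%:Z) ->
  exists m SZ, reach machine (8 + (32 * I + 128 + ccost 0 (cUnpack bits)))
    (RamState 0 inp) (RamState main_pc m) /\ ready n I inp SZ m.
Proof.
move=> n0 lI inp0 bI inpf; have [C0 C1 C2 _ _] := machine_code.
move: C0; rewrite !code_at_cons => -[E0 [_ [E2 [E3 [E4 [E5 [E6 _]]]]]]].
set m := foldl exec1 inp [:: IAdd 0 0 0; IAdd 0 0 4; IConst 4 17; ISub 4 0 4].
have inp4 : inp 4 = (f 4)%:Z by apply: inpf; lia.
have m0 : m 0%N = (n.*2 + f 4)%N%:Z by rewrite /m /=; mem; rewrite inp0 inp4 -!PoszD addnn.
have st : start n inp f m by split=> // i i0 i4 _; rewrite /m /=; mem.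
have m4 : m 4%N = (n.*2 + f 4)%N%:Z - 17 by rewrite -m0 /m /=; mem.
have R0 T p : reach machine T (RamState (if (9 <= n)%N then 66%N else 7%N) m) p ->
    reach machine (8 + T) (RamState 0 inp) p.
  move=> R; apply: (@reach_le _ T.+4.+2); first by rewrite addnC -addn4 -addn2 -addnA leq_add2l.
  apply: reach_goto E0 _ _; first by rewrite inp0.
  apply: reach_instr E2 _ _ => //; apply: reach_instr E3 _ _ => //.
  apply: reach_instr E4 _ _ => //; apply: reach_instr E5 _ _ => //; rewrite -/m.
  case: (leqP 9 n) R => h R.
    by apply: reach_goto E6 _ R; rewrite m4; move: h; clear; lia.
  by apply: reach_skip E6 _ R; rewrite m4; move: h; case: (f 4); clear; lia.
have [big|small] := leqP 9 n.
  have [m' [SZ [R rd]]] := big_ok n0 lI inp0 bI inpf C2 big st.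
  by exists m', SZ; split=> //; apply: R0; rewrite big.
have [m' [SZ [R rd]]] := small_ok n0 lI inp0 bI inpf C1 small st.
exists m', SZ; split=> //; apply: R0; rewrite leqNgt small.
apply: reach_le R; move: (ccost _ _); clear; lia.
Qed.

(** The scan covers cells 1 to [OFF + NA * n]. From [OFF] on, division by [NA] recovers the array
    and the index of a cell; in this range only [aOut] can hold anything but -1, which never names a
    point. *)
Lemma decode_ok n (s : store) (m : memory) (C : {set 'I_n}) p :
  m 0%N = (OFF + NA * n)%N%:Z -> (forall j, (0 < j < OFF)%N -> m j = -1) ->
  (forall a i, (a < NA)%N -> m (cell a i) = ar s a i) ->
  (forall a i, (a < NA)%N -> a != aOut -> (i <= n)%N -> ar s a i = -1) ->
  outset s C -> decode_output n (RamState p m) = C.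
Proof.
move=> m0 mlo mc clean out; apply/setP => i; rewrite inE /= m0 absz_nat.
apply/hasP/idP => [[j]|iC].
  rewrite mem_iota => /andP[j0 jle] /eqP mj.
  have [jO|jO] := ltnP j OFF; first by move: mj; rewrite mlo // j0.
  pose u := ((j - OFF) %/ NA)%N; pose a := ((j - OFF) %% NA)%N.
  have aN : (a < NA)%N by rewrite ltn_mod NAE.
  have jE : j = cell a u.
    by rewrite /cell -addnA [(NA * u)%N]mulnC -divn_eq subnKC.
  have un : (u <= n)%N.
    by move: jle; rewrite jE /cell NAE; move: (u) (a) => x y; clear; lia.
  rewrite jE mc // in mj; have [ea|na] := eqVneq a aOut; last first.
    by move: mj; rewrite clean.
  have un' : (u < n)%N.
    by move: jle; rewrite jE ea /cell NAE /aOut; move: (u) => x; clear; lia.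
  rewrite ea (out (Ordinal un')) in mj; move: mj; case: ifP => // uC [E].
  by have -> : i = Ordinal un' by apply: val_inj; rewrite /= -E.
exists (cell aOut i); last by rewrite mc ?out ?iC // NAE.
by rewrite mem_iota /cell NAE /aOut /OFF; have := ltn_ord i; clear; lia.
Qed.

Lemma agree_finish s m : agree s m -> exists m',
  [/\ reach machine 200 (RamState end_pc m) (RamState (end_pc + 200) m'),
    ram_step machine (RamState (end_pc + 200) m') = None,
    m' 0%N = sc s 5%N, forall j, (0 < j < OFF)%N -> m' j = -1
    & forall a i, (a < NA)%N -> m' (cell a i) = ar s a i].
Proof.
move=> [a0 a1 av aa]; have [_ _ _ _ C] := machine_code.
move: end_pc C => p; rewrite /epilogue -cat_cons code_at_cat => -[C1 C2].
set c1 := _ :: _ in C1 C2; have sz : size c1 = 200%N by [].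
have R := reach_straight m C1 isT; rewrite sz in R C2.
have nE : nth IHalt machine (p + 200) = IHalt by move: C2; rewrite code_at_cons => -[].
have mE x : foldl exec1 m c1 x = if x \in iota 1 199 then -1 else upd m 0 (m 7%N + m 0%N) x.
  exact: (foldl_const (iota 1 199) (-1) (exec1 m (IAdd 0 7 0)) x).
exists (foldl exec1 m c1); split=> //.
- by rewrite /ram_step /= nE.
- by rewrite mE [_ \in _]/= upd_eq a0 addr0 (av 5%N).
- by move=> j /andP[j0 jO]; rewrite mE mem_iota; case: ifP => // /negP[]; rewrite j0.
Qed.

(* There is a RAM program running in polynomial time (in the bit size of the
   encoded instance) that, on every feasible colorful k-center instance,
   outputs a set C with |C| <= k whose balls of radius 3 rho^* cover at least
   r red and at least b blue points. *)
Theorem theorem1 :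
  exists (prog : seq instr) (c : nat),
  forall (n : nat) (d : 'I_n -> 'I_n -> rat) (red : 'I_n -> bool) (k r b : nat),
    is_metric d ->
    (exists rho : rat, solvable d red k r b rho) ->
    exists s' : ram_state,
      ram_run prog (c * (input_size (encode d red k r b)).+1 ^ c)
              (init_state (encode d red k r b)) = Some s'
      /\ forall rho_star : rat, is_opt_radius d red k r b rho_star ->
           is_solution d red k r b (decode_output n s') (3%:R * rho_star).
Proof.
have [c Tc] := polyb_time; exists machine, c => n d red k r b dm [rho sol].
set code := encode d red k r b; set I := input_size code.
suff [s' R] : exists2 s', reach machine (time I) (init_state code) s' /\ ram_step machine s' = None
    & forall rho_star : rat, is_opt_radius d red k r b rho_star ->
           is_solution d red k r b (decode_output n s') (3%:R * rho_star).
  move=> H; exists s'; split=> //; case: R => R1 R2.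
  by apply: reach_run R2; apply: reach_le R1; apply: Tc.
(* Without points the machine stops right after its first test, and feasibility forces r = b = 0. *)
have [n0|n0] := posnP n.
  have [C0 _ _ _ _] := machine_code; move: C0; rewrite !code_at_cons => -[E0 [E1 _]].
  exists (RamState 1 (fun i => nth 0 code i)).
    split; last by rewrite /ram_step [pc _]/= E1.
    apply: (@reach_le _ 1); first exact: time_gt0.
    by apply: reach_skip E0 _ _; [rewrite /= n0|apply: reach_refl].
  have card0 (A : {set 'I_n}) : #|A| = 0%N.
    by apply/eqP; rewrite -leqn0 -[X in (_ <= X)%N]n0 -[X in (_ <= X)%N]card_ord max_card.
  case: sol => _ [C [_ r0 b0]] rs _; rewrite !card0 in r0 b0.
  by split; rewrite ?card0.
pose inp i := nth 0 code i; pose f i := inp i == 1.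
have szc := size_encode d red k r b; have lI := len_input_size d red k r b.
have inp0 : inp 0%N = n%:Z by [].
have bI i : (i < 4 + n + (n * n + n * n))%N -> (bitlen (inp i) <= I)%N.
  by rewrite -szc; apply: bitlen_size.
have inpf i : (4 <= i < 4 + n)%N -> inp i = (f i)%:Z.
  move=> /andP[i4 il]; have lt : (i - 4 < n)%N by move: i4 il; clear; lia.
  have E : i = (4 + Ordinal lt)%N by rewrite /= subnKC.
  by rewrite /f /inp E inp_redE; case: (red _).
have [m [SZ [R1 rd]]] := load_ok n0 lI inp0 bI inpf.
have [m1 [s [R2 A1 E1]]] := main_ok lI inp0 rd.
have [m2 [R3 halt h0 hlo hc]] := agree_finish A1.
exists (RamState (end_pc + 200) m2).
  by split; last exact: halt; rewrite /time; exact: (reach_trans (reach_trans R1 R2) R3).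
move=> rs opt.
have q0 : sc (run cSearch s) 0%N = n%:Z by rewrite search_ro ?(ein0 E1).
have q1 : sc (run cSearch s) 1%N = n.+1%:Z by rewrite search_ro ?(ein1 E1).
have [c1 c2 c3] := cleanP q0 q1.
have nSZ : (n <= SZ)%N by case/andP: (rd_n rd).
have denb i j : denq (d i j) < (2 ^ SZ)%N%:Z.
  have [_ <-] := inp_distE d red k r b i j; apply: (rd_lt rd).
  have : (n * i + j < n * n)%N.
    have := ltn_ord i; have := ltn_ord j => hj hi.
    by apply: leq_trans (_ : n * i + n <= _)%N; nia.
  by move: (n * i + j)%N (n * n)%N => p q; clear; lia.
have [C out sC] := @searchP n SZ inp d red k r b dm erefl erefl erefl
  (inp_redE d red k r b) (fun i j => (inp_distE d red k r b i j).1)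
  (fun i j => (inp_distE d red k r b i j).2) nSZ denb s rs E1 opt n0.
have out' : outset (run cClean (run cSearch s)) C.
  by move=> j; rewrite (c3 _ (ltn_ord j)); exact: out.
by rewrite (decode_ok _ (etrans h0 c1) hlo hc c2 out'); exact: sC.
Qed.
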